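(* Let $\beta\in(1,2)$ be such that $\epsilon(1,\beta)=\epsilon_1(1,\beta)\cdots\epsilon_m(1,\beta)0^\infty$ for some integer $m\ge2$ with $\epsilon_m(1,\beta)=1$, and let $a\in[0,1]$. Then $$\dim_HF_{\beta,a}=\frac{1}{\log\beta}\cdot\max\Big\{h_\mu(\sigma):\mu\in\mathcal{M}_\sigma(S_\beta),\ \mu[0]=a,\ \mu \text{ is an } (m-1)\text{-Markov measure}\Big\}.$$ More concretely, $$\dim_HF_{\beta,a}=\frac{1}{\log\beta}\cdot\max\Big\{\mathfrak{h}_\mu(\beta,m):\mu\text{ is a }(\beta,m,a)\text{-coordinated set function}\Big\},$$ where for a set function $\mu$ from $\{[w]:w\in\bigcup_{n=1}^m\Sigma_\beta^n\}$ to $[0,1]$, $$\mathfrak{h}_\mu(\beta,m):=-\sum_{w_1\cdots w_m\in\Sigma_\beta^m}\mu[w_1\cdots w_m]\log\frac{\mu[w_1\cdots w_m]}{\mu[w_1\cdots w_{m-1}]},$$ and $\mu$ is called $(\beta,m,a)$-coordinated if $$\mu[0]=a,\quad\mu[1]=1-a,\quad\sum_{\substack{v=0,1\\ wv\in\Sigma_\beta^*}}\mu[wv]=\mu[w]\quad\text{and}\quad\sum_{\substack{u=0,1\\ uw\in\Sigma_\beta^*}}\mu[uw]=\mu[w]$$ for all $w\in\bigcup_{n=1}^{m-1}\Sigma_\beta^n$.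
   Context: Let $\beta\in(1,2)$ and $\mathbb{N}=\{1,2,3,\dots\}$. The $\beta$-transformation $T_\beta:[0,1]\to[0,1]$ is $T_\beta(x):=\beta x-\lfloor\beta x\rfloor$. For $x\in[0,1]$ and $n\in\mathbb{N}$ put $\epsilon_n(x,\beta):=\lfloor\beta T_\beta^{n-1}(x)\rfloor$; the sequence $\epsilon(x,\beta)=\epsilon_1(x,\beta)\epsilon_2(x,\beta)\cdots$ is the (greedy) $\beta$-expansion of $x$. Here $0^\infty$ denotes the infinite sequence of zeros. Frequency set: $F_{\beta,a}:=\{x\in[0,1):\lim_{n\to\infty}\frac1n\#\{1\le k\le n:\epsilon_k(x,\beta)=0\}=a\}$; $\dim_H$ is Hausdorff dimension in $\mathbb{R}$ (with $\dim_H\emptyset=0$). The alphabet is $\mathcal{A}_\beta=\{0,1\}$, and $\mathcal{A}_\beta^{\mathbb{N}}$ carries the metric $d_\beta(w,v):=\beta^{-\inf\{k\ge0:\,w_{k+1}\ne v_{k+1}\}}$ (equal to $0$ when $w=v$). A sequence $w\in\mathcal{A}_\beta^{\mathbb{N}}$ is admissible if there is $x\in[0,1)$ with $\epsilon_i(x,\beta)=w_i$ for all $i\in\mathbb{N}$; $\Sigma_\beta$ is the set of admissible sequences and $S_\beta$ its closure in $(\mathcal{A}_\beta^{\mathbb{N}},d_\beta)$. A word $w\in\mathcal{A}_\beta^n$ is admissible if there is $x\in[0,1)$ with $\epsilon_i(x,\beta)=w_i$ for $1\le i\le n$; $\Sigma_\beta^n$ is the set of admissible words of length $n$ and $\Sigma_\beta^*:=\bigcup_{n\ge1}\Sigma_\beta^n$.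 For $w\in\Sigma_\beta^*$ of length $n$, the cylinder is $[w]:=\{v\in S_\beta:v_i=w_i\text{ for }1\le i\le n\}$, and $\mu[w]$ means $\mu([w])$. $\sigma$ is the shift $\sigma(w_1w_2\cdots)=w_2w_3\cdots$, restricted to $S_\beta$ (where $\sigma(S_\beta)=S_\beta$). $\mathcal{M}_\sigma(S_\beta)$ is the set of $\sigma$-invariant Borel probability measures on $S_\beta$, and $h_\mu(\sigma)$ is the measure-theoretic entropy of $\sigma$ with respect to $\mu$. For $k\in\mathbb{N}$, $\mu\in\mathcal{M}_\sigma(S_\beta)$ is a $k$-Markov measure if $$\mu[w_1\cdots w_n]=\mu[w_1\cdots w_{n-1}]\cdot\frac{\mu[w_{n-k}\cdots w_n]}{\mu[w_{n-k}\cdots w_{n-1}]}$$ for all $w_1\cdots w_n\in\Sigma_\beta^n$ with $n>k$, where the right-hand side is regarded as $0$ if any of the measures occurring in it is $0$. Conventions: $0\log0$, $0\log\frac00$, $\max\emptyset$ and $\sup\emptyset$ are regarded as $0$. *)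

(* Defs.v *)
From HB Require Import structures.
From mathcomp Require Import all_boot all_order all_algebra.
From mathcomp Require Import all_classical all_reals all_analysis.

Set Implicit Arguments.
Unset Strict Implicit.
Unset Printing Implicit Defensive.

Import Order.TTheory GRing.Theory Num.Theory.
Import numFieldNormedType.Exports.

Local Open Scope classical_set_scope.
Local Open Scope ring_scope.

Section beta_expansion.
Context {R : realType} (beta : R).

Definition beta_map (x : R) : R := beta * x - (Num.floor (beta * x))%:~R.

(* Digits are numbered from 1; the value at [n = 0] is not meaningful. *)
Definition digit (x : R) (n : nat) : int :=
  Num.floor (beta * iter n.-1 beta_map x).

Definition frequency_set (a : R) : set R :=
  [set x | 0 <= x < 1 /\
    (fun n => (\sum_(1 <= k < n.+1) (digit x k == 0%Z))%N%:R / n%:R : R)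
      @ \oo --> a].

(* The alphabet {0,1} is [bool], and the entry [w i] of a sequence
   [w : nat -> bool] is the symbol of index [i + 1]. *)
Definition admissible_seq (w : nat -> bool) : Prop :=
  exists2 x : R, 0 <= x < 1 & forall i, digit x i.+1 = (w i : nat)%:Z.

Definition admissible_word (w : seq bool) : Prop :=
  exists2 x : R, 0 <= x < 1 &
    forall i, (i < size w)%N -> digit x i.+1 = (nth false w i : nat)%:Z.

End beta_expansion.

Section hausdorff_dimension.
Context {R : realType}.
Local Open Scope ereal_scope.

(* [diam set0] is [-oo]. *)
Definition diam (U : set R) : \bar R :=
  ereal_sup [set (`|p.1 - p.2|%R)%:E | p in U `*` U].

(* The empty set contributes 0 for every [s], including [s = 0]. *)
Definition diam_pow (s : R) (U : set R) : \bar R :=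
  if U == set0 then 0 else diam U `^ s.

Definition hausdorff_premeasure (s delta : R) (A : set R) : \bar R :=
  ereal_inf [set \sum_(0 <= i <oo) diam_pow s (U i) |
    U in [set U : nat -> set R |
           A `<=` \bigcup_i U i /\ forall i, diam (U i) <= delta%:E]].

Definition hausdorff_measure (s : R) (A : set R) : \bar R :=
  ereal_sup [set hausdorff_premeasure s delta A | delta in [set e : R | (0 < e)%R]].

Definition hausdorff_dim (A : set R) : \bar R :=
  ereal_inf [set s%:E | s in [set s : R | (0 <= s)%R /\ hausdorff_measure s A = 0]].

End hausdorff_dimension.

Section entropy.
Context d (T : measurableType d) (R : realType).
Variables (mu : probability T R) (f : T -> T).

Definition invariant_measure : Prop :=
  forall A : set T, measurable A -> mu (f @^-1` A) = mu A.

Definition measurable_partition (I : finType) (P : I -> set T) : Prop :=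
  [/\ forall i, measurable (P i), trivIset setT P & \bigcup_i P i = setT].

(* [ln 0 = 0], hence [0 * ln 0 = 0]. *)
Definition partition_entropy (I : finType) (P : I -> set T) : R :=
  - \sum_(i : I) fine (mu (P i)) * ln (fine (mu (P i))).

(* The common refinement of the preimages of [P] under the first [n] iterates
   of [f], indexed by itineraries. *)
Definition iterated_join (I : finType) (P : I -> set T) (n : nat) :
    {ffun 'I_n -> I} -> set T :=
  fun u => \bigcap_(i : 'I_n) iter i f @^-1` P (u i).

Definition entropy_wrt (I : finType) (P : I -> set T) : R :=
  limn (fun n => partition_entropy (@iterated_join I P n) / n%:R : R).

Definition entropy : \bar R :=
  ereal_sup [set h | exists (k : nat) (P : 'I_k -> set T),
    measurable_partition P /\ h = (entropy_wrt P)%:E].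

End entropy.

(* The distance depends on [beta], and is a metric because [1 < beta]; both are
   recorded in the type so that the metric structure can be canonical. *)
Definition seq_space {R : realType} {beta : R} (hbeta : 1 < beta < 2) : Type :=
  nat -> bool.

Section seq_space_metric.
Context {R : realType} {beta : R} (hbeta : 1 < beta < 2).
Implicit Types w v : seq_space hbeta.

Definition seq_dist w v : R :=
  if pselect (exists k, w k != v k) is left ex then beta ^- ex_minn ex else 0.

Let beta_gt1 : 1 < beta. Proof. by case/andP: hbeta. Qed.
Let beta_gt0 : 0 < beta. Proof. exact: lt_trans beta_gt1. Qed.

Lemma seq_dist_ge w v n : w n != v n -> beta ^- n <= seq_dist w v.
Proof.
move=> wvn; rewrite /seq_dist; case: pselect => [ex|]; last by case; exists n.
case: ex_minnP => k _ /(_ n wvn) kn.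
by rewrite lef_pV2 ?posrE ?exprn_gt0// ler_weXn2l// ltW.
Qed.

Lemma seq_dist_cases w v :
  (w = v /\ seq_dist w v = 0) \/
  (exists2 n, w n != v n & seq_dist w v = beta ^- n).
Proof.
rewrite /seq_dist; case: pselect => [ex|nex].
  by right; case: ex_minnP => k wvk _; exists k.
left; split=> //; apply: funext => k; apply/eqP.
by apply: contrapT => /negP ne; apply: nex; exists k.
Qed.

Lemma seq_dist_ge0 w v : 0 <= seq_dist w v.
Proof.
by case: (seq_dist_cases w v) => [[_ ->]//|[n _ ->]]; rewrite invr_ge0 exprn_ge0// ltW.
Qed.

Lemma seq_distxx w : seq_dist w w = 0.
Proof. by case: (seq_dist_cases w w) => [[]//|[n]]; rewrite eqxx. Qed.

Lemma seq_dist_eq0 w v : seq_dist w v = 0 -> w = v.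
Proof.
case: (seq_dist_cases w v) => [[]//|[n _ ->]] /eqP.
by rewrite invr_eq0 expf_eq0 gt_eqF// andbF.
Qed.

Lemma seq_dist_sym w v : seq_dist w v = seq_dist v w.
Proof.
wlog: w v / seq_dist w v <= seq_dist v w => [H|].
  by case: (leP (seq_dist w v) (seq_dist v w)) => [/H//|/ltW/H].
case: (seq_dist_cases v w) => [[-> _]//|[n vwn e]] le1.
by apply/eqP; rewrite eq_le le1 e seq_dist_ge// eq_sym.
Qed.

Lemma seq_dist_triangle v w u : seq_dist w u <= seq_dist w v + seq_dist v u.
Proof.
case: (seq_dist_cases w u) => [[_ ->]|[n wun ->]].
  by rewrite addr_ge0 ?seq_dist_ge0.
have [wvn|wvn] := eqVneq (w n) (v n).
  by rewrite -[leLHS]add0r lerD ?seq_dist_ge0// seq_dist_ge// -wvn.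
by rewrite -[leLHS]addr0 lerD ?seq_dist_ge0// seq_dist_ge.
Qed.

HB.instance Definition _ := gen_eqMixin (seq_space hbeta).
HB.instance Definition _ := gen_choiceMixin (seq_space hbeta).
HB.instance Definition _ := isMetric.Build R (seq_space hbeta)
  seq_distxx seq_dist_eq0 seq_dist_sym seq_dist_triangle.

End seq_space_metric.

Section beta_shift_system.
Context {R : realType} {beta : R} (hbeta : 1 < beta < 2).

Definition Sigma_beta : set (seq_space hbeta) := [set w | admissible_seq beta w].

Definition S_beta : set (seq_space hbeta) := closure Sigma_beta.

Definition shift_seq (w : seq_space hbeta) : seq_space hbeta := fun i => w i.+1.

Let beta_gt1 : 1 < beta. Proof. by case/andP: hbeta. Qed.
Let beta_gt0 : 0 < beta. Proof. exact: lt_trans beta_gt1. Qed.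

Lemma Sigma_beta_zeros : Sigma_beta (fun=> false).
Proof.
exists 0; first by rewrite lexx ltr01.
move=> i; rewrite /digit /=; suff -> : iter i (beta_map beta) 0 = 0.
  by rewrite mulr0 floor0.
by elim: i => //= i ->; rewrite /beta_map mulr0 floor0 subr0.
Qed.

Lemma Sigma_beta_shift w : Sigma_beta w -> Sigma_beta (shift_seq w).
Proof.
case=> x _ xw; exists (beta_map beta x).
  by rewrite /beta_map subr_ge0 floor_le_tmp ltrBlDl -intrD1 lt_succ_floor.
by move=> i; rewrite -xw /digit /= -iterSr.
Qed.

Lemma seq_dist_shift (w v : seq_space hbeta) :
  seq_dist (shift_seq w) (shift_seq v) <= beta * seq_dist w v.
Proof.
have [[_ ->]|[n wvn ->]] := seq_dist_cases (shift_seq w) (shift_seq v).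
  by rewrite mulr_ge0 ?seq_dist_ge0// ltW.
by rewrite -ler_pdivrMl// -invfM -exprS seq_dist_ge.
Qed.

Lemma S_beta_shift w : S_beta w -> S_beta (shift_seq w).
Proof.
move=> Sw B /nbhs_ballP[e /= e0 eB].
have de : 0 < e / beta by rewrite divr_gt0.
have [v [Sv]] := Sw _ (nbhsx_ballx w _ de).
rewrite ballEmdist /= => wv; exists (shift_seq v); split; first exact: Sigma_beta_shift.
apply: eB; rewrite ballEmdist /=.
by apply: le_lt_trans (seq_dist_shift w v) _; rewrite mulrC -ltr_pdivlMr.
Qed.

Definition beta_shift_space : Type := set_type S_beta.

HB.instance Definition _ := Topological.on beta_shift_space.
HB.instance Definition _ := isPointed.Build beta_shift_space
  (SigSub (mem_set (subset_closure Sigma_beta_zeros)) : set_type S_beta).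

Definition beta_shift (w : beta_shift_space) : beta_shift_space :=
  SigSub (mem_set (S_beta_shift (set_mem (valP w)))) : set_type S_beta.

Definition cylinder (w : seq bool) : set beta_shift_space :=
  [set v | forall i, (i < size w)%N -> (val v : nat -> bool) i = nth false w i].

Definition borel_beta_shift : Type :=
  g_sigma_algebraType [set U : set beta_shift_space | open U].

HB.instance Definition _ := Measurable.on borel_beta_shift.

(* The words extracted from [w = w_1 ... w_n] are, in this order,
   [w_1 ... w_(n-1)], [w_(n-k) ... w_n] and [w_(n-k) ... w_(n-1)]. Division by 0
   yields 0, so the right-hand side is 0 as soon as one of its terms is. *)
Definition markov_measure (k : nat) (mu : probability borel_beta_shift R) : Prop :=
  forall w : seq bool, admissible_word beta w -> (k < size w)%N ->
  let n := size w in
  let p u := fine (mu (cylinder u)) in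
  p w = p (take n.-1 w) *
        (p (drop (n - k.+1) w) / p (drop (n - k.+1) (take n.-1 w))).

(* A set function on cylinders is the restriction of a function on all sets;
   only its values on the cylinders of admissible words of length 1 to [m] are
   ever used. *)
Definition cylinder_set_function (m : nat) (mu : set beta_shift_space -> R) : Prop :=
  forall w : seq bool, admissible_word beta w -> (1 <= size w <= m)%N ->
  0 <= mu (cylinder w) <= 1.

Definition coordinated (m : nat) (a : R) (mu : set beta_shift_space -> R) : Prop :=
  [/\ mu (cylinder [:: false]) = a,
      mu (cylinder [:: true]) = 1 - a &
      forall w : seq bool, admissible_word beta w -> (1 <= size w <= m.-1)%N ->
        \sum_(v : bool | `[< admissible_word beta (rcons w v) >])
            mu (cylinder (rcons w v)) = mu (cylinder w) /\
        \sum_(u : bool | `[< admissible_word beta (u :: w) >])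
            mu (cylinder (u :: w)) = mu (cylinder w)].

Definition cylinder_entropy (m : nat) (mu : set beta_shift_space -> R) : R :=
  - \sum_(w : m.-tuple bool | `[< admissible_word beta w >])
      mu (cylinder w) *
      ln (mu (cylinder w) / mu (cylinder (take m.-1 w))).

End beta_shift_system.

(* [M] is the maximum of [A], which is attained; the maximum of the empty set is
   by convention 0. *)
Definition is_max {R : realType} (A : set (\bar R)) (M : \bar R) : Prop :=
  (A !=set0 -> A M /\ ubound A M) /\ (A = set0 -> M = 0%E).

(* Main.v *)
Require Import Defs.
From mathcomp Require Import all_boot all_order all_algebra.
From mathcomp Require Import all_classical all_reals all_analysis.
From mathcomp Require Import zify ring lra.

Set Implicit Arguments.
Unset Strict Implicit.
Unset Printing Implicit Defensive.

Import Order.TTheory GRing.Theory Num.Theory.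
Import numFieldNormedType.Exports.

Local Open Scope classical_set_scope.
Local Open Scope ring_scope.

(** Let [e] be the expansion of 1, which ends at rank [m]. A sequence lies in
    [S_beta] if and only if each of its blocks of length [m] has value less
    than 1 in base [beta] ([good], [admissible_wordP], [S_betaP]). So the shift
    only has memory [m - 1], and after [m] zeros a good sequence can be
    continued by any other ([good_join]).

    The two maxima are taken over the same set of numbers, [block_values]. What
    an invariant measure prescribes on cylinders of length at most [m], and what
    a coordinated set function is, is a [block_law] [q]. Its Markov extension is
    the only law with memory [m - 1] that has these values; it is stationary, it
    is the law of a Borel probability ([law_realized]), and its entropy is the
    increment [block_entropy m q] of word entropy between the lengths [m - 1]
    and [m] ([markov_entropy], [shift_entropy]). The maximum is attained because
    the block laws of frequency [a] form a compact set, on which this entropy is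
    continuous ([max_block_entropy]). Call it [M].

    Upper bound. The type of a word [w] is the block law of the frequencies of
    words in the cyclic word [w0^m]. In the Markov extension of its own type a
    word of length [n] has probability about [exp (- n h)], where [h] is the
    entropy of the type; hence a type is shared by at most about [exp (n h)]
    words, and there are only polynomially many types. By compactness, a word
    whose frequency of zeros is near [a] has a type of entropy nearly at most
    [M] ([card_near_words]). Covering the frequency set by the cylinders of such
    words, of diameter at most [beta ^- n], bounds its dimension by [M / ln beta]
    ([frequency_dim_le]).

    Lower bound. Draw independent long words from the Markov extension of an
    optimal [q] and separate them by [m] zeros. By the law of large numbers this
    yields, for each large [j], about [exp (j M)] words of length [j] of
    frequency near [a] that can be concatenated freely ([many_words]).
    Concatenate one of them for each [j], chosen uniformly and independently,
    with a tolerance that tends to 0: the resulting sequences have frequency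
    exactly [a], and a cylinder of length [n] has probability at most
    [C exp (- n rho)] for any given [rho < M] ([moran_law_le]). As a set of
    diameter less than [beta ^- (n + m)] meets at most two cylinders of length
    [n] ([two_prefixes]), the dimension is at least [rho / ln beta]
    ([mass_distribution], [frequency_dim_ge]).

    When no block law has frequency [a], the covering argument applies with
    [M = 0], which is the conventional maximum. *)

(** * Greedy digits and good sequences *)

Definition shiftn (k : nat) (w : nat -> bool) : nat -> bool :=
  fun i => w (k + i)%N.

Section good_sequences.
Context {R : realType} (beta : R) (hbeta : 1 < beta < 2).
Implicit Types (w v y : nat -> bool) (x : R).

Let beta_gt1 : 1 < beta. Proof. by case/andP: hbeta. Qed.
Let beta_gt0 : 0 < beta. Proof. exact: lt_trans beta_gt1. Qed.
Let beta_lt2 : beta < 2. Proof. by case/andP: hbeta. Qed.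
Let betaX_gt0 n : 0 < beta ^+ n. Proof. exact: exprn_gt0. Qed.

Definition bval (n : nat) w : R := \sum_(j < n) (w j)%:R / beta ^+ j.+1.

(** When the expansion of 1 ends at rank [m], these are the points of [S_beta];
    the condition only looks at windows of length [m]. *)
Definition good (m : nat) w : Prop := forall k, bval m (shiftn k w) < 1.

Lemma eq_bval n w v : (forall i, (i < n)%N -> w i = v i) -> bval n w = bval n v.
Proof. by move=> wv; apply: eq_bigr => i _; rewrite wv. Qed.

Lemma bval0 w : bval 0 w = 0. Proof. by rewrite /bval big_ord0. Qed.

Lemma bval_ge0 n w : 0 <= bval n w.
Proof. by apply: sumr_ge0 => i _; rewrite divr_ge0// ltW. Qed.

Lemma bvalD n k w : bval (n + k) w = bval n w + bval k (shiftn n w) / beta ^+ n.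
Proof.
rewrite /bval big_split_ord /=; congr (_ + _).
rewrite mulr_suml; apply: eq_bigr => i _.
by rewrite -mulrA -invfM -exprD /shiftn /= addSn addnC.
Qed.

Lemma bval1 w : bval 1 w = (w 0%N)%:R / beta.
Proof. by rewrite /bval big_ord1 expr1. Qed.

Lemma bvalS n w : bval n.+1 w = (w 0%N)%:R / beta + bval n (shiftn 1 w) / beta.
Proof. by rewrite -add1n bvalD bval1 expr1. Qed.

Lemma bvalSr n w : bval n.+1 w = bval n w + (w n)%:R / beta ^+ n.+1.
Proof. by rewrite /bval big_ord_recr. Qed.

Lemma bval_homo n k w : (n <= k)%N -> bval n w <= bval k w.
Proof.
move=> nk; rewrite -(subnKC nk) bvalD lerDl.
by rewrite divr_ge0 ?bval_ge0// ltW.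
Qed.

Lemma ler_bval n w v : (forall i, w i -> v i) -> bval n w <= bval n v.
Proof.
move=> wv; apply: ler_sum => i _; rewrite ler_pM2r ?invr_gt0//.
by rewrite ler_nat; case: (w i) (wv i) => //= ->.
Qed.

Lemma good_le m w v : (forall i, w i -> v i) -> good m v -> good m w.
Proof.
move=> wv gv k; apply: le_lt_trans (gv k); apply: ler_bval => i.
exact: wv.
Qed.

Lemma good_shift m k w : good m w -> good m (shiftn k w).
Proof.
move=> gw j; have := gw (k + j)%N; congr (_ < _); apply: eq_bval => i _.
by rewrite /shiftn addnA.
Qed.

Lemma eq_good m w v : w =1 v -> good m w -> good m v.
Proof. by move=> wv gw; have <- : w = v by apply/funext. Qed.

(** A block that begins with 0 is only a contraction of the block following it,
    so zeros inserted in front of a good tail cannot break goodness. *)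
Lemma good_join m (u : seq bool) y :
    good m (nth false u) ->
    (forall i, (i < size u + m)%N -> y i = nth false u i) ->
    good m (shiftn (size u + m) y) -> good m y.
Proof.
move=> gu yu gy k.
have tail j : (size u + m <= j)%N -> bval m (shiftn j y) < 1.
  move=> uj; have := gy (j - (size u + m))%N; congr (_ < _).
  by apply: eq_bval => i _; rewrite /shiftn addnA subnKC.
have [ku|uk] := ltnP k (size u).
  rewrite (eq_bval (v := shiftn k (nth false u))) ?gu// => i im.
  by rewrite /shiftn yu//; lia.
have [d] := ubnP (size u + m - k)%N.
elim: d k uk => // d IH k uk kd.
have [/tail//|km] := leqP (size u + m) k.
have yk : y k = false by rewrite yu// nth_default.
have := bval_homo (shiftn k y) (leqnSn m).
rewrite bvalS [shiftn k y 0%N]/shiftn addn0 yk mul0r add0r => h.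
have shE : bval m (shiftn 1 (shiftn k y)) = bval m (shiftn k.+1 y).
  by apply: eq_bval => i _; rewrite /shiftn; congr y; lia.
rewrite shE in h.
have lt1 : bval m (shiftn k.+1 y) < 1 by apply: IH; lia.
apply: le_lt_trans h _; rewrite ltr_pdivrMr// mul1r.
exact: lt_trans lt1 beta_gt1.
Qed.

(** ** Digits *)

Definition dig x (i : nat) : bool := digit beta x i.+1 == 1%Z.

Lemma beta_map_bound x : 0 <= beta_map beta x < 1.
Proof.
by rewrite /beta_map subr_ge0 floor_le_tmp ltrBlDl -intrD1 lt_succ_floor.
Qed.

Lemma iter_bound x n : 0 <= x <= 1 -> 0 <= iter n (beta_map beta) x <= 1.
Proof.
case: n => [//|n] _; rewrite iterS.
by case/andP: (beta_map_bound (iter n (beta_map beta) x)) => -> /ltW ->.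
Qed.

Lemma iter_bound_lt x n : 0 <= x < 1 -> 0 <= iter n (beta_map beta) x < 1.
Proof. by case: n => [//|n] _; rewrite iterS beta_map_bound. Qed.

Lemma digitE x i : 0 <= x <= 1 -> digit beta x i.+1 = (dig x i : nat)%:Z.
Proof.
move=> x01; rewrite /dig /digit /=.
have /andP[t0 t1] := iter_bound i x01; set t := iter _ _ _ in t0 t1 *.
have f0 : 0%Z <= Num.floor (beta * t) by rewrite floor_ge0 mulr_ge0// ltW.
have f1 : Num.floor (beta * t) < 2%Z.
  rewrite floor_lt_int; apply: le_lt_trans beta_lt2.
  by rewrite -[leRHS]mulr1 ler_pM2l.
by case: (Num.floor _) f0 f1 => [[|[|n]]|n].
Qed.

Lemma beta_mapE x : 0 <= x <= 1 -> beta_map beta x = beta * x - (dig x 0)%:R.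
Proof.
by move=> x01; rewrite /beta_map; have := digitE 0 x01; rewrite /digit /= => ->.
Qed.

Lemma dig_iter x k i : dig (iter k (beta_map beta) x) i = dig x (k + i)%N.
Proof. by rewrite /dig /digit /= -iterD addnC. Qed.

Lemma bval_dig x n : 0 <= x <= 1 ->
  x = bval n (dig x) + iter n (beta_map beta) x / beta ^+ n.
Proof.
move=> x01; elim: n => [|n IH]; first by rewrite bval0 add0r expr0 divr1.
rewrite {1}IH bvalSr -addrA; congr (_ + _).
rewrite iterS beta_mapE ?iter_bound// dig_iter addn0 exprS.
by field; rewrite (gt_eqF (betaX_gt0 n)) (gt_eqF beta_gt0).
Qed.

Lemma bval_dig_le x n : 0 <= x <= 1 -> bval n (dig x) <= x.
Proof.
move=> x01; rewrite {2}(bval_dig n x01) lerDl divr_ge0 ?(ltW (betaX_gt0 _))//.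
by case/andP: (iter_bound n x01).
Qed.

Lemma bval_dig_gt x n : 0 <= x < 1 -> x < bval n (dig x) + (beta ^+ n)^-1.
Proof.
move=> x01; have x01' : 0 <= x <= 1 by case/andP: x01 => -> /ltW ->.
rewrite {1}(bval_dig n x01') ltrD2l ltr_pdivrMr// mulVf ?gt_eqF//.
by case/andP: (iter_bound_lt n x01).
Qed.

Lemma good_dig m x : 0 <= x < 1 -> good m (dig x).
Proof.
move=> x01 k; have /andP[t0 t1] := iter_bound_lt k x01.
apply: le_lt_trans t1.
rewrite (eq_bval (v := dig (iter k (beta_map beta) x))); last first.
  by move=> i _; rewrite dig_iter.
by apply: bval_dig_le; rewrite t0 ltW// (andP (iter_bound_lt k x01)).2.
Qed.

(** In [g i = (y i + g i.+1) / beta] with [0 <= g i.+1 < 1], the digit [y i] can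
    only be the integer part of [beta * g i], so [g] is the orbit of its first
    term. *)
Lemma coding (y : nat -> bool) (g : nat -> R) :
    (forall i, g i = (y i)%:R / beta + g i.+1 / beta) ->
    (forall i, 0 <= g i < 1) ->
  forall i, iter i (beta_map beta) (g 0%N) = g i /\ dig (g 0%N) i = y i.
Proof.
move=> gE g01.
have fl i : Num.floor (beta * g i) = (y i : nat)%:Z.
  apply/eqP; rewrite floor_eq; have /andP[g0 g1] := g01 i.+1.
  have -> : beta * g i = (y i)%:R + g i.+1.
    by rewrite gE; field; rewrite gt_eqF.
  by rewrite intrD lerDl g0 ltrD2l.
have it i : iter i (beta_map beta) (g 0%N) = g i.
  elim: i => // i IH; rewrite iterS IH /beta_map fl gE.
  by rewrite mulrDr !(mulrCA beta) divff ?gt_eqF// !mulr1 /= addrC addKr.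
by move=> i; split; rewrite ?it// /dig /digit /= it fl; case: (y i).
Qed.

(** ** Expansions of 1 that terminate *)

Section finite_expansion.
Context (m : nat).
Hypotheses (hm : (2 <= m)%N) (hdigit : digit beta 1 m = 1%Z)
  (hfinite : forall i : nat, (m < i)%N -> digit beta 1 i = 0%Z).

Let e := dig 1.
Let one01 : 0 <= (1 : R) <= 1. Proof. by rewrite ler01 lexx. Qed.

(** All digits of the remainder of order [m] vanish, hence so does it. *)
Lemma bval_one : bval m e = 1.
Proof.
pose y := iter m (beta_map beta) 1.
have y01 : 0 <= y <= 1 by exact: iter_bound.
have y0 n : bval n (dig y) = 0.
  rewrite (eq_bval (v := fun=> false)).
    by rewrite /bval big1// => i _; rewrite mul0r.
  by move=> i _; rewrite dig_iter /dig hfinite//; lia.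
have {}y0 : y = 0.
  apply/eqP; rewrite eq_le (andP y01).1 andbT; apply/ler_addgt0Pr => d d0.
  have bi : `|beta^-1| < 1.
    by rewrite gtr0_norm ?invr_gt0// invf_lt1.
  have := cvg_expr bi => /cvgrPdist_lt/(_ _ d0)[N _ /(_ N (leqnn N))] /=.
  rewrite sub0r normrN => bN; rewrite add0r (bval_dig N y01) y0 add0r -exprVn.
  have b0 : 0 <= beta^-1 ^+ N by rewrite exprn_ge0// invr_ge0 ltW.
  rewrite ger0_norm// in bN; apply: le_trans (ltW bN).
  by apply: ler_piMl => //; case/andP: (iter_bound N y01).
by have := bval_dig m one01; rewrite -/y y0 mul0r addr0.
Qed.

(** Both have digits 0 and 1 and the value of [w] is less, so they differ within
    [m] digits. Where they first differ, [e] cannot have the 0: its tail is worth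
    less than one digit, so [w] would not be worth less. *)
Lemma good_false_first w : good m w ->
  exists k, [/\ (k < m)%N, forall i, (i < k)%N -> w i = e i, w k = false & e k].
Proof.
move=> /(_ 0%N).
rewrite (eq_bval (v := w))// => w1.
have ex : exists k, w k != e k.
  apply: contrapT => nex; move: w1; rewrite (eq_bval (v := e)).
    by rewrite bval_one ltxx.
  by move=> i _; apply: contrapT => /eqP ne; apply: nex; exists i.
case: (ex_minnP ex) => k wk mink.
have agree i : (i < k)%N -> w i = e i.
  by move=> ik; apply/eqP; apply: contraLR ik => /mink; rewrite -leqNgt.
have km : (k < m)%N.
  rewrite ltnNge; apply/negP => mk; move: w1; rewrite (eq_bval (v := e)).
    by rewrite bval_one ltxx.
  by move=> i im; apply: agree; apply: leq_trans im mk.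
case: (boolP (e k)) => ek; first by exists k; split => //; move: wk; rewrite ek; case: (w k).
have {}wk : w k = true by move: wk; case: (e k) ek; case: (w k).
exfalso; move: w1; apply/negP; rewrite -leNgt.
apply: le_trans (bval_homo w km); rewrite bvalSr wk (eq_bval agree).
rewrite {1}(bval_dig k one01) lerD2l.
set t := iter k (beta_map beta) 1.
have [t0 t1] := andP (beta_map_bound t).
move: t1; rewrite beta_mapE ?iter_bound// dig_iter addn0 -/e (negbTE ek) subr0 => t1.
rewrite exprS invfM mulrA ler_pM2r ?invr_gt0// ler_pdivlMr//.
by rewrite mulrC ltW.
Qed.

(** Compare a good sequence with the expansion of 1 up to their first
    difference: there the good sequence has 0 against 1, and this gap of one
    digit pays for the whole tail, which by induction is worth less than 1. *)
Lemma good_bval_lt1 n w : good m w -> bval n w < 1.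
Proof.
have [N] := ubnP n; elim: N n w => // N IH n w nN gw.
have [k [km agree wk ek]] := good_false_first gw.
have ek1 : bval k.+1 e <= 1 by rewrite -bval_one; exact: bval_homo.
have ek0 : bval k e < bval k.+1 e.
  by rewrite bvalSr ek mul1r ltrDl invr_gt0.
have [nk|kn] := leqP n k.
  rewrite (eq_bval (v := e)); last by move=> i ik; apply: agree; lia.
  by apply: le_lt_trans (bval_homo _ nk) (lt_le_trans ek0 ek1).
rewrite -(subnKC kn) bvalD bvalSr wk mul0r addr0 (eq_bval agree).
apply: lt_le_trans ek1; rewrite bvalSr ek ltrD2l ltr_pM2r ?invr_gt0//.
by apply: IH; [lia|exact: good_shift].
Qed.

Lemma admissible_wordP (w : seq bool) :
  admissible_word beta w <-> good m (nth false w).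
Proof.
split=> [[x x01 xw]|gw].
  apply: good_le (good_dig m x01) => i wi.
  have iw : (i < size w)%N by rewrite ltnNge; apply/negP => /(nth_default false) ; rewrite wi.
  by rewrite /dig xw// wi.
pose g i := bval (size w) (shiftn i (nth false w)).
have gE i : g i = (nth false w i)%:R / beta + g i.+1 / beta.
  have sh : bval (size w).+1 (shiftn i (nth false w)) = g i.
    rewrite bvalSr /shiftn nth_default ?mul0r ?addr0//; lia.
  rewrite -sh bvalS /shiftn addn0; congr (_ + _ / _); apply: eq_bval => j _.
  by rewrite /shiftn; congr nth; lia.
have g01 i : 0 <= g i < 1.
  by rewrite bval_ge0 good_bval_lt1//; exact: good_shift.
exists (g 0%N) => // i iw; rewrite digitE; last by case/andP: (g01 0%N) => -> /ltW ->.
by rewrite (coding gE g01 i).2.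
Qed.

(** ** Values of infinite good sequences *)

Definition seqval w : R := limn (fun n => bval n w).

Lemma is_cvg_bval w : good m w -> cvgn (fun n => bval n w).
Proof.
move=> gw; apply: nondecreasing_is_cvgn.
  by move=> n k; exact: bval_homo.
by exists 1 => _ [n _ <-]; exact/ltW/good_bval_lt1.
Qed.

Lemma bval_le_seqval n w : good m w -> bval n w <= seqval w.
Proof.
move=> gw; apply: nondecreasing_cvgn_le (is_cvg_bval gw) n.
by move=> i j; exact: bval_homo.
Qed.

Lemma seqval_ge0 w : good m w -> 0 <= seqval w.
Proof. by move=> gw; have := bval_le_seqval 0 gw; rewrite bval0. Qed.

Lemma seqval_le1 w : good m w -> seqval w <= 1.
Proof.
move=> gw; apply: limr_le (is_cvg_bval gw) _.
by near=> n; exact/ltW/good_bval_lt1.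
Unshelve. all: by end_near. Qed.

Lemma seqvalD n w : good m w -> seqval w = bval n w + seqval (shiftn n w) / beta ^+ n.
Proof.
move=> gw; apply/cvg_lim => //; rewrite -(cvg_shiftn n) /=.
under eq_fun do rewrite addnC bvalD.
apply: cvgD; first exact: cvg_cst.
apply: cvgMr_tmp; exact: is_cvg_bval (good_shift n gw).
Qed.

(** In the limit only the weak inequality survives: the sequence that repeats
    [e_1 ... e_(m-1) 0] is good and its value is 1. A window of zeros is a place
    where the inequality is strict, and comparisons with [e] carry it back to the
    beginning. *)
Lemma seqval_lt1 w q : good m w ->
  (forall i, (q <= i < q + m)%N -> w i = false) -> seqval w < 1.
Proof.
move=> gw wq.
have st i : (i < q + m)%N -> seqval (shiftn i w) < 1.
  move=> iq; have [d] := ubnP (q + m - i)%N; elim: d i iq => // d IH i iq id.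
  have gi := good_shift i gw.
  have [k [km agree wk ek]] := good_false_first gi.
  have step : seqval (shiftn (i + k.+1) w) < 1 \/ k = 0%N ->
      seqval (shiftn i w) < 1.
    have shE : shiftn k.+1 (shiftn i w) = shiftn (i + k.+1) w.
      by apply/funext => j; rewrite /shiftn addnA.
    case=> [lt1|k0].
      rewrite (seqvalD k.+1 gi) shE bvalSr wk mul0r addr0 (eq_bval agree).
      have ek1 : bval k.+1 e <= 1 by rewrite -bval_one; exact: bval_homo.
      apply: lt_le_trans ek1; rewrite bvalSr ek ltrD2l ltr_pM2r ?invr_gt0//.
    move: wk; rewrite k0 => wk0.
    rewrite (seqvalD 1 gi) bval1 wk0 mul0r add0r expr1.
    rewrite ltr_pdivrMr// mul1r; apply: le_lt_trans beta_gt1.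
    exact/seqval_le1/good_shift.
  have [qi|iq'] := leqP q i; last by apply: step; left; apply: IH; lia.
  apply: step; right.
  case: k {km wk ek} agree => // k /(_ 0%N isT).
  rewrite /shiftn addn0 wq ?qi// => e0.
  suff : e 0%N by rewrite -e0.
  rewrite /e /dig /digit /= mulr1.
  by rewrite floor_eq ltW//= intrD1.
have := st 0%N; rewrite (_ : shiftn 0 w = w)//; apply; lia.
Qed.

Lemma seqval_digits w :
    good m w -> (forall n, exists q, forall i, (n + q <= i < n + q + m)%N -> w i = false) ->
  0 <= seqval w < 1 /\ forall i, digit beta (seqval w) i.+1 = (w i : nat)%:Z.
Proof.
move=> gw wz; pose g i := seqval (shiftn i w).
have gE i : g i = (w i)%:R / beta + g i.+1 / beta.
  rewrite /g (seqvalD 1 (good_shift i gw)) bval1 /shiftn addn0 expr1.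
  congr (_ + seqval _ / _); apply/funext => j; congr w; lia.
have g01 i : 0 <= g i < 1.
  have gi := good_shift i gw; rewrite seqval_ge0//=.
  have [q wq] := wz i; apply: (@seqval_lt1 _ q) => // j jq.
  by rewrite /shiftn wq//; lia.
have g0 : g 0%N = seqval w by [].
rewrite -g0; split => [//|i]; rewrite digitE ?(coding gE g01 i).2//.
by case/andP: (g01 0%N) => -> /ltW ->.
Qed.

End finite_expansion.
End good_sequences.

(** * Laws on finite words *)

Section xlnx.
Context {R : realType}.
Implicit Type x : R.

(** The library has [ln x = 0] for [x <= 0], hence this function vanishes there
    and is continuous on the whole line. *)
Definition xlnx x : R := x * ln x.

Lemma xlnx0 : xlnx 0 = 0. Proof. by rewrite /xlnx mul0r. Qed.

Lemma xlnx_le0 x : x <= 1 -> xlnx x <= 0.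
Proof.
move=> x1; rewrite /xlnx; have [x0|x0] := ltP 0 x.
  by rewrite pmulr_rle0// ln_le0.
by rewrite ln0// mulr0.
Qed.

(** Superadditivity of [x ln x] is why entropy grows under refinement. *)
Lemma xlnx_sum (I : finType) (P : pred I) (F : I -> R) :
  (forall i, 0 <= F i) -> \sum_(i | P i) xlnx (F i) <= xlnx (\sum_(i | P i) F i).
Proof.
move=> F0; rewrite [leRHS]/xlnx mulr_suml; apply: ler_sum => i Pi.
have [Fi0|Fi0] := ltP 0 (F i); last first.
  have -> : F i = 0 by apply/eqP; rewrite eq_le Fi0 F0.
  by rewrite xlnx0 mul0r.
have le : F i <= \sum_(j | P j) F j.
  by rewrite (bigD1 i)//= lerDl; exact: sumr_ge0.
by rewrite /xlnx ler_pM2l// ler_ln// posrE// (lt_le_trans Fi0 le).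
Qed.

Lemma gibbs (I : finType) (a b : I -> R) :
    (forall i, 0 <= a i) -> (forall i, 0 <= b i) ->
    (forall i, 0 < a i -> 0 < b i) -> \sum_i b i <= \sum_i a i ->
  - \sum_i xlnx (a i) <= - \sum_i a i * ln (b i).
Proof.
move=> a0 b0 ab sab; rewrite lerN2 -subr_ge0 -sumrB.
apply: (@le_trans _ _ (\sum_i (a i - b i))).
  by rewrite sumrB subr_ge0.
apply: ler_sum => i _; have [ai|ai] := ltP 0 (a i); last first.
  have -> : a i = 0 by apply/eqP; rewrite eq_le ai a0.
  by rewrite xlnx0 mul0r subr0 sub0r oppr_le0.
have bi := ab _ ai; have x0 : 0 < b i / a i by rewrite divr_gt0.
have x1 : -1 < b i / a i - 1 by rewrite ltrBrDr addrC subrr.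
have := ler_wpM2l (ltW ai) (le_ln1Dx x1).
rewrite [1 + _]addrC subrK ln_div ?posrE// => h.
have e : a i * (b i / a i - 1) = b i - a i by field; rewrite gt_eqF.
by rewrite e mulrBr in h; rewrite /xlnx; lra.
Qed.

End xlnx.

Section tuple_sums.
Context {R : realType} {A : finType}.
Implicit Type f : seq A -> R.

Lemma sum_tuple0 f : \sum_(w : 0.-tuple A) f w = f [::].
Proof. by rewrite (big_pred1 [tuple]) // => w; apply/esym/eqP; rewrite [w]tuple0. Qed.

Lemma sum_tuple_cons f n :
  \sum_(w : n.+1.-tuple A) f w = \sum_(w : n.-tuple A) \sum_(a : A) f (a :: w).
Proof.
rewrite (reindex (fun x : A * n.-tuple A => cons_tuple x.1 x.2)) /=.
  by rewrite -(pair_bigA _ (fun a (w : n.-tuple A) => f (a :: w))) /= exchange_big.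
exists (fun w : n.+1.-tuple A => (thead w, behead_tuple w)) => [[b w] _|w _] /=.
  by congr (_, _); apply/val_inj.
by apply/val_inj; case/tupleP: w.
Qed.

Lemma sum_tuple_rcons f n :
  \sum_(w : n.+1.-tuple A) f w = \sum_(w : n.-tuple A) \sum_(a : A) f (rcons w a).
Proof.
elim: n f => [|n IH] f.
  rewrite sum_tuple_cons (sum_tuple0 (fun w => \sum_a f (a :: w))).
  by rewrite (sum_tuple0 (fun w => \sum_a f (rcons w a))).
rewrite sum_tuple_cons exchange_big /=.
under eq_bigr => a _ do rewrite (IH (fun w => f (a :: w))).
by rewrite exchange_big (sum_tuple_cons (fun w => \sum_a f (rcons w a))).
Qed.

Lemma sum_tuple_cat f n k :
  \sum_(w : (n + k).-tuple A) f w =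
  \sum_(u : n.-tuple A) \sum_(v : k.-tuple A) f (u ++ v).
Proof.
elim: n f => [|n IH] f.
  by rewrite (sum_tuple0 (fun u => \sum_(v : k.-tuple A) f (u ++ v))).
rewrite sum_tuple_cons exchange_big /=.
under eq_bigr => a _ do rewrite (IH (fun w => f (a :: w))).
by rewrite exchange_big (sum_tuple_cons (fun u => \sum_(v : k.-tuple A) f (u ++ v))).
Qed.

End tuple_sums.

Section word_sums.
Context {R : realType}.
Implicit Types (f g p q : seq bool -> R) (w u : seq bool).

Lemma sum_word_cons f n :
  \sum_(w : n.+1.-tuple bool) f w =
  \sum_(w : n.-tuple bool) (f (false :: w) + f (true :: w)).
Proof.
by rewrite sum_tuple_cons; apply: eq_bigr => w _; rewrite big_bool addrC.
Qed.

Lemma sum_word_rcons f n :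
  \sum_(w : n.+1.-tuple bool) f w =
  \sum_(w : n.-tuple bool) (f (rcons w false) + f (rcons w true)).
Proof.
by rewrite sum_tuple_rcons; apply: eq_bigr => w _; rewrite big_bool addrC.
Qed.

Record law p : Prop := Law {
  law0 : p [::] = 1;
  law_ge0 : forall w, 0 <= p w;
  law_rcons : forall w, p (rcons w false) + p (rcons w true) = p w }.

Lemma law_sum p n : law p -> \sum_(w : n.-tuple bool) p w = 1.
Proof.
move=> lp; elim: n => [|n IH]; first by rewrite sum_tuple0 law0.
by rewrite sum_word_rcons; under eq_bigr do rewrite law_rcons//.
Qed.

Lemma law_rcons_le p w b : law p -> p (rcons w b) <= p w.
Proof.
move=> lp; rewrite -(law_rcons lp w).
by case: b; rewrite ?lerDl ?lerDr law_ge0.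
Qed.

Lemma law_cat_le p w u : law p -> p (w ++ u) <= p w.
Proof.
move=> lp; elim/last_ind: u => [|u b IH]; first by rewrite cats0.
by rewrite -rcons_cat; apply: le_trans IH; exact: law_rcons_le.
Qed.

Lemma law_le1 p w : law p -> p w <= 1.
Proof. by move=> lp; rewrite -(law0 lp) -[w]cat0s law_cat_le. Qed.

Lemma law_cat_sum p n w : law p -> \sum_(u : n.-tuple bool) p (w ++ u) = p w.
Proof.
move=> lp; elim: n => [|n IH].
  by rewrite (sum_tuple0 (fun u => p (w ++ u))) cats0.
rewrite (sum_word_rcons (fun u => p (w ++ u))) -IH; apply: eq_bigr => u _.
by rewrite -!rcons_cat law_rcons.
Qed.

Record stationary p : Prop := Stationary {
  st_law :> law p;
  st_cons : forall w, p (false :: w) + p (true :: w) = p w }.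

Lemma stationary_drop p g n k : stationary p ->
  \sum_(w : (n + k).-tuple bool) p w * g (drop n w) =
  \sum_(w : k.-tuple bool) p w * g w.
Proof.
move=> sp; elim: n => [|n IH]; first by under eq_bigr do rewrite drop0.
rewrite addSn (sum_word_cons (fun w => p w * g (drop n.+1 w))) /= -IH.
by apply: eq_bigr => w _; rewrite -mulrDl st_cons.
Qed.

Definition zeros w : nat := count negb w.

Lemma stationary_zeros p n : stationary p ->
  \sum_(w : n.-tuple bool) p w * (zeros w)%:R = n%:R * p [:: false].
Proof.
move=> sp; elim: n => [|n IH].
  by rewrite (sum_tuple0 (fun w => p w * (zeros w)%:R)) /= mulr0 mul0r.
rewrite (sum_word_cons (fun w => p w * (zeros w)%:R)) /=.
under eq_bigr do rewrite add0n add1n -natr1 mulrDr mulr1 addrAC -mulrDl (st_cons sp).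
rewrite big_split /= IH -natr1 mulrDl mul1r; congr (_ + _).
exact: (law_cat_sum n [:: false] sp).
Qed.

(** Words are coded by nested intervals: the interval of [w0] is the left part
    of that of [w], and the interval of [w1] the right part. *)
Definition left_end p w : R :=
  \sum_(i < size w | nth false w i) p (rcons (take i w) false).

Lemma left_end_rcons p w b :
  left_end p (rcons w b) = left_end p w + (if b then p (rcons w false) else 0).
Proof.
rewrite /left_end size_rcons big_mkcond big_ord_recr /= nth_rcons ltnn eqxx.
rewrite -{3}cats1 takel_cat// take_size; congr (_ + _).
rewrite [RHS]big_mkcond; apply: eq_bigr => i _ /=.
by rewrite nth_rcons ltn_ord -[rcons w b]cats1 takel_cat// ltnW.
Qed.

Fixpoint code_path p (t : R) n : seq bool :=
  if n is n'.+1 then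
    let w := code_path p t n' in rcons w (left_end p w + p (rcons w false) <= t)
  else [::].

Definition codeseq p t : nat -> bool := fun i => nth false (code_path p t i.+1) i.

Lemma size_code_path p t n : size (code_path p t n) = n.
Proof. by elim: n => //= n IH; rewrite size_rcons IH. Qed.

Lemma mkseq_code p t n : mkseq (codeseq p t) n = code_path p t n.
Proof.
elim: n => // n IH; rewrite /mkseq -addn1 iotaD map_cat /= add0n cats1.
rewrite -/(mkseq _ n) IH addn1 /=; congr rcons.
by rewrite /codeseq /= nth_rcons size_code_path ltnn eqxx.
Qed.

Lemma code_path_bounds p t n : law p -> 0 <= t < 1 ->
  left_end p (code_path p t n) <= t <
    left_end p (code_path p t n) + p (code_path p t n).
Proof.
move=> lp t01; elim: n => [|n /andP[IH1 IH2]].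
  by rewrite /= /left_end big_ord0 law0// add0r.
rewrite /=; set w := code_path p t n in IH1 IH2 *.
case: (leP (left_end p w + p (rcons w false)) t) => h; rewrite left_end_rcons.
  by rewrite h/= -addrA law_rcons.
by rewrite addr0 IH1.
Qed.

Lemma code_prefixP p t w : law p -> 0 <= t < 1 ->
  (mkseq (codeseq p t) (size w) == w) = (left_end p w <= t < left_end p w + p w).
Proof.
move=> lp t01; rewrite mkseq_code; apply/eqP/idP => [<-|]; first exact: code_path_bounds.
elim/last_ind: w => // w b IH; rewrite left_end_rcons => /andP[t1 t2].
have -> : code_path p t (size (rcons w b)) =
  rcons (code_path p t (size w)) (left_end p (code_path p t (size w)) +
    p (rcons (code_path p t (size w)) false) <= t) by rewrite size_rcons.
rewrite IH; last first.
  rewrite -(law_rcons lp); case: b t1 t2 => t1 t2.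
    by apply/andP; split; [apply: le_trans t1; rewrite lerDl law_ge0|lra].
  have h := law_ge0 lp (rcons w true).
  by apply/andP; split; lra.
congr rcons; case: b t1 t2 => [-> //|_]; rewrite addr0 => t2.
by apply/negbTE; rewrite -ltNge.
Qed.

Lemma code_prefix_gt0 p t n : law p -> 0 <= t < 1 -> 0 < p (mkseq (codeseq p t) n).
Proof.
move=> lp t01; have := code_path_bounds n lp t01; rewrite mkseq_code.
by move=> /andP[t1 t2]; have := le_lt_trans t1 t2; rewrite ltrDl.
Qed.

(** ** Entropy of words *)

Definition word_entropy p n : R := - \sum_(w : n.-tuple bool) xlnx (p w).

Lemma word_entropy_ge0 p n : law p -> 0 <= word_entropy p n.
Proof.
by move=> lp; rewrite oppr_ge0; apply: sumr_le0 => w _; rewrite xlnx_le0// law_le1.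
Qed.

Lemma word_entropy_le p n k : law p -> word_entropy p n <= word_entropy p (n + k).
Proof.
move=> lp; rewrite lerN2 (sum_tuple_cat (fun w => xlnx (p w))); apply: ler_sum => u _.
rewrite -(law_cat_sum k u lp); apply: xlnx_sum => v; exact: law_ge0.
Qed.

End word_sums.

(** * Block laws and their Markov extensions *)

Section block_laws.
Context {R : realType} (beta : R) (m : nat).
Hypothesis hm : (2 <= m)%N.
Implicit Types (q : seq bool -> R) (w u : seq bool).

(** A coordinated set function seen as a function of words, with value 1 on the
    empty word and 0 on inadmissible words. *)
Record block_law q : Prop := BlockLaw {
  bl0 : q [::] = 1;
  bl_ge0 : forall w, (size w <= m)%N -> 0 <= q w;
  bl_supp : forall w, (size w <= m)%N -> q w != 0 -> good beta m (nth false w);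
  bl_rcons : forall w, (size w < m)%N -> q (rcons w false) + q (rcons w true) = q w;
  bl_cons : forall w, (size w < m)%N -> q (false :: w) + q (true :: w) = q w }.

Definition block_entropy q : R := word_entropy q m - word_entropy q m.-1.

(** Each letter is drawn according to the [m.-1] letters before it, and the first
    letters according to all letters before them. *)
Definition markov_ext q w : R :=
  \prod_(i < size w) (q (drop (i.+1 - m) (take i.+1 w)) /
                      q (drop (i.+1 - m) (take i w))).

Section one_law.
Variables (q : seq bool -> R) (bq : block_law q).

Lemma bl_rcons_le w b : (size w < m)%N -> q (rcons w b) <= q w.
Proof.
move=> wm; rewrite -(bl_rcons bq wm).
by case: b; rewrite ?lerDl ?lerDr bl_ge0// size_rcons.
Qed.

Lemma bl_cons_le w b : (size w < m)%N -> q (b :: w) <= q w.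
Proof.
move=> wm; rewrite -(bl_cons bq wm).
by case: b; rewrite ?lerDl ?lerDr bl_ge0.
Qed.

Lemma bl_le1 w : (size w <= m)%N -> q w <= 1.
Proof.
elim: w => [_|b w IH wm]; first by rewrite (bl0 bq).
exact: le_trans (bl_cons_le _ wm) (IH (ltnW wm)).
Qed.

Lemma bl_rcons_eq0 w b : (size w < m)%N -> q w = 0 -> q (rcons w b) = 0.
Proof.
move=> wm w0; apply/eqP; rewrite eq_le bl_ge0 ?size_rcons// andbT.
by rewrite -w0 bl_rcons_le.
Qed.

Lemma bl_cons_eq0 w b : (size w < m)%N -> q w = 0 -> q (b :: w) = 0.
Proof.
move=> wm w0; apply/eqP; rewrite eq_le bl_ge0// andbT.
by rewrite -w0 bl_cons_le.
Qed.

Lemma markov_ext_rcons w b :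
  markov_ext q (rcons w b) = markov_ext q w *
    (q (drop ((size w).+1 - m) (rcons w b)) / q (drop ((size w).+1 - m) w)).
Proof.
have tk k : (k <= size w)%N -> take k (rcons w b) = take k w.
  by move=> kw; rewrite -cats1 takel_cat.
have tS : take (size w).+1 (rcons w b) = rcons w b by rewrite -(size_rcons w b) take_size.
rewrite /markov_ext size_rcons big_ord_recr /= tS tk// take_size; congr (_ * _).
by apply: eq_bigr => i _; rewrite !tk// ltnW.
Qed.

Lemma markov_ext_small w : (size w <= m)%N -> markov_ext q w = q w.
Proof.
elim/last_ind: w => [_|w b IH]; first by rewrite /markov_ext big_ord0 (bl0 bq).
rewrite size_rcons => wm; rewrite markov_ext_rcons IH 1?ltnW//.
have -> : ((size w).+1 - m = 0)%N by apply/eqP; rewrite subn_eq0.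
rewrite !drop0; have [w0|w0] := eqVneq (q w) 0.
  by rewrite w0 mul0r bl_rcons_eq0.
by rewrite mulrCA divff// mulr1.
Qed.

Lemma markov_ext_ge0 w : 0 <= markov_ext q w.
Proof.
apply: prodr_ge0 => i _; apply: divr_ge0; apply: bl_ge0 => //;
  rewrite size_drop size_take_min; lia.
Qed.

Lemma markov_ext_eq0_block w k : (k + m <= size w)%N ->
  q (take m (drop k w)) = 0 -> markov_ext q w = 0.
Proof.
move=> km q0; have im : (k + m.-1 < size w)%N by lia.
apply/eqP/prodf_eq0; exists (Ordinal im) => //=.
have -> : ((k + m.-1).+1 - m = k)%N by lia.
have -> : (k + m.-1).+1 = (m + k)%N by lia.
by rewrite -take_drop q0 mul0r.
Qed.

(** Without this the conditional laws of the last letter, which are 0 after a word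
    of probability 0, would not add up. *)
Lemma markov_ext_eq0 w : q (drop ((size w).+1 - m) w) = 0 -> markov_ext q w = 0.
Proof.
move=> q0; have [wm|mw] := ltnP (size w) m.
  rewrite markov_ext_small 1?ltnW//; move: q0.
  have -> : ((size w).+1 - m = 0)%N by lia.
  by rewrite drop0.
apply: (@markov_ext_eq0_block _ (size w - m)%N); first lia.
rewrite take_oversize ?size_drop; last lia.
have lt : (size w - m < size w)%N by lia.
rewrite (drop_nth false lt) -subSn// bl_cons_eq0// size_drop; lia.
Qed.

Lemma markov_ext_law : law (markov_ext q).
Proof.
split=> [|w|w]; first by rewrite /markov_ext big_ord0.
  exact: markov_ext_ge0.
rewrite !markov_ext_rcons -mulrDr -mulrDl.
have sz : (size (drop ((size w).+1 - m) w) < m)%N by rewrite size_drop; lia.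
rewrite !drop_rcons ?bl_rcons//; last 2 first.
- by lia.
- by lia.
have [q0|q0] := eqVneq (q (drop ((size w).+1 - m) w)) 0.
  by rewrite (markov_ext_eq0 q0) mul0r.
by rewrite divff// mulr1.
Qed.

(** Stationarity propagates along the Markov property: prepending a letter does
    not change the conditional law of the last one once the word is long. *)
Lemma markov_ext_stationary : stationary (markov_ext q).
Proof.
split; first exact: markov_ext_law.
have m0 : (0 < m)%N by lia.
elim/last_ind => [|w b IH].
  by rewrite !markov_ext_small ?(bl_cons bq).
have [wm|mw] := ltnP (size (rcons w b)) m.
  by rewrite !markov_ext_small ?(bl_cons bq)//= ltnW.
rewrite -!rcons_cons !markov_ext_rcons /= -IH mulrDl.
by move: mw; rewrite size_rcons => mw; rewrite (subSn mw) /= -mulrDl.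
Qed.

Lemma markov_ext_supp w : markov_ext q w != 0 -> good beta m (nth false w).
Proof.
move=> w0; have [wm|mw] := leqP (size w) m.
  by apply: (bl_supp bq) => //; rewrite -markov_ext_small.
have blk k : (k + m <= size w)%N -> good beta m (nth false (take m (drop k w))).
  move=> km; apply: (bl_supp bq); first by rewrite size_take_min geq_minl.
  by apply: contraNneq w0 => /(markov_ext_eq0_block km) ->.
move=> k; have [km|km] := leqP (k + m) (size w).
  have := blk k km 0%N; congr (_ < _); apply: eq_bval => i im.
  by rewrite /shiftn add0n nth_take// nth_drop.
have sm : (size w - m + m <= size w)%N by lia.
have := blk _ sm (k - (size w - m))%N; congr (_ < _); apply: eq_bval => i im.
rewrite /shiftn take_oversize ?size_drop; last lia.
by rewrite nth_drop; congr nth; lia.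
Qed.

Lemma block_entropyE : block_entropy q =
  - \sum_(w : m.-tuple bool) q w * ln (q w / q (take m.-1 w)).
Proof.
have m1 : m = m.-1.+1 by lia.
rewrite /block_entropy /word_entropy opprK addrC -opprB; congr (- _).
have sumE f : \sum_(w : m.-tuple bool) f (w : seq bool) =
    \sum_(w : m.-1.-tuple bool) (f (rcons w false) + f (rcons w true)) :> R.
  by rewrite -sum_word_rcons -m1.
rewrite (sumE (fun w => xlnx (q w))) (sumE (fun w => q w * ln (q w / q (take m.-1 w)))).
rewrite -sumrB; apply: eq_bigr => w _.
have wm : (size w < m)%N by rewrite size_tuple; lia.
have term b : q (rcons w b) * ln (q (rcons w b) / q (take m.-1 (rcons w b))) =
    xlnx (q (rcons w b)) - q (rcons w b) * ln (q w).
  rewrite -cats1 takel_cat ?size_tuple// take_oversize ?size_tuple// cats1.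
  have [q0|q0] := eqVneq (q (rcons w b)) 0; first by rewrite q0 xlnx0 !mul0r subrr.
  have qw : q w != 0 by apply: contra_neq q0 => /bl_rcons_eq0 ->.
  have pos u : (size u <= m)%N -> q u != 0 -> 0 < q u.
    by move=> um u0; rewrite lt_neqAle eq_sym u0 bl_ge0.
  by rewrite ln_div ?posrE ?pos ?size_rcons// 1?ltnW// mulrBr.
by rewrite !term addrACA -opprD -mulrDl bl_rcons.
Qed.

Lemma block_entropy_ge0 : 0 <= block_entropy q.
Proof.
rewrite block_entropyE oppr_ge0; apply: sumr_le0 => w _.
have wm : (size w <= m)%N by rewrite size_tuple.
have tm : (size (take m.-1 w) < m)%N by rewrite size_take_min size_tuple; lia.
have [q0|q0] := eqVneq (q w) 0; first by rewrite q0 mul0r.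
have qw : 0 < q w by rewrite lt_neqAle eq_sym q0 bl_ge0.
rewrite pmulr_rle0// ln_le0//.
have lt : q w <= q (take m.-1 w).
  have sz : (m.-1 < size w)%N by rewrite size_tuple; lia.
  rewrite -{1}(cat_take_drop m.-1 w) (drop_nth false sz) drop_oversize ?size_tuple; last lia.
  by rewrite cats1 bl_rcons_le.
by rewrite ler_pdivrMr ?mul1r// (lt_le_trans qw).
Qed.

(** By stationarity the last [m] letters of a long word have law [q], and the last
    of them only depends on these. *)
Lemma markov_entropyS n : (m <= n.+1)%N ->
  word_entropy (markov_ext q) n.+1 = word_entropy (markov_ext q) n + block_entropy q.
Proof.
move=> mn; pose g u := ln (q u / q (take m.-1 u)).
have nE : n.+1 = (n.+1 - m + m)%N by lia.
have marg : \sum_(w : n.+1.-tuple bool) markov_ext q w * g (drop (n.+1 - m) w) =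
    - block_entropy q.
  have h := stationary_drop g (n.+1 - m) m markov_ext_stationary.
  rewrite -nE in h; rewrite h block_entropyE opprK.
  by apply: eq_bigr => w _; rewrite markov_ext_small// size_tuple.
apply/eqP; rewrite -subr_eq; apply/eqP; rewrite -[RHS]opprK -marg.
rewrite /word_entropy opprK addrC.
rewrite (sum_word_rcons (fun w => xlnx (markov_ext q w))).
rewrite (sum_word_rcons (fun w => markov_ext q w * g (drop (n.+1 - m) w))).
rewrite -sumrB -[RHS]sumrN; apply: eq_bigr => w _.
have lM := markov_ext_law.
have term b : xlnx (markov_ext q (rcons w b)) =
   markov_ext q (rcons w b) * ln (markov_ext q w) +
   markov_ext q (rcons w b) * g (drop (n.+1 - m) (rcons w b)).
  have [M0|M0] := eqVneq (markov_ext q (rcons w b)) 0; first by rewrite M0 xlnx0 !mul0r addr0.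
  rewrite /xlnx -mulrDr; congr (_ * _).
  move: M0; rewrite markov_ext_rcons size_tuple.
  rewrite mulf_eq0 negb_or => /andP[Mw]; rewrite mulf_eq0 invr_eq0 negb_or => /andP[q1 q2].
  have sz : (size (drop (n.+1 - m) w) < m)%N by rewrite size_drop size_tuple; lia.
  have szr : (size (drop (n.+1 - m) (rcons w b)) <= m)%N.
    by rewrite size_drop size_rcons size_tuple; lia.
  rewrite lnM ?posrE; last 2 first.
  - by rewrite lt_neqAle eq_sym Mw law_ge0.
  - by rewrite divr_gt0// lt_neqAle eq_sym ?q1 ?q2 bl_ge0// ltnW.
  congr (_ + _); rewrite /g; congr (ln (_ / q _)).
  rewrite drop_rcons ?size_tuple; last lia.
  rewrite -cats1 takel_cat ?size_drop ?size_tuple; last lia.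
  by rewrite take_oversize// size_drop size_tuple; lia.
rewrite !term -(law_rcons lM w) /xlnx mulrDl.
by rewrite (law_rcons lM w) opprD; ring.
Qed.

Lemma markov_entropy n :
  word_entropy (markov_ext q) (n + m.-1) =
  word_entropy (markov_ext q) m.-1 + n%:R * block_entropy q.
Proof.
elim: n => [|n IH]; first by rewrite add0n mul0r addr0.
by rewrite addSn markov_entropyS ?IH -?natr1; [ring|lia].
Qed.

End one_law.
End block_laws.

(** * The Borel structure of the shift space *)

Section shift_space.
Context {R : realType} {beta : R} (hbeta : 1 < beta < 2) (m : nat).
Hypotheses (hm : (2 <= m)%N) (hdigit : digit beta 1 m = 1%Z)
  (hfinite : forall i : nat, (m < i)%N -> digit beta 1 i = 0%Z).

Let beta_gt1 : 1 < beta. Proof. by case/andP: hbeta. Qed.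
Let beta_gt0 : 0 < beta. Proof. exact: lt_trans beta_gt1. Qed.

Local Notation space := (beta_shift_space hbeta).
Local Notation borel := (borel_beta_shift hbeta).

Definition letters (v : space) : nat -> bool := val v.

Lemma seq_dist_small (w v : seq_space hbeta) n :
  (forall i, (i < n)%N -> w i = v i) -> seq_dist w v <= beta ^- n.
Proof.
move=> wv; case: (seq_dist_cases w v) => [[_ ->]|[k wk ->]].
  by rewrite invr_ge0 exprn_ge0// ltW.
rewrite lef_pV2 ?posrE ?exprn_gt0// ler_weXn2l// 1?ltW//.
by rewrite leqNgt; apply: contra wk => /wv ->.
Qed.

Lemma seq_dist_agree (w v : seq_space hbeta) n i :
  seq_dist w v < beta ^- n -> (i <= n)%N -> w i = v i.
Proof.
move=> d im; apply: contraTeq d => ne; rewrite -leNgt.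
apply: le_trans (seq_dist_ge ne).
by rewrite lef_pV2 ?posrE ?exprn_gt0// ler_weXn2l// ltW.
Qed.

Lemma betaN_small (d : R) : 0 < d -> exists n, beta ^- n < d.
Proof.
move=> d0; have bi : `|beta^-1| < 1.
  by rewrite gtr0_norm ?invr_gt0// invf_lt1.
have := cvg_expr bi => /cvgrPdist_lt/(_ _ d0)[N _ /(_ N (leqnn N))] /=.
rewrite sub0r normrN exprVn ger0_norm ?invr_ge0 ?exprn_ge0 1?ltW// => h.
by exists N.
Qed.

(** Goodness passes to limits because it concerns finite windows. Conversely, a
    good sequence is the limit of its truncations, which end in zeros and thus are
    the digits of their values. *)
Lemma S_betaP (w : seq_space hbeta) : S_beta w <-> good beta m w.
Proof.
split=> [Sw k|gw B /nbhs_ballP[d /= d0 dB]].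
  have d0 : 0 < beta ^- (k + m) by rewrite invr_gt0 exprn_gt0.
  have [v [[x x01 xv]]] := Sw _ (nbhsx_ballx w _ d0).
  rewrite ballEmdist /= => wv.
  have gv : good beta m v.
    apply: eq_good (good_dig hbeta m x01) => i.
    by rewrite /dig xv; case: (v i).
  have := gv k; congr (_ < _); apply: eq_bval => i im.
  by rewrite /shiftn (seq_dist_agree wv)//; lia.
have [n nd] := betaN_small d0.
pose u := mkseq w n; pose v : seq_space hbeta := nth false u.
have uE i : (i < n)%N -> nth false u i = w i by move=> lt; rewrite nth_mkseq.
have gu : good beta m v.
  apply: (good_le hbeta _ gw) => i; have [lt|ge] := ltnP i n; first by rewrite /v uE.
  by rewrite /v nth_default// size_mkseq.
exists v; split; last first.
  apply: dB; rewrite ballEmdist /=; apply: le_lt_trans nd.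
  by apply: seq_dist_small => i lt; rewrite /v uE.
have [n'|v01 vd] := seqval_digits hbeta hm hdigit hfinite gu; last by exists (seqval beta v).
by exists n => i /andP[i1 i2]; rewrite /v nth_default// size_mkseq; lia.
Qed.

Lemma val_good (v : space) : good beta m (letters v).
Proof. by apply/S_betaP; exact: set_mem (valP v). Qed.

Definition to_shift_space (w : nat -> bool) : space :=
  if pselect (S_beta (w : seq_space hbeta)) is left Sw then SigSub (mem_set Sw) : set_type _
  else point.

Lemma to_shift_spaceK w : good beta m w -> letters (to_shift_space w) = w.
Proof. by move=> gw; rewrite /letters /to_shift_space; case: pselect => // -[]; apply/S_betaP. Qed.

Lemma cylinderP (v : space) w :
  cylinder w v <-> forall i, (i < size w)%N -> letters v i = nth false w i.
Proof. by []. Qed.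

Lemma cylinderE (v : space) w :
  cylinder w v <-> mkseq (letters v) (size w) = w.
Proof.
split=> [/cylinderP cv|wE]; last first.
  by apply/cylinderP => i iw; rewrite -[in RHS]wE nth_mkseq.
apply: (@eq_from_nth _ false); rewrite size_mkseq// => i iw.
by rewrite nth_mkseq// cv.
Qed.

Lemma cylinder_nil : cylinder [::] = [set: space].
Proof. by apply/seteqP; split. Qed.

Lemma cylinder_good w (v : space) : cylinder w v -> good beta m (nth false w).
Proof.
move=> /cylinderP cv; apply: (good_le hbeta _ (val_good v)) => i.
have [iw|wi] := ltnP i (size w); first by rewrite cv.
by rewrite nth_default.
Qed.

Lemma cylinder_inadmissible w : ~ good beta m (nth false w) ->
  cylinder w = set0 :> set space.
Proof. by move=> ng; apply/seteqP; split=> // v /cylinder_good. Qed.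

Lemma open_cylinder w : open (cylinder w : set space).
Proof.
exists [set v : seq_space hbeta | forall i, (i < size w)%N -> v i = nth false w i] => //.
rewrite openE => v wv; apply/nbhs_ballP; exists (beta ^- size w) => /=.
  by rewrite invr_gt0 exprn_gt0.
move=> u; rewrite ballEmdist /= => uv i iw.
by rewrite -(seq_dist_agree uv (ltnW iw)) wv.
Qed.

Lemma open_has_cylinder (U : set space) (v : space) : open U -> U v ->
  exists n, cylinder (mkseq (letters v) n) `<=` U.
Proof.
case=> B oB <- /= Bv; move: oB; rewrite openE => /(_ _ Bv) /nbhs_ballP[d /= d0 dB].
have [n nd] := betaN_small d0; exists n => u /cylinderP; rewrite size_mkseq => cu.
apply: dB; rewrite ballEmdist /=; apply: le_lt_trans nd.
apply: (@seq_dist_small (val v) (val u) n) => i lt.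
by have := cu i lt; rewrite nth_mkseq// /letters => ->.
Qed.

Definition cylinders : set (set space) := [set cylinder w | w in [set: seq bool]].

(** There are only countably many cylinders. *)
Lemma open_sub_cylinders : [set U : set space | open U] `<=` <<s cylinders >>.
Proof.
move=> U oU.
pose D := [set w : seq bool | cylinder w `<=` U].
have -> : U = \bigcup_(w in D) cylinder w.
  apply/seteqP; split=> [v Uv|v [w Dw]]; last exact: Dw.
  have [n nU] := open_has_cylinder oU Uv; exists (mkseq (letters v) n) => //.
  by apply/cylinderE; rewrite size_mkseq.
have -> : \bigcup_(w in D) cylinder w =
    \bigcup_n (if (unpickle n : option (seq bool)) is Some w then
                 if `[< D w >] then cylinder w else set0 else set0) :> set space.
  apply/seteqP; split=> [v [w Dw cv]|v [n _]].
    by exists (pickle w) => //; rewrite pickleK asboolT.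
  by case: unpickle => // w; case: asboolP => // Dw cv; exists w.
have [s0 _ sU] := @smallest_sigma_algebra _ setT cylinders.
have key (o : option (seq bool)) :
    <<s cylinders >> (if o is Some w then if `[< D w >] then cylinder w else set0 else set0).
  case: o => [w|]; last exact: s0.
  by case: asboolP => _; [apply: sub_gen_smallest; exists w|exact: s0].
exact: (sU _ (fun n => key (unpickle n))).
Qed.

Lemma measurable_cylinder w : measurable (cylinder w : set borel).
Proof. by apply: sub_gen_smallest; exact: open_cylinder. Qed.

Lemma borel_cylinders (A : set borel) : measurable A -> <<s cylinders >> A.
Proof.
move: A; apply: smallest_sub; first exact: smallest_sigma_algebra.
exact: open_sub_cylinders.
Qed.

Lemma cylinder_setI w u : (size w <= size u)%N ->
  cylinder w `&` cylinder u = (if take (size w) u == w then cylinder u else set0) :> set space.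
Proof.
move=> wu; apply/seteqP; split=> [v [/cylinderP cw /cylinderP cu]|v].
  suff -> : take (size w) u = w by rewrite eqxx.
  apply: (@eq_from_nth _ false); rewrite size_takel// => i iw.
  by rewrite nth_take// -cw// cu// (leq_trans iw).
case: eqP => // tw /cylinderP cu; split; apply/cylinderP => // i iw.
by rewrite -[in RHS]tw nth_take// cu// (leq_trans iw).
Qed.

Lemma cylinders_setI : setI_closed (cylinders `|` [set set0]).
Proof.
move=> A B [[w _ <-]|->] [[u _ <-]|->]; rewrite ?setI0 ?set0I; try by right.
have [wu|/ltnW uw] := leqP (size w) (size u).
  by rewrite cylinder_setI//; case: ifP => _; [left; exists u|right].
by rewrite setIC cylinder_setI//; case: ifP => _; [left; exists w|right].
Qed.

(** Two cylinders are nested or disjoint, so the cylinders and the empty set are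
    stable under intersection. *)
Lemma eq_measure_cylinders (mu nu : {measure set borel -> \bar R}) :
  (mu setT < +oo)%E -> (forall w, mu (cylinder w) = nu (cylinder w)) ->
  forall A, measurable A -> mu A = nu A.
Proof.
move=> fin e A mA.
apply: (measure_unique (T := borel) (cylinders `|` [set set0]) (fun=> setT)) => //.
- apply/seteqP; split.
    move=> B /borel_cylinders; apply: sub_smallest2r; [exact: smallest_sigma_algebra|].
    by move=> ? ?; left.
  apply: smallest_sub; first exact: sigma_algebra_measurable.
  by move=> B [[w _ <-]|->]; [exact: measurable_cylinder|exact: measurable0].
- exact: cylinders_setI.
- by left; exists [::] => //; exact: cylinder_nil.
- by apply/seteqP; split=> // x _; exists 0%N.
- by move=> B [[w _ <-]|->]; rewrite ?measure0.
Qed.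

Lemma cylinder_rcons w :
  cylinder w = cylinder (rcons w false) `|` cylinder (rcons w true) :> set space.
Proof.
apply/seteqP; split=> [v /cylinderP cv|v].
  have ext b : letters v (size w) = b -> cylinder (rcons w b) v.
    move=> vb; apply/cylinderP => i; rewrite size_rcons ltnS leq_eqVlt => /predU1P[->|iw].
      by rewrite nth_rcons ltnn eqxx.
    by rewrite nth_rcons iw cv.
  by case vb : (letters v (size w)); [right|left]; exact: ext.
by case=> /cylinderP cv; apply/cylinderP => i iw; have := cv i; rewrite size_rcons nth_rcons iw; apply; apply: ltnW.
Qed.

Lemma cylinder_rcons_disj w :
  cylinder (rcons w false) `&` cylinder (rcons w true) = set0 :> set space.
Proof.
apply/seteqP; split=> // v [/cylinderP/(_ (size w)) c0 /cylinderP/(_ (size w)) c1].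
move: c0 c1; rewrite !size_rcons !nth_rcons ltnn eqxx => /(_ (leqnn _)) ->.
by move/(_ (leqnn _)).
Qed.

Lemma preimage_shift_cylinder w :
  beta_shift (hbeta := hbeta) @^-1` cylinder w =
  cylinder (false :: w) `|` cylinder (true :: w).
Proof.
apply/seteqP; split=> [v /cylinderP cv|v].
  have ext b : letters v 0%N = b -> cylinder (b :: w) v.
    by move=> vb; apply/cylinderP => -[|i] //= iw; rewrite -cv.
  by case vb : (letters v 0%N); [right|left]; exact: ext.
by case=> /cylinderP cv; apply/cylinderP => i iw; exact: (cv i.+1).
Qed.

Lemma cylinder_cons_disj w :
  cylinder (false :: w) `&` cylinder (true :: w) = set0 :> set space.
Proof.
apply/seteqP; split=> // v [/cylinderP/(_ 0%N isT) /= c0 /cylinderP/(_ 0%N isT)].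
by rewrite c0.
Qed.

Lemma measurable_shift :
  measurable_fun setT (beta_shift (hbeta := hbeta) : borel -> borel).
Proof.
apply: (measurability (rT := borel) cylinders).
  apply/seteqP; split=> B; first exact: borel_cylinders.
  apply: smallest_sub; first exact: sigma_algebra_measurable.
  by move=> ? [w _ <-]; exact: measurable_cylinder.
move=> _ [_ [w _ <-] <-]; rewrite setTI preimage_shift_cylinder.
by apply: measurableU; exact: measurable_cylinder.
Qed.

(** ** Laws of Borel probabilities *)

Definition law_of (mu : probability borel R) (w : seq bool) : R := fine (mu (cylinder w)).

Section law_of_measure.
Variable mu : probability borel R.

Lemma law_ofE w : mu (cylinder w) = (law_of mu w)%:E.
Proof. by rewrite fineK// fin_num_measure//; exact: measurable_cylinder. Qed.

Lemma law_of_law : law (law_of mu).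
Proof.
split=> [|w|w].
- by rewrite /law_of cylinder_nil probability_setT.
- by rewrite fine_ge0.
- apply/EFin_inj; rewrite EFinD -!law_ofE [in RHS]cylinder_rcons measureU//.
  + exact: measurable_cylinder.
  + exact: measurable_cylinder.
  + exact: cylinder_rcons_disj.
Qed.

Lemma law_of_supp w : law_of mu w != 0 -> good beta m (nth false w).
Proof.
move=> w0; apply: contrapT => /cylinder_inadmissible c0.
by move: w0; rewrite /law_of c0 measure0 eqxx.
Qed.

Lemma law_of_stationary :
  invariant_measure mu (@beta_shift _ _ hbeta) <-> stationary (law_of mu).
Proof.
have consE w : mu (@beta_shift _ _ hbeta @^-1` cylinder w) =
    (law_of mu (false :: w) + law_of mu (true :: w))%:E.
  rewrite preimage_shift_cylinder EFinD -!law_ofE measureU//.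
  - exact: measurable_cylinder.
  - exact: measurable_cylinder.
  - exact: cylinder_cons_disj.
split=> [inv|[_ st] A mA].
  split=> [|w]; first exact: law_of_law.
  by apply/EFin_inj; rewrite -consE inv ?law_ofE//; exact: measurable_cylinder.
have := @eq_measure_cylinders
  (measure_function_pushforward__canonical__measure_function_Measure mu measurable_shift) mu.
by apply=> // [|w]; rewrite /= /pushforward /= ?preimage_setT ?probability_setT ?ltry// consE st law_ofE.
Qed.

End law_of_measure.

(** ** Every law supported by good words is the law of a probability *)

Section realization.
Variables (p : seq bool -> R) (lp : law p)
  (sp : forall w, p w != 0 -> good beta m (nth false w)).

Lemma code_good t : 0 <= t < 1 -> good beta m (codeseq p t).
Proof.
move=> t01 k; have := sp (lt0r_neq0 (code_prefix_gt0 (k + m) lp t01)).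
move=> /(_ k); congr (_ < _); apply: eq_bval => i im.
by rewrite /shiftn nth_mkseq// ltn_add2l.
Qed.

Definition code_point (t : R) : borel :=
  if 0 <= t < 1 then to_shift_space (codeseq p t) else point.

Lemma left_end_bounds w : 0 <= left_end p w /\ left_end p w + p w <= 1.
Proof.
split; first by apply: sumr_ge0 => i _; exact: law_ge0.
elim/last_ind: w => [|w b IH]; first by rewrite /left_end big_ord0 add0r (law0 lp).
apply: le_trans IH; rewrite left_end_rcons -(law_rcons lp w).
have := law_ge0 lp (rcons w true); have := law_ge0 lp (rcons w false).
by case: b => ? ?; lra.
Qed.

Lemma code_point_cylinder w :
  code_point @^-1` cylinder w `&` `[0, 1[%classic =
  `[left_end p w, (left_end p w + p w)[%classic.
Proof.
have [l0 l1] := left_end_bounds w.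
apply/seteqP; split=> t /=; rewrite !in_itv /=.
  move=> [ct t01]; rewrite -code_prefixP//; apply/eqP.
  move: ct => /cylinderE; rewrite /code_point t01 to_shift_spaceK//.
  exact: code_good.
move=> /andP[t1 t2]; have t01 : 0 <= t < 1 by apply/andP; split; lra.
split => //; apply/cylinderE; rewrite /code_point t01 to_shift_spaceK; last exact: code_good.
by apply/eqP; rewrite code_prefixP// t1.
Qed.

Lemma measurable_code_point : measurable_fun (setT : set (measurableTypeR R)) code_point.
Proof.
apply: (measurability (rT := borel) cylinders).
  apply/seteqP; split=> B; first exact: borel_cylinders.
  apply: smallest_sub; first exact: sigma_algebra_measurable.
  by move=> ? [w _ <-]; exact: measurable_cylinder.
move=> _ [_ [w _ <-] <-]; rewrite setTI.
have -> : code_point @^-1` cylinder w =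
   `[left_end p w, (left_end p w + p w)[%classic `|`
   (if pselect (cylinder w (point : space)) then ~` `[0, 1[%classic else set0).
  rewrite -code_point_cylinder; apply/seteqP; split=> t /=.
    have [t01|t01] := boolP (t \in `[0, 1[%classic).
      by left; split => //; rewrite inE in t01.
    move=> ct; right; move: ct; rewrite notin_setE /= in_itv /= in t01.
    rewrite /code_point; case: ifP => [//|_ cp]; case: pselect => //= _.
  case=> [[]//|]; case: pselect => //= cp; rewrite in_itv /= => /negP t01.
  by rewrite /code_point (negbTE t01).
apply: measurableU => //; case: pselect => [c0|c0] /=; last exact: measurable0.
exact: measurableC.
Qed.

Lemma uniform01E (A : set (measurableTypeR R)) : measurable A ->
  uniform_prob (@ltr01 R) A = lebesgue_measure (A `&` `[0, 1]).
Proof.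
move=> mA; rewrite /uniform_prob integral_uniform_pdf.
rewrite (eq_integral (fun=> 1%E)); last first.
  move=> x; rewrite inE => -[_]; rewrite /= in_itv /= => x01.
  by rewrite /uniform_pdf x01 subr0 invr1.
by rewrite integral_cst ?mul1e//; exact: measurableI.
Qed.

(** The image of the uniform distribution under the coding by nested intervals:
    the cylinder of [w] pulls back to an interval of length [p w]. *)
Lemma law_realized : exists mu : probability borel R, law_of mu = p.
Proof.
pose mX := isMeasurableFun.Build _ _ _ _ _ measurable_code_point.
pose X : {mfun (measurableTypeR R) >-> borel} :=
  MeasurableFun.Pack (MeasurableFun.Class mX).
pose P : probability (measurableTypeR R) R := uniform_prob (@ltr01 R).
exists (distribution P X); apply/funext => w.
have mc := measurable_cylinder w.
rewrite /law_of /= /distribution /pushforward /= uniform01E; last first.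
  by rewrite -[X in measurable X]setTI; exact: measurable_code_point.
set A := code_point @^-1` cylinder w.
have mA : measurable (A : set (measurableTypeR R)).
  by rewrite -[X in measurable X]setTI; exact: measurable_code_point.
have itvE : lebesgue_measure (A `&` `[0, 1[) = (p w)%:E.
  rewrite code_point_cylinder lebesgue_measure_itv /= lte_fin ltrDl.
  case: ltP => [p0|p0]; first by rewrite -EFinD addrAC subrr add0r.
  by congr EFin; apply/eqP; rewrite eq_le p0 law_ge0.
suff -> : lebesgue_measure (A `&` `[0, 1]) = lebesgue_measure (A `&` `[0, 1[).
  by rewrite itvE.
apply/eqP; rewrite eq_le; apply/andP; split; last first.
  apply: le_measure; rewrite ?inE; try exact: measurableI.
  by apply: setIS; apply: subset_itvl; rewrite bnd_simp.
rewrite -[leRHS]adde0 -(lebesgue_measure_set1 (1 : R)).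
apply: le_trans (measureU2 _ _ _) => //; last exact: measurableI.
apply: le_measure; rewrite ?inE; try exact: measurableI.
  by apply: measurableU => //; exact: measurableI.
move=> t [At] /=; rewrite !in_itv /= => /andP[t0].
by rewrite le_eqVlt => /predU1P[->|t1]; [right|left; rewrite t0].
Qed.

End realization.
End shift_space.

(** * Entropy *)

Section fekete.
Context {R : realType}.

(** Fekete's lemma. *)
Lemma subadditive_limit (u : nat -> R) :
    (forall n, 0 <= u n) -> (forall n k, u (n + k)%N <= u n + u k) ->
  exists2 l : R, (fun n => u n / n%:R) @ \oo --> l &
    forall n, (0 < n)%N -> l <= u n / n%:R.
Proof.
move=> u0 usub.
pose S := [set u n / n%:R | n in [set n : nat | (0 < n)%N]].
have lbS : lbound S 0 by move=> _ [n _ <-]; rewrite divr_ge0.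
have infS : has_inf S by split; [exists (u 1%N / 1%:R); exists 1%N|exists 0].
have lu n : (0 < n)%N -> inf S <= u n / n%:R.
  by move=> n0; apply: ge_inf; [exists 0|exists n].
exists (inf S) => //; apply/cvgrPdist_le => eps eps0.
have e2 : 0 < eps / 2 by rewrite divr_gt0.
have [_ [N /= N0 <-] uN] := inf_adherent e2 infS.
pose M := \sum_(r < N) u r.
have uM q r : (r < N)%N -> u (q * N + r)%N <= q%:R * u N + M.
  move=> rN; elim: q => [|q IH].
    rewrite mul0n add0n mul0r add0r /M (bigD1 (Ordinal rN))//= lerDl.
    by apply: sumr_ge0 => i _.
  by rewrite mulSn -addnA -natr1 mulrDl mul1r addrAC addrC (le_trans (usub _ _))// lerD2l.
have M0 : 0 <= M by apply: sumr_ge0 => i _.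
near=> n; have n0 : (0 < n)%N by near: n; exact: nbhs_infty_gt.
have nR : 0 < n%:R :> R by rewrite ltr0n.
have NR : 0 < N%:R :> R by rewrite ltr0n.
rewrite ler_norml; apply/andP; split; last first.
  by rewrite lerBlDr (le_trans (lu n n0))// lerDr ltW.
rewrite lerNl opprB lerBlDr.
have nM : M / n%:R <= eps / 2.
  rewrite ler_pdivrMr// -ler_pdivrMl//.
  by near: n; exact: nbhs_infty_ger.
have main : u n / n%:R <= u N / N%:R + M / n%:R.
  rewrite ler_pdivrMr// mulrDl divfK ?gt_eqF//.
  rewrite {1}(divn_eq n N) (le_trans (uM _ _ (ltn_pmod n N0)))// lerD2r.
  rewrite mulrC -mulrA ler_wpM2l// mulrC ler_pdivlMr//.
  by rewrite -natrM ler_nat leq_trunc_div.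
by lra.
Unshelve. all: by end_near. Qed.

End fekete.

Section itineraries.
Context d (T : measurableType d) (R : realType) (mu : probability T R) (f : T -> T).
Hypotheses (mf : measurable_fun setT f) (inv : invariant_measure mu f).

Definition prob (A : set T) : R := fine (mu A).

Lemma prob_ge0 A : 0 <= prob A. Proof. exact: fine_ge0. Qed.

Lemma probE A : measurable A -> mu A = (prob A)%:E.
Proof. by move=> mA; rewrite fineK// fin_num_measure. Qed.

Lemma le_prob A B : measurable A -> measurable B -> A `<=` B -> prob A <= prob B.
Proof.
by move=> mA mB AB; rewrite -lee_fin -!probE//; apply: le_measure; rewrite ?inE.
Qed.

Lemma prob0 : prob set0 = 0. Proof. by rewrite /prob measure0. Qed.

Lemma probT : prob setT = 1. Proof. by rewrite /prob probability_setT. Qed.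

Lemma measurable_preimage A : measurable A -> measurable (f @^-1` A).
Proof. by move=> mA; rewrite -[X in measurable X]setTI; exact: mf. Qed.

Lemma prob_sum (J : finType) (C : J -> set T) (A : set T) :
  measurable_partition C -> measurable A -> prob A = \sum_j prob (A `&` C j).
Proof.
move=> [mC tC cC] mA; apply/EFin_inj; rewrite -sumEFin -probE//.
have mAC j : measurable (A `&` C j) by exact: measurableI.
under eq_bigr do rewrite -probE//.
rewrite [in LHS](_ : A = \bigcup_(j in [set: J]) (A `&` C j)); last by rewrite -setI_bigcupr cC setIT.
rewrite measure_fin_bigcup//=; last exact: trivIset_setIl.
have -> : [set: J] = [set` index_enum J].
  by apply/seteqP; split=> // j _ /=; rewrite mem_index_enum.
by rewrite -fsbig_seq// index_enum_uniq.
Qed.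

Lemma prob_coarsen (J K : finType) (C : J -> set T) (D : K -> set T) (g : J -> K) k :
    measurable_partition C -> (forall k, measurable (D k)) -> trivIset setT D ->
    (forall j, C j `<=` D (g j)) ->
  prob (D k) = \sum_(j | g j == k) prob (C j).
Proof.
move=> mC mD tD CD; rewrite (prob_sum mC (mD k)) [RHS]big_mkcond /=.
apply: eq_bigr => j _; case: eqP => [<-|ne].
  by congr prob; apply/seteqP; split=> [x []//|x cx]; split => //; exact: CD.
suff -> : D k `&` C j = set0 by rewrite prob0.
apply/seteqP; split=> // x [Dx /CD Dgx].
by apply: ne; apply: tD => //; exists x.
Qed.

Lemma partition_entropy_coarsen (J K : finType) (C : J -> set T) (D : K -> set T) (g : J -> K) :
    measurable_partition C -> (forall k, measurable (D k)) -> trivIset setT D ->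
    (forall j, C j `<=` D (g j)) ->
  partition_entropy mu D <= partition_entropy mu C.
Proof.
move=> mC mD tD CD; rewrite lerN2 (partition_big g predT)//=.
apply: ler_sum => k _; rewrite -/(prob _) (prob_coarsen k mC mD tD CD).
by apply: xlnx_sum => j; exact: prob_ge0.
Qed.

Section alphabet.
Context {A : finType} (P : A -> set T).

Fixpoint itin (w : seq A) : set T :=
  if w is a :: w' then P a `&` f @^-1` (itin w') else setT.

Lemma itinP a0 w x :
  itin w x <-> forall k, (k < size w)%N -> P (nth a0 w k) (iter k f x).
Proof.
elim: w x => [|a w IH] x //=; split=> [[Pa /IH h] [|k] //= kw|h].
  by rewrite -iterS iterSr; exact: h.
split; first exact: (h 0%N).
by apply/IH => k kw; rewrite -iterSr; exact: (h k.+1).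
Qed.

Hypothesis mP : measurable_partition P.

Lemma measurable_itin w : measurable (itin w).
Proof.
by elim: w => //= a w IH; apply: measurableI; [case: mP|exact: measurable_preimage].
Qed.

Lemma itin_cat u v : itin (u ++ v) = itin u `&` iter (size u) f @^-1` itin v.
Proof.
elim: u => [|a u IH]; first by rewrite setTI.
rewrite /= IH; apply/seteqP; split=> x /=; rewrite -iterSr.
  by case=> ? [].
by case=> -[].
Qed.

Lemma itin_disj n (u v : n.-tuple A) x : itin u x -> itin v x -> u = v.
Proof.
case: mP => _ tP _ ux vx.
case: n u v ux vx => [|n] u v ux vx; first by rewrite [u]tuple0 [v]tuple0.
apply: eq_from_tnth => k; rewrite !(tnth_nth (thead u)).
apply: tP => //; exists (iter k f x); split.
  by apply: (itinP _ _ _).1 ux _ _; rewrite size_tuple.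
by apply: (itinP _ _ _).1 vx _ _; rewrite size_tuple.
Qed.

Lemma itin_partition n : measurable_partition (fun w : n.-tuple A => itin w).
Proof.
split=> [w||]; first exact: measurable_itin.
  by move=> u v _ _ [x [ux vx]]; exact: itin_disj ux vx.
apply/seteqP; split=> // x _; case: mP => _ _ cP.
have ex y : exists a, P a y by have : setT y by []; rewrite -cP => -[a _ Pa]; exists a.
elim: n x => [|n IH] x; first by exists [tuple].
have [a Pa] := ex x; have [w _ wx] := IH (f x).
by exists (cons_tuple a w).
Qed.

Lemma preimage_iterS n B : iter n.+1 f @^-1` B = f @^-1` (iter n f @^-1` B).
Proof. by apply/seteqP; split=> x /=; rewrite -iterSr. Qed.

Lemma measurable_preimage_iter n B :
  measurable B -> measurable (iter n f @^-1` B).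
Proof.
by move=> mB; elim: n => // n IH; rewrite preimage_iterS; exact: measurable_preimage.
Qed.

Lemma prob_preimage_iter n B : measurable B -> prob (iter n f @^-1` B) = prob B.
Proof.
move=> mB; elim: n => [//|n IH]; rewrite -IH preimage_iterS /prob inv//.
exact: measurable_preimage_iter.
Qed.

Lemma itin_catr n v : \sum_(u : n.-tuple A) prob (itin (u ++ v)) = prob (itin v).
Proof.
rewrite -(prob_preimage_iter n (measurable_itin v)).
rewrite (prob_sum (itin_partition n)); last first.
  exact/measurable_preimage_iter/measurable_itin.
by apply: eq_bigr => u _; rewrite itin_cat size_tuple setIC.
Qed.

Lemma itin_catl n u : \sum_(v : n.-tuple A) prob (itin (u ++ v)) = prob (itin u).
Proof.
elim: n => [|n IH].
  by rewrite (sum_tuple0 (fun v => prob (itin (u ++ v)))) cats0.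
rewrite (sum_tuple_rcons (fun v => prob (itin (u ++ v)))) -IH; apply: eq_bigr => v _.
set s := u ++ v; case: mP => mP0 tP cP.
rewrite (@prob_sum _ (fun a => iter (size s) f @^-1` P a)); last exact: measurable_itin.
  apply: eq_bigr => a _; rewrite -rcons_cat -cats1 itin_cat /=.
  by rewrite preimage_setT setIT.
split=> [a||]; first exact: measurable_preimage_iter.
  by move=> a b _ _ [x [xa xb]]; apply: tP => //; exists (iter (size s) f x).
by rewrite -preimage_bigcup cP preimage_setT.
Qed.

Lemma itin_sum (s : A -> R) n :
  \sum_(w : n.-tuple A) prob (itin w) * (\sum_(a <- w) s a) =
  n%:R * \sum_a prob (P a) * s a.
Proof.
elim: n => [|n IH].
  by rewrite (sum_tuple0 (fun w => prob (itin w) * (\sum_(a <- w) s a))) big_nil mulr0 mul0r.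
rewrite (sum_tuple_cons (fun w => prob (itin w) * (\sum_(a <- w) s a))).
under eq_bigr => w _.
  under eq_bigr => a _ do rewrite big_cons mulrDr.
  rewrite big_split /= -[X in _ + X]mulr_suml.
  have -> : \sum_a prob (itin (a :: w)) = prob (itin w).
    rewrite -(itin_catr 1 w) (sum_tuple_cons (fun u => prob (itin (u ++ w)))).
    by rewrite (sum_tuple0 (fun v => \sum_a prob (itin ((a :: v) ++ w)))).
  over.
rewrite big_split /= IH exchange_big /= -natr1 mulrDl mul1r addrC; congr (_ + _).
apply: eq_bigr => a _; rewrite -mulr_suml; congr (_ * _).
rewrite -[X in prob X](_ : itin [:: a] = P a); last by rewrite /= preimage_setT setIT.
exact: (itin_catl n [:: a]).
Qed.

Definition itin_entropy n : R := - \sum_(w : n.-tuple A) xlnx (prob (itin w)).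

Lemma iterated_join_entropy n :
  partition_entropy mu (iterated_join f P (n := n)) = itin_entropy n.
Proof.
congr (- _); rewrite (reindex (fun u : {ffun 'I_n -> A} => [tuple u i | i < n])) /=.
  apply: eq_bigr => u _; rewrite -/(prob _).
  have -> // : iterated_join f P u = itin [tuple u i | i < n].
  case: n u => [|n] u.
    by rewrite [in RHS]tuple0 /=; apply/seteqP; split=> // x _ [].
  apply/seteqP; split=> x ux.
    apply/(itinP (u ord0)) => k; rewrite size_tuple => kn.
    rewrite -(tnth_nth _ _ (Ordinal kn)) tnth_mktuple.
    exact: (ux (Ordinal kn) I).
  move=> k _ /=; have /(itinP (u ord0))/(_ k) := ux.
  by rewrite size_tuple -(tnth_nth _ _ k) tnth_mktuple; apply.
exists (fun w : n.-tuple A => [ffun i => tnth w i]) => w _.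
  by apply/ffunP => i; rewrite ffunE tnth_mktuple.
by apply: eq_from_tnth => i; rewrite tnth_mktuple ffunE.
Qed.

Lemma itin_entropy_ge0 n : 0 <= itin_entropy n.
Proof.
rewrite oppr_ge0; apply: sumr_le0 => w _; rewrite xlnx_le0//.
by rewrite -probT; apply: le_prob => //; exact: measurable_itin.
Qed.

(** Gibbs' inequality for the product of the two marginals. *)
Lemma itin_entropy_subadd n k : itin_entropy (n + k) <= itin_entropy n + itin_entropy k.
Proof.
rewrite /itin_entropy (sum_tuple_cat (fun w => xlnx (prob (itin w)))).
pose a (x : n.-tuple A * k.-tuple A) := prob (itin (x.1 ++ x.2)).
pose b (x : n.-tuple A * k.-tuple A) := prob (itin x.1) * prob (itin x.2).
rewrite (pair_bigA _ (fun u v => xlnx (prob (itin (tval u ++ tval v))))) /=.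
have sum1 j : \sum_(u : j.-tuple A) prob (itin u) = 1.
  by rewrite (itin_catl j [::]) probT.
have ale x : a x <= prob (itin x.1) /\ a x <= prob (itin x.2).
  split.
    rewrite -(itin_catl k x.1) (bigD1 x.2)//= lerDl.
    by apply: sumr_ge0 => v _; exact: prob_ge0.
  rewrite -(itin_catr n x.2) (bigD1 x.1)//= lerDl.
  by apply: sumr_ge0 => v _; exact: prob_ge0.
apply: (@le_trans _ _ (- \sum_x a x * ln (b x))).
  apply: gibbs.
  - by move=> x; exact: prob_ge0.
  - by move=> x; rewrite mulr_ge0 ?prob_ge0.
  - by move=> x ax; have [h1 h2] := ale x; rewrite mulr_gt0// (lt_le_trans ax).
  - rewrite -(pair_bigA _ (fun u v => prob (itin (tval u)) * prob (itin (tval v)))) /=.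
    rewrite -(pair_bigA _ (fun u v => prob (itin (tval u ++ tval v)))) /=.
    under eq_bigr do rewrite -mulr_sumr sum1 mulr1.
    by under [leRHS]eq_bigr do rewrite itin_catl.
rewrite -opprD lerN2 le_eqVlt; apply/orP; left; apply/eqP.
transitivity (\sum_x (a x * ln (prob (itin x.1)) + a x * ln (prob (itin x.2)))).
  rewrite big_split /=; congr (_ + _).
    rewrite -(pair_bigA _ (fun u v => prob (itin (tval u ++ tval v)) * ln (prob (itin (tval u))))) /=.
    by apply: eq_bigr => u _; rewrite -mulr_suml itin_catl.
  rewrite -(pair_bigA _ (fun u v => prob (itin (tval u ++ tval v)) * ln (prob (itin (tval v))))) /=.
  by rewrite exchange_big; apply: eq_bigr => v _; rewrite -mulr_suml itin_catr.
apply: eq_bigr => x _; have [ax|ax] := ltP 0 (a x).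
  have [h1 h2] := ale x.
  by rewrite /b lnM ?posrE ?(lt_le_trans ax)// mulrDr.
have -> : a x = 0 by apply/eqP; rewrite eq_le ax prob_ge0.
by rewrite !mul0r addr0.
Qed.

Lemma entropy_wrt_cvg :
  (fun n => itin_entropy n / n%:R) @ \oo --> entropy_wrt mu f P /\
  forall n, (0 < n)%N -> entropy_wrt mu f P <= itin_entropy n / n%:R.
Proof.
have [l ul ll] := subadditive_limit itin_entropy_ge0 itin_entropy_subadd.
suff -> : entropy_wrt mu f P = l by [].
rewrite /entropy_wrt; apply/cvg_lim => //.
by under eq_fun do rewrite iterated_join_entropy.
Qed.

End alphabet.

(** Code the itinerary of [P] with the help of that of [Q], guessing each letter
    of [P] from the simultaneous letter of [Q] by the kernel [r]: by Gibbs'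
    inequality the entropy exceeds that of [Q] by at most [n] times the expected
    cost of one guess. *)
Lemma itin_entropy_guess (A B : finType) (P : A -> set T) (Q : B -> set T)
    (r : A -> B -> R) n :
    measurable_partition P -> measurable_partition Q ->
    (forall a b, 0 < r a b) -> (forall b, \sum_a r a b = 1) ->
  itin_entropy P n <= itin_entropy Q n +
    n%:R * - \sum_a \sum_b prob (P a `&` Q b) * ln (r a b).
Proof.
move=> mP mQ r0 r1.
pose PQ (x : A * B) := P x.1 `&` Q x.2.
have mPQ : measurable_partition PQ.
  case: mP mQ => mP tP cP [mQ tQ cQ]; split=> [x||].
  - exact: measurableI.
  - move=> [a b] [a' b'] _ _ [x [[/= Pa Qb] [/= Pa' Qb']]].
    by congr (_, _); [apply: tP => //; exists x|apply: tQ => //; exists x].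
  - apply/seteqP; split=> // x _.
    have : setT x by []; rewrite -{1}cP => -[a _ Pa].
    have : setT x by []; rewrite -{1}cQ => -[b _ Qb].
    by exists (a, b).
have sub (w : seq (A * B)) : itin PQ w `<=` itin P (map fst w) /\ itin PQ w `<=` itin Q (map snd w).
  elim: w => [|x w [IH1 IH2]]; first by split.
  by split=> y /= [[Px Qx] /= wy]; split=> //; [exact: IH1|exact: IH2].
have HP : itin_entropy P n <= itin_entropy PQ n.
  apply: (@partition_entropy_coarsen _ _ (fun w : n.-tuple (A * B) => itin PQ w)
    (fun w : n.-tuple A => itin P w) (fun w => map_tuple fst w)).
  - exact: itin_partition.
  - by move=> w; exact: measurable_itin.
  - by case: (itin_partition mP n).
  - by move=> w; case: (sub w).
apply: (le_trans HP).
pose b (w : seq (A * B)) := prob (itin Q (map snd w)) * \prod_(x <- w) r x.1 x.2.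
have pr0 (w : seq (A * B)) : 0 < \prod_(x <- w) r x.1 x.2 by apply: prodr_gt0 => x _; exact: r0.
have le_b (w : seq (A * B)) : prob (itin PQ w) <= prob (itin Q (map snd w)).
  by apply: le_prob; [exact: measurable_itin|exact: measurable_itin|case: (sub w)].
apply: (@le_trans _ _ (- \sum_(w : n.-tuple (A * B)) prob (itin PQ w) * ln (b w))).
  apply: (gibbs (a := fun w : n.-tuple (A * B) => prob (itin PQ w)) (b := fun w : n.-tuple (A * B) => b w)).
  - by move=> w; exact: prob_ge0.
  - by move=> w; rewrite mulr_ge0 ?prob_ge0// ltW.
  - by move=> w aw; rewrite mulr_gt0// (lt_le_trans aw).
  - have -> : \sum_(w : n.-tuple (A * B)) prob (itin PQ w) = 1.
      by rewrite (itin_catl mPQ n [::]) probT.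
    suff -> : \sum_(w : n.-tuple (A * B)) b w = 1 by [].
    have one (k : nat) : \sum_(w : k.-tuple (A * B)) b w = 1.
      elim: k => [|k IH]; first by rewrite (sum_tuple0 b) /b big_nil mulr1 probT.
      rewrite (sum_tuple_rcons b) -IH; apply: eq_bigr => w _.
      have -> : \sum_x b (rcons w x) = \sum_c \sum_a b (rcons w (a, c)).
        by rewrite exchange_big pair_bigA; apply: eq_bigr => -[].
      transitivity (\sum_c prob (itin Q (rcons (map snd w) c)) * \prod_(x <- w) r x.1 x.2).
        apply: eq_bigr => c _; rewrite -[RHS]mulr1 -[X in _ = _ * X](r1 c) mulr_sumr.
        apply: eq_bigr => a _; rewrite /b -[rcons w _]cats1 map_cat big_cat big_seq1 /=.
        by rewrite cats1 mulrA.
      rewrite -mulr_suml; congr (_ * _).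
      rewrite -(itin_catl mQ 1 (map snd w)) (sum_tuple_cons (fun u => prob (itin Q (map snd w ++ u)))).
      rewrite (sum_tuple0 (fun v => \sum_c prob (itin Q (map snd w ++ c :: v)))).
      by apply: eq_bigr => c _; rewrite cats1.
    exact: one.
have split_ln (w : n.-tuple (A * B)) : prob (itin PQ w) * ln (b w) =
    prob (itin PQ w) * ln (prob (itin Q (map snd w))) +
    prob (itin PQ w) * \sum_(x <- w) ln (r x.1 x.2).
  have [aw|aw] := ltP 0 (prob (itin PQ w)); last first.
    have -> : prob (itin PQ w) = 0 by apply/eqP; rewrite eq_le aw prob_ge0.
    by rewrite !mul0r addr0.
  rewrite /b lnM ?posrE ?(lt_le_trans aw (le_b w)) ?pr0// mulrDr.
  congr (_ + _ * _); elim: (tval w) => [|x s IH]; first by rewrite !big_nil ln1.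
  by rewrite !big_cons lnM ?posrE ?r0// IH.
under eq_bigr do rewrite split_ln.
rewrite big_split /= opprD lerD//; last first.
  rewrite (itin_sum mPQ (fun x => ln (r x.1 x.2))) -mulrN.
  by rewrite pair_bigA /= ler_wpM2l// lerN2 le_eqVlt; apply/orP; left; apply/eqP.
rewrite /itin_entropy lerN2 le_eqVlt; apply/orP; left; apply/eqP.
rewrite (partition_big (fun w : n.-tuple (A * B) => map_tuple snd w) predT)//=.
apply: eq_bigr => v _.
have pv : prob (itin Q v) =
    \sum_(w : n.-tuple (A * B) | map_tuple snd w == v) prob (itin PQ w).
  apply: (@prob_coarsen _ _ (fun w : n.-tuple (A * B) => itin PQ w) (fun w : n.-tuple B => itin Q w)).
  - exact: itin_partition.
  - by move=> w; exact: measurable_itin.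
  - by case: (itin_partition mQ n).
  - by move=> w; case: (sub w).
by rewrite /xlnx {1}pv mulr_suml; apply: eq_bigr => w /eqP <-.
Qed.

End itineraries.

Section shift_entropy.
Context {R : realType} {beta : R} (hbeta : 1 < beta < 2) (m : nat).
Hypothesis hm : (2 <= m)%N.
Local Notation space := (beta_shift_space hbeta).
Local Notation borel := (borel_beta_shift hbeta).
Variable mu : probability borel R.
Local Notation pr := (prob mu).

Definition wset n (b : seq bool -> bool) : set borel :=
  [set v : space | b (mkseq (letters v) n)].

Lemma cylinder_partition n :
  measurable_partition (fun w : n.-tuple bool => cylinder w : set borel).
Proof.
split=> [w||]; first exact: measurable_cylinder.
  move=> u v _ _ [x [/cylinderE xu /cylinderE xv]]; apply/val_inj => /=.
  by rewrite -xu -xv !size_tuple.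
apply/seteqP; split=> // x _.
have s : size (mkseq (letters x) n) == n by rewrite size_mkseq.
by exists (Tuple s) => //; apply/cylinderE => /=; rewrite size_mkseq.
Qed.

Lemma measurable_wset n b : measurable (wset n b).
Proof.
have -> : wset n b = \bigcup_(w in [set w : n.-tuple bool | b w]) cylinder w.
  apply/seteqP; split=> [v bv|v [w bw /cylinderE]]; last first.
    by rewrite size_tuple /wset /= => ->.
  have s : size (mkseq (letters v) n) == n by rewrite size_mkseq.
  by exists (Tuple s) => //; apply/cylinderE => /=; rewrite size_mkseq.
apply: fin_bigcup_measurable; first exact: finite_finset.
by move=> w _; exact: measurable_cylinder.
Qed.

Lemma wset_widen n k b : (n <= k)%N -> wset n b = wset k (b \o take n).
Proof.
move=> nk; rewrite /wset; apply/seteqP; split=> v;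
  by rewrite /= /mkseq -map_take take_iota (minn_idPl nk).
Qed.

Lemma probU A B : measurable A -> measurable B -> pr (A `|` B) <= pr A + pr B.
Proof.
move=> mA mB; rewrite -lee_fin EFinD -!probE//; last exact: measurableU.
exact: measureU2.
Qed.

(** Sets that are nearly determined by a prefix. They form a sigma-algebra that
    contains the cylinders, hence are all the Borel sets. *)
Definition approximable : set (set borel) := [set A | measurable A /\
  forall d : R, 0 < d -> exists n b, pr (A `+` wset n b) < d].

Lemma approximableU A B : approximable A -> approximable B -> approximable (A `|` B).
Proof.
move=> [mA aA] [mB aB]; split; first exact: measurableU.
move=> d d0; have d2 : 0 < d / 2 by rewrite divr_gt0.
have [n [b nb]] := aA _ d2; have [k [c kc]] := aB _ d2.
exists (maxn n k), (fun w => b (take n w) || c (take k w)).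
have -> : wset (maxn n k) (fun w => b (take n w) || c (take k w)) = wset n b `|` wset k c.
  rewrite (wset_widen b (leq_maxl n k)) (wset_widen c (leq_maxr n k)).
  by apply/seteqP; split=> v /=; rewrite /wset /=; [move=> /orP|move=> ?; apply/orP].
have mw n' b' := measurable_wset n' b'.
have mY (E F : set borel) : measurable E -> measurable F -> measurable (E `+` F).
  by move=> mE mF; apply: measurableU; exact: measurableD.
apply: (@le_lt_trans _ _ (pr ((A `+` wset n b) `|` (B `+` wset k c)))).
  apply: le_prob.
  - by apply: mY; exact: measurableU.
  - by apply: measurableU; exact: mY.
  - move=> v [[[?|?] /not_orP[? ?]]|[[?|?] /not_orP[? ?]]].
    + by left; left.
    + by right; left.
    + by left; right.
    + by right; right.
apply: le_lt_trans (probU _ _) _; [exact: mY|exact: mY|].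
by rewrite [d]splitr ltrD.
Qed.

Lemma approximable_sigma : sigma_algebra setT approximable.
Proof.
have mw n' b' := measurable_wset n' b'.
have mY (E F : set borel) : measurable E -> measurable F -> measurable (E `+` F).
  by move=> mE mF; apply: measurableU; exact: measurableD.
have a0 : approximable set0.
  split=> // d d0; exists 0%N, xpred0.
  have -> : set0 `+` wset 0 xpred0 = set0 by apply/seteqP; split=> // v [[]|[]].
  by rewrite prob0.
split=> // [A [mA aA]|F aF].
  split; first by rewrite setTD; exact: measurableC.
  move=> d /aA[n [b nb]]; exists n, (predC b); congr (pr _ < d): nb.
  rewrite setTD; apply/seteqP; split=> v; rewrite /wset /=.
    case=> [[Av bv]|[bv Av]]; last by left; split=> //; rewrite bv.
    by right; split; [exact/negP|move=> nA; exact: nA Av].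
  case=> [[Av bv]|[bv Av]]; last by left; split; [exact: contrapT|exact/negP].
  by right; split=> //; apply: contrapT => /negP.
have mF i : measurable (F i) by case: (aF i).
have mU : measurable (\bigcup_i F i) by exact: bigcupT_measurable.
split=> // d d0; have d2 : 0 < d / 2 by rewrite divr_gt0.
pose G n := \big[setU/set0]_(i < n) F i.
have aG n : approximable (G n).
  elim: n => [|n IH]; first by rewrite /G big_ord0.
  by rewrite /G big_ord_recr; exact: approximableU.
have mG n : measurable (G n) by case: (aG n).
have GU : \bigcup_n G n = \bigcup_i F i.
  apply/seteqP; split=> v [i _]; first by rewrite /G -bigcup_mkord => -[j _ Fj]; exists j.
  by move=> Fi; exists i.+1 => //; rewrite /G -bigcup_mkord; exists i => /=.
have Gmono : {homo G : n k / (n <= k)%N >-> (n <= k)%O}.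
  move=> n k nk; apply/subsetPset; rewrite /G -!bigcup_mkord => v [i /= ik Fi].
  by exists i => //=; exact: leq_trans nk.
have : mu (G n) @[n --> \oo] --> (pr (\bigcup_i F i))%:E.
  by rewrite -probE// -GU; apply: nondecreasing_cvg_mu => //; rewrite GU.
move=> /fine_cvgP[_].
move=> /cvgrPdist_lt/(_ _ d2)[M _ /(_ M (leqnn M))] /= hM.
have GM : G M `<=` \bigcup_i F i by rewrite -GU => v Gv; exists M.
have diff : pr (\bigcup_i F i `\` G M) < d / 2.
  rewrite /prob measureD//; last by rewrite (le_lt_trans (probability_le1 _ _))// ltry.
  rewrite setIidr// fineB ?fin_num_measure//.
  by apply: le_lt_trans hM; exact: ler_norm.
have [n [b nb]] := (aG M).2 _ d2; exists n, b.
apply: (@le_lt_trans _ _ (pr ((\bigcup_i F i `\` G M) `|` (G M `+` wset n b)))).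
  apply: le_prob.
  - exact: mY.
  - by apply: measurableU; [exact: measurableD|exact: mY].
  - move=> v [[Fv nv]|[wv nF]].
      by case: (pselect (G M v)) => Gv; [right; left|left].
    by right; right; split=> // /GM.
apply: le_lt_trans (probU _ _) _; [exact: measurableD|exact: mY|].
by rewrite [d]splitr ltrD.
Qed.

Lemma borel_approximable A : measurable A -> approximable A.
Proof.
move=> mA; apply: (smallest_sub _ _ (borel_cylinders mA)).
  exact: approximable_sigma.
move=> _ [w _ <-]; split=> [|d d0]; first exact: measurable_cylinder.
exists (size w), (pred1 w).
have -> : cylinder w `+` wset (size w) (pred1 w) = set0.
  apply/seteqP; split=> // v [[/cylinderE cv]|[]]; rewrite /wset /=.
    by rewrite cv eqxx.
  by move=> /eqP /cylinderE.
by rewrite prob0.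
Qed.

(** A finite Borel partition is nearly a function of long enough prefixes. *)
Lemma partition_guess (I : finType) (P : I -> set borel) (d : R) :
    measurable_partition P -> 0 < d ->
  exists n (lab : n.-tuple bool -> I),
    \sum_i \sum_(w : n.-tuple bool | lab w != i) pr (P i `&` cylinder w) < d.
Proof.
move=> mPP d0; case: (mPP) => mP tP cP.
have [i0 _] : exists2 i : I, True & P i point.
  by have : [set: borel] point by []; rewrite -cP => -[i _ Pi]; exists i.
have I0 : 0 < #|I|%:R :> R by rewrite ltr0n; apply/card_gt0P; exists i0.
pose d' := d / (#|I|%:R * #|I|%:R).
have d'0 : 0 < d' by rewrite divr_gt0// mulr_gt0.
have [g gP] : {g : I -> nat * (seq bool -> bool) &
    forall i, pr (P i `+` wset (g i).1 (g i).2) < d'}.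
  apply: (@choice _ _ (fun i (g : nat * (seq bool -> bool)) => pr (P i `+` wset g.1 g.2) < d')) => i.
  by have [_ /(_ _ d'0)[n [b nb]]] := borel_approximable (mP i); exists (n, b).
pose n := \max_i (g i).1; pose b i := (g i).2 \o take (g i).1.
have gn i : pr (P i `+` wset n (b i)) < d'.
  have le : ((g i).1 <= n)%N by exact: (leq_bigmax (F := fun i => (g i).1)).
  by rewrite -(wset_widen _ le).
pose lab (w : n.-tuple bool) := odflt i0 [pick i | b i w].
exists n, lab.
have mY i : measurable (P i `+` wset n (b i)).
  by apply: measurableU; apply: measurableD => //; exact: measurable_wset.
have le i : \sum_(w : n.-tuple bool | lab w != i) pr (P i `&` cylinder w) <=
    \sum_k pr (P k `+` wset n (b k)).
  have -> : \sum_k pr (P k `+` wset n (b k)) =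
      \sum_(w : n.-tuple bool) \sum_k pr ((P k `+` wset n (b k)) `&` cylinder w).
    by rewrite exchange_big; apply: eq_bigr => k _; exact: prob_sum (cylinder_partition n) (mY k).
  rewrite [leRHS](bigID (fun w => lab w != i)) /= -[leLHS]addr0 lerD//; last first.
    by apply: sumr_ge0 => w _; apply: sumr_ge0 => k _; exact: prob_ge0.
  apply: ler_sum => w lw.
  have mc : measurable (cylinder w : set borel) by exact: measurable_cylinder.
  have [bi|bi] := boolP (b i w).
    pose k := lab w.
    have bk : b k w.
      by rewrite /k /lab; case: pickP => [j //|/(_ i)]; rewrite bi.
    rewrite (bigD1 k)//= -[leLHS]addr0 lerD//; last first.
      by apply: sumr_ge0 => j _; exact: prob_ge0.
    apply: le_prob; [exact: measurableI|exact: measurableI|].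
    move=> v [Pv cv]; split=> //; right; split.
      by rewrite /wset /=; move/cylinderE: cv; rewrite size_tuple => ->.
    move=> Pkv; move: lw; rewrite -/k; apply/negP; rewrite negbK; apply/eqP.
    by apply: tP => //; exists v.
  rewrite (bigD1 i)//= -[leLHS]addr0 lerD//; last first.
    by apply: sumr_ge0 => j _; exact: prob_ge0.
  apply: le_prob; [exact: measurableI|exact: measurableI|].
  move=> v [Pv cv]; split=> //; left; split=> //.
  rewrite /wset /=; move/cylinderE: cv; rewrite size_tuple => ->.
  exact/negP.
have lt : \sum_k pr (P k `+` wset n (b k)) < #|I|%:R * d'.
  rewrite mulr_natl -sumr_const; apply: ltr_sum => //.
  by apply/hasP; exists i0 => //; rewrite mem_index_enum.
apply: (@le_lt_trans _ _ (\sum_(i : I) \sum_k pr (P k `+` wset n (b k)))).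
  by apply: ler_sum => i _; exact: le.
rewrite sumr_const -mulr_natl.
have -> : d = #|I|%:R * (#|I|%:R * d') by rewrite /d'; field; rewrite gt_eqF.
by rewrite ltr_pM2l.
Qed.

Hypothesis inv : invariant_measure mu (@beta_shift _ _ hbeta).

Let mf := @measurable_shift R beta hbeta.

Lemma letters_iter (x : space) k i : letters (iter k (@beta_shift _ _ hbeta) x) i = letters x (k + i)%N.
Proof.
elim: k i => [|k IH] i //.
by rewrite iterS -[LHS]/(letters (iter k (@beta_shift _ _ hbeta) x) i.+1) IH addnS.
Qed.

(** The first [n + N] letters of a point determine its itinerary of length [n]
    through the cylinders of length [N]. *)
Lemma cylinder_itin_entropy N n :
  itin_entropy mu (@beta_shift _ _ hbeta) (fun w : N.-tuple bool => cylinder w) n <=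
  word_entropy (law_of mu) (n + N).
Proof.
pose blk (k : 'I_n) (w : (n + N).-tuple bool) : N.-tuple bool :=
  [tuple nth false w (k + j) | j < N].
pose Q (w : N.-tuple bool) : set borel := cylinder w.
pose f : borel -> borel := @beta_shift _ _ hbeta.
suff : partition_entropy mu (fun w : n.-tuple (N.-tuple bool) => itin f Q w) <=
  partition_entropy mu (fun w : (n + N).-tuple bool => cylinder w : set borel) by [].
apply: (@partition_entropy_coarsen _ _ _ mu _ _ _ _ (fun w => [tuple blk k w | k < n])).
- exact: cylinder_partition.
- move=> w; apply: measurable_itin => //; exact: cylinder_partition.
- by case: (itin_partition mf (cylinder_partition N) n).
- move=> w x /cylinderP xw; apply/(itinP _ _ [tuple of nseq N false]) => k.
  have -> : size [tuple blk k w | k < n] = n by rewrite size_tuple.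
  move=> kn; rewrite -(tnth_nth _ _ (Ordinal kn)) tnth_mktuple.
  apply/cylinderP => j; rewrite size_tuple => jN.
  rewrite letters_iter xw ?size_tuple ?ltn_add//; last lia.
  by rewrite -(tnth_nth _ _ (Ordinal jN)) tnth_mktuple.
Qed.

Variables (h c : R).
Hypothesis linear_entropy :
  forall n, word_entropy (law_of mu) (n + m.-1) = c + n%:R * h.

(** No partition has more entropy than the cylinders: its itineraries can be
    guessed from the letters, with rare errors ([partition_guess]). *)
Lemma entropy_wrt_le (I : finType) (P : I -> set borel) :
  measurable_partition P -> entropy_wrt mu (@beta_shift _ _ hbeta) P <= h.
Proof.
move=> mP; have [cv lb] := entropy_wrt_cvg mf inv mP.
have [i0 _ _] : exists2 i : I, True & P i point.
  by case: mP => _ _ cP; have : [set: borel] point by []; rewrite -cP => -[i _ Pi]; exists i.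
have I0 : 0 < #|I|%:R :> R by rewrite ltr0n; apply/card_gt0P; exists i0.
apply/ler_addgt0Pr => eps eps0.
(* The guessed letter gets weight [t], which costs [eps / 3]; the rest is shared
   out equally, so that a wrong guess has a finite cost. *)
pose t := expR (- (eps / 3)); have t0 : 0 < t by exact: expR_gt0.
have t1 : t < 1 by rewrite expR_lt1 oppr_lt0 divr_gt0.
pose s := (1 - t) / #|I|%:R.
have s0 : 0 < s by rewrite divr_gt0// subr_gt0.
pose K := `|ln s|.
have K0 : 0 < K + 1 by rewrite ltr_wpDl// normr_ge0.
have [N [lab err]] := partition_guess mP (divr_gt0 (divr_gt0 eps0 (ltr0n _ 3)) K0).
pose r i (w : N.-tuple bool) := (if lab w == i then t else 0) + s.
have r0 i w : 0 < r i w by rewrite /r; case: ifP => _; rewrite ?add0r// addr_gt0.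
have r1 w : \sum_i r i w = 1.
  rewrite big_split /= -big_mkcond /= (big_pred1 (lab w)); last by move=> i; rewrite eq_sym.
  by rewrite sumr_const /s -[_ *+ _]mulr_natr divfK ?gt_eqF// addrC subrK.
pose E := - \sum_i \sum_(w : N.-tuple bool) pr (P i `&` cylinder w) * ln (r i w).
have Ele : E <= eps / 3 + eps / 3.
  have term i (w : N.-tuple bool) : - (pr (P i `&` cylinder w) * ln (r i w)) <=
      pr (P i `&` cylinder w) * (eps / 3) +
      (if lab w != i then pr (P i `&` cylinder w) * (K + 1) else 0).
    have p0 := prob_ge0 mu (P i `&` cylinder w).
    rewrite -mulrN /r; case: eqP => [_|_] /=.
      rewrite addr0 ler_wpM2l// lerNl -[- _](expRK) -/t ler_ln ?posrE//; first by rewrite lerDl ltW.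
      by rewrite addr_gt0.
    rewrite add0r -mulrDr ler_wpM2l//.
    have : - ln s <= K by rewrite /K -normrN ler_norm.
    by lra.
  rewrite /E -sumrN; under eq_bigr do rewrite -sumrN.
  apply: (@le_trans _ _ (\sum_i \sum_(w : N.-tuple bool) (pr (P i `&` cylinder w) * (eps / 3) +
      (if lab w != i then pr (P i `&` cylinder w) * (K + 1) else 0)))).
    by apply: ler_sum => i _; apply: ler_sum => w _; exact: term.
  under eq_bigr do rewrite big_split /= -big_mkcond /= -!mulr_suml.
  rewrite big_split /= -!mulr_suml lerD//.
    rewrite (eq_bigr (fun i => pr (P i))); last first.
      by move=> i _; rewrite -(prob_sum mu (cylinder_partition N))//; case: mP.
    rewrite -(_ : \sum_i pr (setT `&` P i) = \sum_i pr (P i)); last by apply: eq_bigr => i _; rewrite setTI.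
    by rewrite -prob_sum// probT mul1r.
  by rewrite -ler_pdivlMr// ltW.
have main n : (0 < n)%N -> entropy_wrt mu (@beta_shift _ _ hbeta) P <=
    h + (c + N%:R * `|h|) / n%:R + E.
  move=> n0; have nR : 0 < n%:R :> R by rewrite ltr0n.
  apply: le_trans (lb n n0) _; rewrite ler_pdivrMr//.
  apply: le_trans (itin_entropy_guess mf inv n mP (cylinder_partition N) r0 r1) _.
  rewrite -/E [n%:R * E]mulrC [leRHS]mulrDl lerD2r.
  rewrite mulrDl divfK ?gt_eqF//.
  apply: le_trans (cylinder_itin_entropy N n) _.
  have le : word_entropy (law_of mu) (n + N) <= c + (n + N)%:R * h.
    by rewrite -linear_entropy word_entropy_le//; exact: law_of_law.
  apply: le_trans le _; rewrite natrD mulrDl addrCA [n%:R * h]mulrC lerD2l lerD2l.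
  by rewrite ler_wpM2l// ler_norm.
near \oo => n.
have n0 : (0 < n)%N by near: n; exact: nbhs_infty_gt.
have nR : 0 < n%:R :> R by rewrite ltr0n.
have small : (c + N%:R * `|h|) / n%:R <= eps / 3.
  rewrite ler_pdivrMr// -ler_pdivrMl ?divr_gt0//.
  by near: n; exact: nbhs_infty_ger.
by have := main n n0; lra.
Unshelve. all: by end_near. Qed.

(** The bound is attained by the partition according to the first letter, whose
    itineraries are the cylinders. *)
Lemma shift_entropy : entropy mu (@beta_shift _ _ hbeta) = h%:E.
Proof.
apply/eqP; rewrite eq_le; apply/andP; split.
  by apply: ge_ereal_sup => _ [k [P [mP ->]]]; rewrite lee_fin entropy_wrt_le.
pose f : borel -> borel := @beta_shift _ _ hbeta.
pose P (i : 'I_2) : set borel := cylinder [:: i == ord_max].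
have mP : measurable_partition P.
  split=> [i||]; first exact: measurable_cylinder.
    move=> i j _ _ [v [/cylinderP/(_ 0%N isT) /= vi /cylinderP/(_ 0%N isT) /= vj]].
    by move: vi; rewrite vj; case: i => -[|[|]] //= ?; case: j {vj} => -[|[|]] //= ? _; exact/val_inj.
  apply/seteqP; split=> // v _.
  exists (if letters v 0%N then ord_max else ord0) => //; apply/cylinderP => -[|//] _ /=.
  by case: (letters v 0%N).
apply: (@le_trans _ _ (entropy_wrt mu f P)%:E); last first.
  by apply: ereal_sup_ubound; exists 2, P.
have [cv _] := entropy_wrt_cvg mf inv mP.
have low n : word_entropy (law_of mu) n <= itin_entropy mu f P n.
  suff : partition_entropy mu (fun w : n.-tuple bool => cylinder w : set borel) <=
    partition_entropy mu (fun w : n.-tuple 'I_2 => itin f P w) by [].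
  apply: (@partition_entropy_coarsen _ _ _ mu _ _ _ _ (fun w => map_tuple (fun i => i == ord_max) w)).
  - exact: itin_partition.
  - by move=> w; exact: measurable_cylinder.
  - by case: (cylinder_partition n).
  - move=> w x /(itinP f P ord0) xw; apply/cylinderP => k; rewrite size_tuple => kn.
    have := xw k; rewrite size_tuple => /(_ kn)/cylinderP/(_ 0%N isT) /=.
    by rewrite letters_iter addn0 (nth_map ord0) ?size_tuple.
rewrite lee_fin; apply/ler_addgt0Pr => eps eps0.
have e2 : 0 < eps / 2 by rewrite divr_gt0.
near \oo => n.
have n0 : (0 < n)%N by near: n; exact: nbhs_infty_gt.
have nm : (m <= n)%N by near: n; exact: nbhs_infty_ge.
have nR : 0 < n%:R :> R by rewrite ltr0n.
have up : itin_entropy mu f P n / n%:R <= entropy_wrt mu f P + eps / 2.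
  have : `|entropy_wrt mu f P - itin_entropy mu f P n / n%:R| <= eps / 2.
    by near: n; move/cvgrPdist_le : cv; apply.
  by rewrite ler_norml => /andP[]; lra.
have nE : n = (n - m.-1 + m.-1)%N by lia.
have main : word_entropy (law_of mu) n <= (entropy_wrt mu f P + eps / 2) * n%:R.
  by apply: le_trans (low n) _; rewrite -ler_pdivrMr.
rewrite {1}nE linear_entropy natrB in main; last lia.
have small : (m.-1%:R * h - c) / n%:R <= eps / 2.
  rewrite ler_pdivrMr// -ler_pdivrMl//.
  by near: n; exact: nbhs_infty_ger.
rewrite ler_pdivrMr// in small.
by rewrite -(ler_pM2r nR); lra.
Unshelve. all: by end_near. Qed.

End shift_entropy.

(** * The two optimisation problems agree *)

Section optimisation.
Context {R : realType} {beta : R} (hbeta : 1 < beta < 2) (m : nat).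
Hypotheses (hm : (2 <= m)%N) (hdigit : digit beta 1 m = 1%Z)
  (hfinite : forall i : nat, (m < i)%N -> digit beta 1 i = 0%Z).
Variable a : R.
Local Notation space := (beta_shift_space hbeta).
Local Notation borel := (borel_beta_shift hbeta).

Let beta_gt1 : 1 < beta. Proof. by case/andP: hbeta. Qed.
Let beta_gt0 : 0 < beta. Proof. exact: lt_trans beta_gt1. Qed.
Let admP w : admissible_word beta w <-> good beta m (nth false w) :=
  admissible_wordP hbeta hm hdigit hfinite w.

Definition block_values : set (\bar R) :=
  [set h | exists q : seq bool -> R,
    [/\ block_law beta m q, q [:: false] = a & h = (block_entropy m q)%:E]].

Lemma good_cons b w : good beta m (nth false (b :: w)) -> good beta m (nth false w).
Proof. by move=> /(good_shift 1). Qed.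

Lemma good_cat w u : good beta m (nth false (w ++ u)) -> good beta m (nth false w).
Proof.
apply: good_le => // i wi; rewrite nth_cat; case: ltnP => // le.
by move: wi; rewrite nth_default.
Qed.

Lemma good_rcons w b : good beta m (nth false (rcons w b)) -> good beta m (nth false w).
Proof. by rewrite -cats1; exact: good_cat. Qed.

Lemma good_letter b : good beta m (nth false [:: b]).
Proof.
move=> k; have m1 : m = m.-1.+1 by lia.
rewrite m1 bvalS (_ : bval _ m.-1 _ = 0); last first.
  by rewrite /bval big1// => i _; rewrite /shiftn addnCA nth_default ?mul0r.
rewrite mul0r addr0 ltr_pdivrMr// mul1r; apply: le_lt_trans beta_gt1.
by case: (shiftn _ _ _).
Qed.

Lemma stationary_block_law (p : seq bool -> R) : stationary p ->
  (forall w, p w != 0 -> good beta m (nth false w)) -> block_law beta m p.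
Proof.
move=> [lp st] supp; split=> //; first exact: law0.
- by move=> w _; exact: law_ge0.
- by move=> w _; exact: supp.
- by move=> w _; exact: law_rcons.
Qed.

Lemma block_law_ext_realized q : block_law beta m q ->
  exists2 mu : probability borel R, law_of mu = markov_ext m q &
    invariant_measure mu (@beta_shift _ _ hbeta).
Proof.
move=> bq; have sp := markov_ext_stationary hm bq.
have [mu e] := law_realized hbeta hm hdigit hfinite sp (markov_ext_supp hm bq).
by exists mu => //; apply/law_of_stationary; rewrite e.
Qed.

Lemma markov_law_ext (mu : probability borel R) :
    block_law beta m (law_of mu) -> markov_measure m.-1 mu ->
  law_of mu = markov_ext m (law_of mu).
Proof.
move=> bq mk; apply/funext; elim/last_ind => [|w b IH].
  by rewrite (markov_ext_small bq).
have [wm|mw] := leqP (size (rcons w b)) m; first by rewrite (markov_ext_small bq).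
have [adm|nadm] := pselect (admissible_word beta (rcons w b)); last first.
  have z (p : seq bool -> R) : (p (rcons w b) != 0 -> good beta m (nth false (rcons w b))) -> p (rcons w b) = 0.
    by move=> h; apply/eqP; apply: contrapT => /negP /h /admP.
  rewrite (z _ (law_of_supp hm hdigit hfinite (mu := mu) (w := _))).
  by rewrite (z _ (markov_ext_supp hm bq (w := _))).
have mk' := mk _ adm; rewrite size_rcons in mw mk'.
have m1 : m.-1.+1 = m by lia.
rewrite markov_ext_rcons -IH -!/(law_of mu _) /law_of mk'; last lia.
rewrite m1 /= (_ : take (size w) (rcons w b) = w)//.
by rewrite -cats1 take_size_cat.
Qed.

(** The Markov property determines a measure from its values on words of length at
    most [m], so that its law is the Markov extension of these. *)
Lemma markov_values :
  [set h : \bar R | exists mu : probability borel R,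
     [/\ invariant_measure mu (@beta_shift _ _ hbeta),
         mu (cylinder [:: false]) = a%:E, markov_measure m.-1 mu &
         h = entropy mu (@beta_shift _ _ hbeta)]] = block_values.
Proof.
have entE q (mu : probability borel R) : block_law beta m q ->
    law_of mu = markov_ext m q -> invariant_measure mu (@beta_shift _ _ hbeta) ->
    entropy mu (@beta_shift _ _ hbeta) = (block_entropy m q)%:E.
  move=> bq e inv.
  apply: (shift_entropy hm inv (c := word_entropy (markov_ext m q) m.-1)).
  by move=> n; rewrite e (markov_entropy hm bq).
apply/seteqP; split=> h.
  move=> [mu [inv mu0 mk ->]].
  have bq : block_law beta m (law_of mu).
    apply: stationary_block_law; first exact/law_of_stationary.
    by move=> w; exact: law_of_supp.
  exists (law_of mu); split=> //; first by rewrite /law_of mu0.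
  by apply: entE => //; exact: markov_law_ext.
move=> [q [bq q0 ->]].
have [mu e inv] := block_law_ext_realized bq; exists mu.
have small w : (size w <= m)%N -> law_of mu w = q w.
  by move=> wm; rewrite e (markov_ext_small bq).
split=> //; last by rewrite (entE q).
  by rewrite law_ofE small ?q0//=; lia.
move=> w _; case/lastP: w => // w b mw n p; rewrite /n size_rcons /=.
have m1 : m.-1.+1 = m by lia.
rewrite -!/(law_of mu _) {}/p {}/n; change (fun u => fine (mu (cylinder u))) with (law_of mu).
rewrite size_rcons in mw *.
have tw : take (size w) (rcons w b) = w by rewrite -cats1 take_size_cat.
have d1 : law_of mu (drop ((size w).+1 - m) (rcons w b)) = q (drop ((size w).+1 - m) (rcons w b)).
  by rewrite small// size_drop size_rcons; lia.
have d2 : law_of mu (drop ((size w).+1 - m) w) = q (drop ((size w).+1 - m) w).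
  by rewrite small// size_drop; lia.
rewrite tw m1 -/(law_of mu (rcons w b)) -/(law_of mu w) -/(law_of mu (drop _ (rcons w b))).
by rewrite -/(law_of mu (drop _ w)) d1 d2 e markov_ext_rcons.
Qed.

(** A block law is a function of words; it is a function of sets because it comes
    from a measure. *)
Lemma coordinated_values :
  [set h : \bar R | exists mu : set space -> R,
     [/\ cylinder_set_function m mu, coordinated m a mu &
         h = (cylinder_entropy m mu)%:E]] = block_values.
Proof.
have ordm : (0 < m)%N by lia.
apply/seteqP; split=> h.
  move=> [mu [cf [mu0 mu1 co] ->]].
  pose q (w : seq bool) : R := if w is [::] then 1 else
    if `[< admissible_word beta w >] then mu (cylinder w) else 0.
  have qE w : (0 < size w)%N -> q w = if `[< admissible_word beta w >] then mu (cylinder w) else 0.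
    by case: w.
  have adm1 b : admissible_word beta [:: b] by apply/admP; exact: good_letter.
  have bq : block_law beta m q.
    split=> //.
    - move=> [|b w] wm //; rewrite qE//; case: asboolP => // adm.
      by have := cf _ adm; rewrite wm => /(_ isT)/andP[].
    - move=> [|b w] wm; first by move=> _; exact: (good_cons (good_letter false)).
      rewrite qE//; case: asboolP => [/admP//|_]; by rewrite eqxx.
    - move=> [|b w] wm; first by rewrite /= !asboolT// mu0 mu1 addrC subrK.
      rewrite !qE ?size_rcons//; have [adm|nadm] := pselect (admissible_word beta (b :: w)).
        have [|<- _] := co _ adm; first by move: wm => /=; lia.
        rewrite (asboolT adm) big_mkcond big_bool /= addrC.
        by congr (_ + _); case: asboolP.
      rewrite !asboolF ?addr0// => /admP/good_rcons/admP //.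
    - move=> [|b w] wm; first by rewrite /= !asboolT// mu0 mu1 addrC subrK.
      rewrite !qE//; have [adm|nadm] := pselect (admissible_word beta (b :: w)).
        have [|_ <-] := co _ adm; first by move: wm => /=; lia.
        rewrite (asboolT adm) big_mkcond big_bool /= addrC.
        by congr (_ + _); case: asboolP.
      rewrite !asboolF ?addr0// => /admP/good_cons/admP //.
  exists q; split=> //; first by rewrite qE// asboolT.
  rewrite (block_entropyE hm bq) /cylinder_entropy big_mkcond /=.
  congr (- _)%:E; apply: eq_bigr => w _.
  rewrite !qE ?size_take_min ?size_tuple//; last lia.
  case: asboolP => [adm|_]; last by rewrite mul0r.
  rewrite asboolT//; apply/admP; apply: (@good_cat _ (drop m.-1 w)).
  by rewrite cat_take_drop; exact/admP.
move=> [q [bq q0 ->]].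
have [mu e inv] := block_law_ext_realized bq.
have small w : (size w <= m)%N -> law_of mu w = q w.
  by move=> wm; rewrite e (markov_ext_small bq).
have nadm w : (size w <= m)%N -> ~ admissible_word beta w -> q w = 0.
  by move=> wm nw; apply/eqP; apply: contrapT => /negP /(bl_supp bq wm) /admP.
exists (fun A : set space => fine (mu A)); split.
- by move=> w _ /andP[_ wm]; rewrite -/(law_of mu w) small// (bl_ge0 bq)//= (bl_le1 bq).
- split; rewrite -?/(law_of mu [:: _]).
  + by rewrite small.
  + rewrite small//; have := bl_rcons bq (w := [::]) ordm; rewrite /= q0 (bl0 bq).
    by move=> h1; lra.
  + move=> w adm /andP[w0 wm]; have wm' : (size w < m)%N by lia.
    have e1 b : law_of mu (rcons w b) = q (rcons w b) by rewrite small// size_rcons.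
    have e2 b : law_of mu (b :: w) = q (b :: w) by rewrite small.
    have e0 : law_of mu w = q w by rewrite small// ltnW.
    have part (f : bool -> seq bool) : (forall b, (size (f b) <= m)%N) ->
        (forall b, law_of mu (f b) = q (f b)) ->
        \sum_(b : bool | `[< admissible_word beta (f b) >]) fine (mu (cylinder (f b))) =
        q (f false) + q (f true).
      move=> fm fe; rewrite big_mkcond big_bool /= addrC.
      by congr (_ + _); rewrite -/(law_of mu (f _)) fe; case: asboolP => // /(nadm _ (fm _)) ->.
    rewrite (part (fun b => rcons w b)); [|by move=> b; rewrite size_rcons|exact: e1].
    rewrite (part (fun b => b :: w)); [|by move=> b|exact: e2].
    by rewrite -/(law_of mu w) e0 (bl_rcons bq)// (bl_cons bq).
- rewrite (block_entropyE hm bq) /cylinder_entropy [in RHS]big_mkcond /=.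
  congr (- _)%:E; apply: eq_bigr => w _.
  rewrite -!/(law_of mu _) !small ?size_take_min ?size_tuple//; last lia.
  by case: asboolP => // /nadm ->; rewrite ?size_tuple// mul0r.
Qed.

End optimisation.

(** * Compactness of the space of block laws *)

Section compactness.
Context {R : realType} (beta : R) (m : nat).
Hypothesis hm : (2 <= m)%N.

(** At 0, use [ln x = 2 ln (sqrt x)] to bound [x ln x] by [2 sqrt x + x ^ 2]. *)
Lemma continuous_xlnx : continuous (@xlnx R).
Proof.
have sqrt_bound (x : R) : 0 < x -> `|xlnx x| <= 2 * Num.sqrt x + x * x.
  move=> x0; have s0 : 0 < Num.sqrt x by rewrite sqrtr_gt0.
  have lnx : ln x = 2 * ln (Num.sqrt x).
    by rewrite -[in LHS](sqr_sqrtr (ltW x0)) lnXn// mulr_natl.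
  have up : ln x <= x := ltW (ln_sublinear x0).
  have low : - ln x <= 2 / Num.sqrt x.
    have : ln (Num.sqrt x)^-1 <= (Num.sqrt x)^-1.
      by apply/ltW/ln_sublinear; rewrite invr_gt0.
    by rewrite lnV ?posrE// lnx; lra.
  rewrite ler_norml /xlnx; apply/andP; split.
    rewrite lerNl; have := ler_wpM2l (ltW x0) low.
    have -> : x * (2 / Num.sqrt x) = 2 * Num.sqrt x.
      by rewrite -{1}(sqr_sqrtr (ltW x0)); field; rewrite gt_eqF.
    by have := mulr_ge0 (ltW x0) (ltW x0); lra.
  by have := ler_wpM2l (ltW x0) up; have := ltW s0; lra.
move=> x; have [x0|x0|->] := ltgtP x 0.
- apply: (near_cst_continuous 0); near=> y.
  rewrite /xlnx ln0 ?mulr0//; near: y; apply: filterS (lt_nbhsl x0) => y.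
  exact: ltW.
- by apply: cvgM => //; exact: continuous_ln.
rewrite /continuous_at xlnx0; apply/cvgrPdist_le => eps eps0.
have s_cvg : (fun y : R => 2 * Num.sqrt `|y| + `|y| * `|y|) @ 0 --> 2 * Num.sqrt `|0 : R| + `|0 : R| * `|0 : R|.
  have nc : (fun y : R => `|y|) @ 0 --> `|0 : R| by exact: norm_continuous.
  apply: cvgD; last exact: cvgM.
  apply: cvgM; first exact: cvg_cst.
  by apply: continuous_cvg nc; exact: sqrt_continuous.
rewrite normr0 sqrtr0 !mulr0 addr0 in s_cvg.
have := s_cvg => /cvgrPdist_le/(_ _ eps0); apply: filterS => y.
rewrite !sub0r !normrN => h; have [y0|y0] := ltP 0 y.
  have h' := le_trans (ler_norm _) h.
  by rewrite (gtr0_norm y0) in h'; exact: le_trans (sqrt_bound _ y0) h'.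
by rewrite /xlnx ln0// mulr0 normr0 ltW.
Unshelve. all: by end_near. Qed.

Lemma continuous_bigsum (T : topologicalType) (I : Type) (r : seq I) (P : pred I) (f : I -> T -> R) :
  (forall i, continuous (f i)) -> continuous (fun x => \sum_(i <- r | P i) f i x).
Proof.
move=> fc; elim: r => [|i r IH] x.
  by under eq_fun do rewrite big_nil; exact: cvg_cst.
under eq_fun do rewrite big_cons.
case: (P i); last exact: IH.
by apply: cvgD; [exact: fc|exact: IH].
Qed.

Lemma continuous_sub (T : topologicalType) (f g : T -> R) :
  continuous f -> continuous g -> continuous (fun x => f x - g x).
Proof. by move=> cf cg x; apply: cvgB; [exact: cf|exact: cg]. Qed.

Lemma continuous_add (T : topologicalType) (f g : T -> R) :
  continuous f -> continuous g -> continuous (fun x => f x + g x).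
Proof. by move=> cf cg x; apply: cvgD; [exact: cf|exact: cg]. Qed.

Lemma continuous_dist (T : topologicalType) (f : T -> R) c :
  continuous f -> continuous (fun x => `|f x - c|).
Proof. by move=> cf x; apply: cvg_norm; apply: cvgB; [exact: cf|exact: cvg_cst]. Qed.

Let size1 (b : bool) : (size [:: b] <= m)%N. Proof. exact: ltnW. Qed.

Local Notation W := (m.-tuple bool).
Local Notation V := 'rV[R]_#|{: W}|.

(** The law of words of length at most [m] given by weights on words of length
    exactly [m]. *)
Definition marginal (v : V) (w : seq bool) : R :=
  \sum_(u : W | take (size w) u == w) v ord0 (enum_rank u).

Lemma continuous_marginal w : continuous (fun v => marginal v w).
Proof. by apply: continuous_bigsum => u; exact: coord_continuous. Qed.

Lemma continuous_marginal_entropy : continuous (fun v => block_entropy m (marginal v)).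
Proof.
have cH n : continuous (fun v => word_entropy (marginal v) n).
  have cx (w : n.-tuple bool) : continuous (fun v => xlnx (marginal v w)).
    by move=> v; apply: continuous_comp; [exact: continuous_marginal|exact: continuous_xlnx].
  rewrite (_ : (fun v => _) = fun v => 0 - \sum_(w : n.-tuple bool) xlnx (marginal v w)).
    apply: continuous_sub; first by move=> x; exact: cst_continuous.
    exact: continuous_bigsum.
  by apply/funext => v; rewrite sub0r.
exact: continuous_sub.
Qed.

Lemma block_law_marginal q : block_law beta m q ->
  exists v, forall w, (size w <= m)%N -> marginal v w = q w.
Proof.
move=> bq; exists (\row_(i < #|{: W}|) q (tval (enum_val i : W))) => w wm.
rewrite /marginal; under eq_bigr do rewrite mxE enum_rankK.
have [k kE] : exists k, (m = size w + k)%N by exists (m - size w)%N; rewrite subnKC.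
have catl n u : (size u + n <= m)%N -> \sum_(t : n.-tuple bool) q (u ++ t) = q u.
  elim: n => [|n IH] um; first by rewrite (sum_tuple0 (fun t => q (u ++ t))) cats0.
  rewrite (sum_word_rcons (fun t => q (u ++ t))) -IH; last lia.
  apply: eq_bigr => t _; rewrite -!rcons_cat (bl_rcons bq)//.
  by rewrite size_cat size_tuple; lia.
rewrite -(catl k w); last by rewrite -kE.
rewrite big_mkcond /=.
have -> : \sum_(u : W) (if take (size w) u == w then q u else 0) =
    \sum_(u : (size w + k).-tuple bool) (if take (size w) u == w then q u else 0).
  by rewrite -kE.
rewrite (sum_tuple_cat (fun u => if take (size w) u == w then q u else 0)).
rewrite (bigD1 (in_tuple w))//= [X in _ + X]big1 ?addr0; last first.
  move=> u uw; apply: big1 => t _; rewrite take_size_cat ?size_tuple//.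
  by case: eqP => // e; case/eqP: uw; apply/val_inj.
by apply: eq_bigr => t _; rewrite take_size_cat// eqxx.
Qed.

Definition law_simplex : set V := [set v | block_law beta m (marginal v)].

Lemma closed_eqc (f : V -> R) c : continuous f -> closed [set v | f v = c].
Proof.
move=> fc; suff : closed (f @^-1` [set x | x = c]) by [].
by apply: preimage_closed; [move=> v _; exact: fc|exact: closed_eq].
Qed.

Lemma closed_gec (f : V -> R) c : continuous f -> closed [set v | c <= f v].
Proof.
move=> fc; suff : closed (f @^-1` [set x | c <= x]) by [].
by apply: preimage_closed; [move=> v _; exact: fc|exact: closed_ge].
Qed.

Lemma law_simplex_closed : closed law_simplex.
Proof.
have cm := continuous_marginal.
pose A2 := \bigcap_(w in [set w : seq bool | (size w <= m)%N]) [set v | 0 <= marginal v w].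
pose A3 := \bigcap_(w in [set w : seq bool | (size w <= m)%N /\ ~ good beta m (nth false w)])
   [set v | marginal v w = 0].
pose A4 := \bigcap_(w in [set w : seq bool | (size w < m)%N])
   [set v | marginal v (rcons w false) + marginal v (rcons w true) - marginal v w = 0].
pose A5 := \bigcap_(w in [set w : seq bool | (size w < m)%N])
   [set v | marginal v (false :: w) + marginal v (true :: w) - marginal v w = 0].
have -> : law_simplex = [set v | marginal v [::] = 1] `&` (A2 `&` (A3 `&` (A4 `&` A5))).
  apply/seteqP; split=> v.
    move=> [h1 h2 h3 h4 h5]; split=> //; split=> [w wm|]; first exact: h2.
    split=> [w [wm ng]|]; first by apply/eqP; apply: contrapT => /negP /(h3 _ wm).
    by split=> w wm /=; rewrite ?h4 ?h5// subrr.
  move=> [h1 [h2 [h3 [h4 h5]]]]; split=> //.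
  - by move=> w wm w0; apply: contrapT => ng; move: w0; rewrite (h3 w)// eqxx.
  - by move=> w wm; apply/eqP; rewrite -subr_eq0; apply/eqP; exact: (h4 w wm).
  - by move=> w wm; apply/eqP; rewrite -subr_eq0; apply/eqP; exact: (h5 w wm).
have c3 u v w : continuous (fun x => marginal x u + marginal x v - marginal x w).
  have c2 : continuous (fun x => marginal x u + marginal x v).
    exact: continuous_add.
  exact: continuous_sub.
apply: closedI; first exact: closed_eqc.
apply: closedI; first by apply: closed_bigI => w _; exact: closed_gec.
apply: closedI; first by apply: closed_bigI => w _; exact: closed_eqc.
by apply: closedI; apply: closed_bigI => w _; apply: closed_eqc; exact: c3.
Qed.

Lemma law_simplex_compact : compact law_simplex.
Proof.
apply: (@subclosed_compact _ _ [set v : V | forall i, `[0, 1]%classic (v ord0 i)]).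
- exact: law_simplex_closed.
- have := (@rV_compact _ #|{: W}| (fun=> (`[0, 1]%classic : set R))).
  by apply => i; exact: segment_compact.
move=> v bv i /=; rewrite in_itv /=.
have iE : v ord0 i = marginal v (enum_val i).
  rewrite /marginal (big_pred1 (enum_val i)) ?enum_valK// => u.
  rewrite size_tuple take_oversize ?size_tuple//.
by rewrite iE (bl_ge0 bv) ?size_tuple// (bl_le1 bv) ?size_tuple.
Qed.

Lemma eq_block_law (p q : seq bool -> R) :
  (forall w, (size w <= m)%N -> p w = q w) -> block_law beta m q -> block_law beta m p.
Proof.
move=> pq [h1 h2 h3 h4 h5]; split=> [|w wm|w wm|w wm|w wm].
- by rewrite pq.
- by rewrite pq// h2.
- by rewrite pq//; exact: h3.
- by rewrite !pq ?size_rcons ?h4// ltnW.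
- by rewrite !pq ?h5//= ltnW.
Qed.

Lemma eq_block_entropy (p q : seq bool -> R) :
  (forall w, (size w <= m)%N -> p w = q w) -> block_entropy m p = block_entropy m q.
Proof.
move=> pq; rewrite /block_entropy /word_entropy; congr (- _ - - _);
  by apply: eq_bigr => w _; rewrite pq ?size_tuple//; lia.
Qed.

Lemma max_block_entropy a :
  (exists q, block_law beta m q /\ q [:: false] = a) ->
  exists q, [/\ block_law beta m q, q [:: false] = a &
    forall q', block_law beta m q' -> q' [:: false] = a -> block_entropy m q' <= block_entropy m q].
Proof.
move=> [q0 [bq0 q0a]].
pose K := law_simplex `&` [set v | marginal v [:: false] = a].
have mem q : block_law beta m q -> q [:: false] = a ->
    exists2 v, K v & forall w, (size w <= m)%N -> marginal v w = q w.
  move=> bq qa; have [v vq] := block_law_marginal bq; exists v => //; split.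
    exact: eq_block_law vq bq.
  by rewrite /= vq.
have [v0 Kv0 _] := mem _ bq0 q0a.
have cK : compact K.
  apply: (subclosed_compact _ law_simplex_compact); last by move=> v [].
  apply: closedI; first exact: law_simplex_closed.
  by apply: closed_eqc; exact: continuous_marginal.
have K0 : K !=set0 by exists v0.
have [v] := compact_EVT_max K0 cK (continuous_subspaceT continuous_marginal_entropy).
rewrite inE => -[bv va] vmax; exists (marginal v); split=> // q bq qa.
have [u Ku uq] := mem _ bq qa.
by rewrite -(eq_block_entropy uq); apply: vmax; rewrite inE.
Qed.

(** Upper semicontinuity in the frequency [a] of the maximal entropy: otherwise
    a block law of exact frequency [a] would be a limit of counterexamples. *)
Lemma block_entropy_usc a (M eta : R) : 0 < eta ->
    (forall q, block_law beta m q -> q [:: false] = a -> block_entropy m q <= M) ->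
  exists2 d : R, 0 < d & forall q, block_law beta m q ->
    `|q [:: false] - a| < d -> block_entropy m q < M + eta.
Proof.
move=> eta0 qM.
pose K := law_simplex `&` [set v | M + eta <= block_entropy m (marginal v)].
have cK : compact K.
  apply: (subclosed_compact _ law_simplex_compact); last by move=> v [].
  apply: closedI; first exact: law_simplex_closed.
  by apply: closed_gec; exact: continuous_marginal_entropy.
have mem q : block_law beta m q -> M + eta <= block_entropy m q ->
    exists2 v, K v & marginal v [:: false] = q [:: false].
  move=> bq qh; have [v vq] := block_law_marginal bq; exists v; last by rewrite vq.
  by split; [exact: eq_block_law vq bq|rewrite /= (eq_block_entropy vq)].
have [K0|/set0P K0] := eqVneq K set0.
  exists 1 => // q bq _; rewrite ltNge; apply/negP => /(mem _ bq) [v].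
  by rewrite K0.
have cf : continuous (fun v => `|marginal v [:: false] - a|).
  by apply: continuous_dist; exact: continuous_marginal.
have [v] := compact_EVT_min K0 cK (continuous_subspaceT cf).
rewrite inE => -[bv vM] vmin; exists `|marginal v [:: false] - a|.
  rewrite normr_gt0 subr_eq0; apply/eqP => va.
  by have := qM _ bv va; move: vM => /=; lra.
move=> q bq qa; rewrite ltNge; apply/negP => /(mem _ bq) [u Ku ua].
by move: qa; rewrite -ua ltNge => /negP; apply; apply: vmin; rewrite inE.
Qed.

End compactness.

(** * Counting words by their type *)

Section word_types.
Context {R : realType} (beta : R) (hbeta : 1 < beta < 2) (m : nat).
Hypotheses (hm : (2 <= m)%N).
Implicit Types (w u : seq bool).

Definition period w : nat := (size w + m)%N.

(** The [m] zeros make this sequence good when [w] is, and counting occurrences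
    along a cycle gives frequencies that are exactly consistent on both sides. *)
Definition periodic w : nat -> bool := fun i => nth false w (i %% period w)%N.

Definition occ w u : nat :=
  \sum_(k < period w) (mkseq (shiftn k (periodic w)) (size u) == u).

Definition word_type w u : R := (occ w u)%:R / (period w)%:R.

Lemma period_gt0 w : (0 < period w)%N. Proof. by rewrite /period; lia. Qed.

Lemma periodic_good w : good beta m (nth false w) -> good beta m (periodic w).
Proof.
(* [y j] consists of [j] periods followed by [w] and zeros. *)
move=> gw; pose fix y j : nat -> bool := fun i =>
  if j is j'.+1 then if (i < period w)%N then nth false w i else y j' (i - period w)%N
  else nth false w i.
have gy j : good beta m (y j).
  elim: j => [|j IH]; first exact: eq_good gw.
  apply: (good_join hbeta gw) => [i iw|]; first by rewrite /= iw.
  apply: eq_good IH => i; rewrite /shiftn /= ltnNge leq_addr /=.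
  by congr y; rewrite addKn.
have yE j i : (i < j * period w)%N -> y j i = periodic w i.
  elim: j i => [|j IH] i // ij; rewrite /=; case: ltnP => iw.
    by rewrite /periodic modn_small.
  rewrite IH; last by move: ij; rewrite mulSn; lia.
  by rewrite /periodic -[in RHS](subnK iw) modnDr.
move=> k; have := gy (k + m)%N k; congr (_ < _); apply: eq_bval => i im.
rewrite /shiftn yE//; apply: (@leq_trans (k + m)); first by rewrite ltn_add2l.
by rewrite leq_pmulr// period_gt0.
Qed.

Lemma sum_occ w (g : seq bool -> R) n :
  \sum_(u : n.-tuple bool) (occ w u)%:R * g u =
  \sum_(k < period w) g (mkseq (shiftn k (periodic w)) n).
Proof.
under eq_bigr => u _ do rewrite /occ natr_sum mulr_suml.
rewrite exchange_big; apply: eq_bigr => k _ /=.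
have s : size (mkseq (shiftn k (periodic w)) n) == n by rewrite size_mkseq.
rewrite (bigD1 (Tuple s))//= size_mkseq eqxx mul1r big1 ?addr0// => u ne.
rewrite size_tuple; case: eqP => [e|]; last by rewrite mul0r.
by case/eqP: ne; apply/val_inj.
Qed.

Lemma occ_rcons w u : (occ w (rcons u false) + occ w (rcons u true))%N = occ w u.
Proof.
rewrite /occ -big_split; apply: eq_bigr => k _ /=.
set y := shiftn k (periodic w).
have e b : (mkseq y (size (rcons u b)) == rcons u b) = (mkseq y (size u) == u) && (y (size u) == b).
  rewrite size_rcons /mkseq -addn1 iotaD map_cat /= add0n cats1 eqseq_rcons //.
by rewrite !e; case: (mkseq _ _ == _); case: (y _).
Qed.

Lemma periodicD w i : periodic w (i + period w)%N = periodic w i.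
Proof. by rewrite /periodic modnDr. Qed.

(** Shifting the starting position by one permutes the positions of the cycle. *)
Lemma occ_cons w u : (occ w (false :: u) + occ w (true :: u))%N = occ w u.
Proof.
pose f k : nat := mkseq (shiftn k (periodic w)) (size u) == u.
transitivity (\sum_(k < period w) f k.+1)%N.
  rewrite /occ -big_split; apply: eq_bigr => k _ /=.
  have e b : (mkseq (shiftn k (periodic w)) (size (b :: u)) == b :: u) =
      (shiftn k (periodic w) 0%N == b) && (mkseq (shiftn k.+1 (periodic w)) (size u) == u).
    rewrite /mkseq /= eqseq_cons -[1%N]add1n iotaDl -map_comp; congr (_ && (_ == _)).
    by apply: eq_map => i /=; rewrite /shiftn; congr periodic; lia.
  by rewrite !e /f; case: (mkseq _ _ == _); case: (shiftn _ _ _).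
have -> : occ w u = (\sum_(k < period w) f k)%N by [].
rewrite -(big_mkord xpredT (fun k => f k.+1)) -(big_mkord xpredT f).
have [p pE] : exists p, period w = p.+1 by exists (period w).-1; rewrite prednK// period_gt0.
rewrite pE big_nat_recr//= [in RHS]big_nat_recl//= addnC; congr (_ + _)%N.
rewrite /f; congr (nat_of_bool (_ == _)); apply: eq_mkseq => i.
by rewrite /shiftn -pE addnC periodicD add0n.
Qed.

Lemma word_type_law w : good beta m (nth false w) -> block_law beta m (word_type w).
Proof.
move=> gw; have pw : (period w)%:R != 0 :> R by rewrite pnatr_eq0 -lt0n period_gt0.
split.
- rewrite /word_type /occ (eq_bigr (fun=> 1%N)) ?sum1_card ?card_ord ?divff//.
- by move=> u _; rewrite divr_ge0.
- move=> u um; rewrite mulf_eq0 invr_eq0 (negbTE pw) orbF pnatr_eq0 => u0.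
  have [k /eqP ku] : exists k : 'I_(period w), mkseq (shiftn k (periodic w)) (size u) == u.
    apply/existsP; apply: contraNT u0; rewrite negb_exists => /forallP h.
    by rewrite /occ big1// => k _; rewrite (negbTE (h k)).
  apply: (good_le hbeta _ (good_shift k (periodic_good gw))) => i ui.
  have iu : (i < size u)%N by rewrite ltnNge; apply/negP => le; rewrite nth_default in ui.
  by rewrite -ku nth_mkseq in ui.
- by move=> u um; rewrite -mulrDl -natrD occ_rcons.
- by move=> u um; rewrite -mulrDl -natrD occ_cons.
Qed.

Lemma word_type_zero w : word_type w [:: false] = (zeros w + m)%:R / (period w)%:R.
Proof.
rewrite /word_type; congr (_%:R / _); rewrite /occ.
rewrite (eq_bigr (fun k : 'I_(period w) => (~~ nth false (w ++ nseq m false) k : nat))); last first.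
  move=> k _; rewrite /mkseq /= /shiftn addn0 /periodic modn_small// nth_cat.
  case: ltnP => kw; last by rewrite nth_nseq if_same nth_default.
  by case: (nth _ _ _).
have -> : (zeros w + m)%N = zeros (w ++ nseq m false).
  by rewrite /zeros count_cat count_nseq mul1n.
rewrite -(big_mkord xpredT (fun k => (~~ nth false (w ++ nseq m false) k : nat))).
have -> : period w = size (w ++ nseq m false) by rewrite size_cat size_nseq.
elim/last_ind: (w ++ _) => [|s b IH]; first by rewrite big_nil.
rewrite size_rcons big_nat_recr//= nth_rcons ltnn eqxx /zeros -cats1 count_cat -/(zeros s) /= addn0.
congr (_ + _)%N; rewrite -IH; apply: eq_big_nat => i /andP[_ is_].
by rewrite cats1 nth_rcons is_.
Qed.

(** In the Markov extension of its own type, a word has probability about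
    [exp (- n h)], where [h] is the entropy of the type: the factors along the
    periodic sequence multiply exactly to the exponential of [- n h]. *)
Lemma markov_ext_type w : good beta m (nth false w) ->
  expR (- ((period w)%:R * block_entropy m (word_type w))) <=
  (period w)%:R * markov_ext m (word_type w) w.
Proof.
move=> gw; set q := word_type w; set T := period w; set y := periodic w.
have bq : block_law beta m q := word_type_law gw.
have T0 : 0 < T%:R :> R by rewrite ltr0n period_gt0.
have qpos k n : T%:R^-1 <= q (mkseq (shiftn k y) n).
  have modE i : y (k + i)%N = y (k %% T + i)%N.
    by rewrite /y /periodic -/T modnDml.
  have -> : mkseq (shiftn k y) n = mkseq (shiftn (k %% T) y) n.
    by apply: eq_mkseq => i; exact: modE.
  rewrite /q /word_type -[leLHS]mul1r ler_pM2r ?invr_gt0// ler1n /occ.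
  rewrite (bigD1 (Ordinal (ltn_pmod k (period_gt0 w))))//= size_mkseq eqxx.
  by [].
have drop_mkseq n k : drop k (mkseq y (n + k)) = mkseq (shiftn k y) n.
  apply: (@eq_from_nth _ false); rewrite size_drop !size_mkseq addnK// => i lt.
  by rewrite nth_drop !nth_mkseq// addnC ltn_add2r.
pose r k := q (mkseq (shiftn k y) m) / q (mkseq (shiftn k y) m.-1).
have q0 k n : 0 < q (mkseq (shiftn k y) n).
  by apply: lt_le_trans (qpos k n); rewrite invr_gt0.
have mE z : mkseq z m = rcons (mkseq z m.-1) (z m.-1).
  by rewrite -{1}(prednK (ltnW hm)) mkseqS.
have r0 k : 0 < r k by rewrite divr_gt0.
have r1 k : r k <= 1.
  rewrite ler_pdivrMr// mul1r mE (bl_rcons_le bq)// size_mkseq; lia.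
have ext L : markov_ext m q (mkseq y (m.-1 + L)) =
    q (mkseq y m.-1) * \prod_(k < L) r k.
  elim: L => [|L IH].
    by rewrite addn0 big_ord0 mulr1 (markov_ext_small bq)// size_mkseq; lia.
  rewrite addnS mkseqS markov_ext_rcons IH big_ord_recr size_mkseq [RHS]mulrA.
  have -> : ((m.-1 + L).+1 - m = L)%N by lia.
  have mL : ((m.-1 + L).+1 = m + L)%N by lia.
  by rewrite -mkseqS mL !drop_mkseq.
have prodE : \prod_(k < T) r k = expR (- (T%:R * block_entropy m q)).
  have lnr : \sum_(k < T) ln (r k) = - (T%:R * block_entropy m q).
    pose g u := ln (q u / q (take m.-1 u)).
    rewrite (block_entropyE hm bq) mulrN opprK mulr_sumr.
    transitivity (\sum_(k < period w) g (mkseq (shiftn k (periodic w)) m)).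
      apply: eq_bigr => k _; rewrite /g /r; congr (ln (_ / q _)).
      by rewrite mE -cats1 take_size_cat// size_mkseq.
    rewrite -sum_occ; apply: eq_bigr => u _; rewrite mulrA; congr (_ * _).
    by rewrite /q /word_type mulrCA divff ?gt_eqF// mulr1.
  rewrite -lnr; elim/big_rec2: _ => [|k x z _ ->]; first by rewrite expR0.
  by rewrite expRD lnK ?posrE ?r0.
have sub n k : \prod_(i < n + k) r i <= \prod_(i < n) r i.
  rewrite big_split_ord /= -[leRHS]mulr1 ler_pM2l ?prodr_gt0//.
  by apply: prodr_ile1 => i _; rewrite ltW//= r1.
have wy : w = mkseq y (size w).
  apply: (@eq_from_nth _ false) => [|i iw]; first by rewrite size_mkseq.
  by rewrite nth_mkseq// /y /periodic modn_small// /period; lia.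
have wle : markov_ext m q (mkseq y (m.-1 + size w)) <= markov_ext m q w.
  have -> : mkseq y (m.-1 + size w) = w ++ mkseq (shiftn (size w) y) m.-1.
    rewrite {2}wy /mkseq addnC iotaD map_cat add0n; congr (_ ++ _).
    by rewrite -[X in iota X]addn0 iotaDl -map_comp.
  exact: law_cat_le (markov_ext_law hm bq).
apply: le_trans (ler_wpM2l (ltW T0) wle); rewrite ext -prodE.
have TE : T = (size w + m)%N by [].
rewrite mulrA; apply: le_trans (_ : 1 * \prod_(k < size w) r k <= _).
  by rewrite mul1r TE sub.
rewrite ler_pM2r ?prodr_gt0//.
have := qpos 0%N m.-1; rewrite -(ler_pM2l T0) divff ?gt_eqF//.
Qed.

Lemma occ_le w u : (occ w u <= period w)%N.
Proof.
rewrite -[leqRHS]card_ord -sum1_card /occ; apply: leq_sum => k _.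
by case: (_ == _).
Qed.

Lemma eq_markov_ext (p q : seq bool -> R) w :
  (forall u, (size u <= m)%N -> p u = q u) -> markov_ext m p w = markov_ext m q w.
Proof.
move=> pq; apply: eq_bigr => i _.
by rewrite !pq// size_drop size_take_min; lia.
Qed.

Definition type_index n (w : n.-tuple bool) :
    {ffun m.-tuple bool * 'I_m.+1 -> 'I_(n + m).+1} :=
  [ffun x : m.-tuple bool * 'I_m.+1 => inord (occ w (take x.2 x.1))].

Lemma type_index_eq n (w v : n.-tuple bool) : type_index w = type_index v ->
  forall u, (size u <= m)%N -> word_type w u = word_type v u.
Proof.
move=> wv u um; have wS (x : n.-tuple bool) : period x = (n + m)%N by rewrite /period size_tuple.
have s : size (u ++ nseq (m - size u) false) == m by rewrite size_cat size_nseq subnKC.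
have k : (size u < m.+1)%N by [].
have := congr1 (fun f : {ffun m.-tuple bool * 'I_m.+1 -> 'I_(n + m).+1} =>
  f (Tuple s, Ordinal k) : nat) wv.
have le (x : n.-tuple bool) : (occ x u < (n + m).+1)%N by rewrite ltnS -(wS x) occ_le.
rewrite !ffunE /= take_size_cat// !inordK// => e.
by rewrite /word_type !wS e.
Qed.

(** Words of the same type all have probability at least [exp (- n h) / n] for
    one and the same law, and there are only polynomially many types. *)
Lemma card_words n (W : pred (n.-tuple bool)) (B : R) :
    (forall w : n.-tuple bool, W w -> good beta m (nth false w)) ->
    (forall w : n.-tuple bool, W w -> block_entropy m (word_type w) <= B) ->
  #|W|%:R <= ((n + m).+1 ^ (#|{: m.-tuple bool * 'I_m.+1}|).+1)%:R * expR ((n + m)%:R * B).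
Proof.
move=> gW hW; pose D := #|{: m.-tuple bool * 'I_m.+1}|.
have T0 : 0 < (n + m)%:R :> R by rewrite ltr0n; lia.
have class t : (\sum_(w : n.-tuple bool | W w && (type_index w == t)) 1)%N%:R <= (n + m)%:R * expR ((n + m)%:R * B).
  have [[w0 /andP[Ww0 /eqP tw0]]|nex] := pselect (exists w : n.-tuple bool, W w && (type_index w == t)); last first.
    rewrite big_pred0 ?mulr_ge0// ?expR_ge0// => w; apply/negP => h; apply: nex; by exists w.
  pose q := word_type w0; have bq : block_law beta m q := word_type_law (gW _ Ww0).
  rewrite natr_sum -ler_pdivrMr ?expR_gt0// -expRN mulr_suml.
  apply: (@le_trans _ _ (\sum_(w : n.-tuple bool) (n + m)%:R * markov_ext m q w)); last first.
    by rewrite -mulr_sumr (law_sum n (markov_ext_law hm bq)) mulr1.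
  rewrite [leRHS](bigID (fun w : n.-tuple bool => W w && (type_index w == t))) /=.
  rewrite -[leLHS]addr0 lerD//; last first.
    by apply: sumr_ge0 => w _; rewrite mulr_ge0// (law_ge0 (markov_ext_law hm bq)).
  apply: ler_sum => w /andP[Ww /eqP tw]; rewrite mul1r.
  have tq u : (size u <= m)%N -> q u = word_type w u.
    by move=> um; apply: type_index_eq => //; rewrite tw0 tw.
  rewrite (eq_markov_ext _ tq); have := markov_ext_type (gW _ Ww).
  rewrite /period size_tuple; apply: le_trans.
  by rewrite ler_expR lerN2 ler_pM2l// hW.
have -> : #|W| = (\sum_t \sum_(w : n.-tuple bool | W w && (type_index w == t)) 1)%N.
  rewrite -sum1_card (partition_big (@type_index n) predT)//=.
rewrite natr_sum; apply: le_trans (ler_sum _ (fun t _ => class t)) _.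
rewrite sumr_const -[leLHS]mulr_natl mulrA ler_wpM2r ?expR_ge0//.
rewrite -natrM ler_nat card_ffun card_ord expnSr leq_mul2l; apply/orP; right; lia.
Qed.

Lemma poly_le_exp (eta : R) D : 0 < eta ->
  exists2 C : R, 0 < C & forall n, (n.+1 ^ D)%:R <= C * expR (n%:R * eta).
Proof.
move=> eta0; case: D => [|D].
  exists 1 => // n; rewrite mul1r -[leLHS]expR0 ler_expR mulr_ge0// ltW//.
pose t := eta / D.+1%:R; have t0 : 0 < t by rewrite divr_gt0.
exists (expR eta / t ^+ D.+1) => [|n]; first by rewrite divr_gt0 ?expR_gt0// exprn_gt0.
rewrite natrX mulrAC ler_pdivlMr ?exprn_gt0// -exprMn.
have x0 : 0 <= n.+1%:R * t by rewrite mulr_ge0// ltW.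
apply: (@le_trans _ _ (expR (n.+1%:R * t) ^+ D.+1)).
  rewrite lerXn2r ?nnegrE ?expR_ge0//.
  by apply: le_trans (expR_ge1Dx _); rewrite lerDr.
rewrite -expRM_natl -expRD ler_expR.
have -> : D.+1%:R * (n.+1%:R * t) = n.+1%:R * eta.
  by rewrite mulrCA /t [_ * (_ / _)]mulrC divfK// pnatr_eq0.
by rewrite -natr1 mulrDl mul1r addrC.
Qed.

Definition near_words (a d : R) n : pred (n.-tuple bool) :=
  fun w : n.-tuple bool => `[< good beta m (nth false w) >] && (`|(zeros w)%:R / n%:R - a| < d).
Arguments near_words : clear implicits.

Lemma card_near_words (a M eta : R) : 0 < eta ->
    (forall q, block_law beta m q -> q [:: false] = a -> block_entropy m q <= M) ->
  exists d C (N : nat), [/\ 0 < d, 0 < C &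
    forall n, (N <= n)%N -> #|near_words a d n|%:R <= C * expR (n%:R * (M + eta))].
Proof.
move=> eta0 qM; have e2 : 0 < eta / 2 by rewrite divr_gt0.
have [d d0 hd] := block_entropy_usc hm e2 qM.
have [C C0 hC] := poly_le_exp (#|{: m.-tuple bool * 'I_m.+1}|).+1 e2.
have d2 : 0 < d / 2 by rewrite divr_gt0.
exists (d / 2), (C * expR (m%:R * (M + eta))), (Num.truncn (m%:R / (d / 2))).+1.
split => [//||n Nn]; first by rewrite mulr_gt0// expR_gt0.
have n0 : (0 < n)%N by apply: leq_trans Nn.
have nR : 0 < n%:R :> R by rewrite ltr0n.
have mn : m%:R / n%:R < d / 2.
  rewrite ltr_pdivrMr// mulrC -ltr_pdivrMr//; apply: lt_le_trans (truncnS_gt _) _.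
  by rewrite ler_nat.
have hW (w : n.-tuple bool) : near_words a (d / 2) n w -> block_entropy m (word_type w) <= M + eta / 2.
  move=> /andP[/asboolP gw nw]; apply/ltW/hd; first exact: word_type_law.
  rewrite word_type_zero /period size_tuple.
  have zn : (zeros w)%:R <= n%:R :> R by have := count_size negb w; rewrite size_tuple ler_nat.
  have z0 : 0 <= (zeros w)%:R :> R by [].
  have nm0 : 0 < n%:R + m%:R :> R by rewrite ltr_wpDr.
  have e : (zeros w + m)%:R / (n + m)%:R - (zeros w)%:R / n%:R =
      m%:R * (n%:R - (zeros w)%:R) / (n%:R * (n%:R + m%:R)) :> R.
    by rewrite !natrD; field; rewrite !gt_eqF.
  have b : `|(zeros w + m)%:R / (n + m)%:R - (zeros w)%:R / n%:R| <= m%:R / n%:R :> R.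
    rewrite e ger0_norm; last first.
      by rewrite divr_ge0 ?mulr_ge0 ?subr_ge0// ltW.
    rewrite invfM [_ * (n%:R^-1 * _)]mulrA ler_pdivrMr//.
    rewrite -mulrA [X in _ * X]mulrC mulrA ler_wpM2l ?divr_ge0//.
    by rewrite -[leRHS]subr0; have : 0 <= m%:R :> R by []; lra.
  have -> : (zeros w + m)%:R / (n + m)%:R - a =
     ((zeros w + m)%:R / (n + m)%:R - (zeros w)%:R / n%:R) + ((zeros w)%:R / n%:R - a) :> R.
    by rewrite addrA subrK.
  apply: le_lt_trans (ler_normD _ _) _; rewrite [d]splitr.
  by apply: ltrD => //; exact: le_lt_trans b mn.
have gW (w : n.-tuple bool) : near_words a (d / 2) n w -> good beta m (nth false w).
  by case/andP => /asboolP.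
apply: le_trans (card_words gW hW) _.
apply: le_trans (ler_wpM2r (expR_ge0 _) (hC (n + m)%N)) _.
rewrite -!mulrA ler_pM2l// -!expRD ler_expR natrD.
have : 0 <= m%:R :> R by []; have : 0 <= n%:R :> R by [].
by lra.
Qed.

End word_types.

(** * The upper bound *)

Section word_covers.
Context {R : realType}.
Implicit Types (U : set R) (s : R).

Lemma diam_le U r : (forall x y, U x -> U y -> `|x - y| <= r) -> (diam U <= r%:E)%E.
Proof. by move=> h; apply: ge_ereal_sup => _ [[x y] [Ux Uy] <-]; rewrite lee_fin h. Qed.

Lemma diam_ge0 U : U !=set0 -> (0 <= diam U)%E.
Proof.
move=> [x Ux]; apply: ereal_sup_ubound; exists (x, x) => //=.
by rewrite subrr normr0.
Qed.

Lemma diam_pow_ge0 s U : (0 <= diam_pow s U)%E.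
Proof. by rewrite /diam_pow; case: ifP => // _; exact: poweR_ge0. Qed.

Lemma diam_pow_le s U r : 0 <= s -> 0 <= r ->
  (forall x y, U x -> U y -> `|x - y| <= r) -> (diam_pow s U <= (r `^ s)%:E)%E.
Proof.
move=> s0 r0 Ur; rewrite /diam_pow; case: (eqVneq U set0) => [_|/set0P U0].
  by rewrite lee_fin powR_ge0.
have := diam_ge0 U0; have := diam_le Ur; case: (diam U) => [d| |] //= dr d0.
by rewrite lee_fin in dr d0; rewrite lee_fin ge0_ler_powR// ?nnegrE.
Qed.

Lemma premeasure_ge0 s d (F : set R) : (0 <= hausdorff_premeasure s d F)%E.
Proof.
apply: le_ereal_inf_tmp => _ [U _ <-]; apply: nneseries_ge0 => i _ _.
exact: diam_pow_ge0.
Qed.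

Lemma measure_eq0 s (F : set R) :
  (forall d e : R, 0 < d -> 0 < e -> (hausdorff_premeasure s d F <= e%:E)%E) ->
  hausdorff_measure s F = 0%E.
Proof.
move=> h; apply/eqP; rewrite eq_le; apply/andP; split.
  apply: ge_ereal_sup => _ [d /= d0 <-]; apply/lee_addgt0Pr => e e0.
  by rewrite add0e h.
apply: le_trans (premeasure_ge0 s 1 F) _; apply: ereal_sup_ubound.
by exists 1 => //=; exact: ltr01.
Qed.

Lemma sum_words_le (c : seq bool -> R) (l : seq (seq bool)) :
  (forall w, 0 <= c w) -> uniq l ->
  exists K, \sum_(w <- l) c w <= \sum_(n < K) \sum_(w : n.-tuple bool) c w.
Proof.
move=> c0 ul; pose K := (\max_(w <- l) size w).+1; exists K.
have -> : \sum_(w <- l) c w = \sum_(w <- l) \sum_(n < K) (if size w == n then c w else 0).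
  apply: eq_big_seq => w wl; have wK : (size w < K)%N.
    by rewrite ltnS; exact: leq_bigmax_seq.
  by rewrite -big_mkcond (big_pred1 (Ordinal wK))// => n; rewrite eq_sym.
rewrite exchange_big; apply: ler_sum => n _.
rewrite -big_mkcond -big_filter.
have -> : \sum_(w <- [seq w <- l | size w == n]) c w =
    \sum_(w <- [seq tval t | t <- enum [pred t : n.-tuple bool | tval t \in l]]) c w.
  apply: perm_big; apply: uniq_perm.
  - exact: filter_uniq.
  - by rewrite map_inj_uniq ?enum_uniq//; exact: val_inj.
  move=> w; rewrite mem_filter; apply/andP/mapP.
    by move=> [sw wl]; exists (Tuple sw) => //; rewrite mem_enum.
  by move=> [t]; rewrite mem_enum /= => tl ->; rewrite size_tuple.
rewrite big_map big_enum /= [leRHS](bigID (fun t : n.-tuple bool => tval t \in l)) /= lerDl.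
exact: sumr_ge0.
Qed.

(** Covers indexed by words are countable covers, and finitely many words are
    among those of length less than some [K]. *)
Lemma premeasure_words_le s d (F : set R) (J : seq bool -> set R) (c : seq bool -> R) (E : R) :
    0 < d -> (forall w, (diam (J w) <= d%:E)%E) ->
    (forall w, (diam_pow s (J w) <= (c w)%:E)%E) ->
    F `<=` \bigcup_w J w ->
    (forall K, \sum_(n < K) \sum_(w : n.-tuple bool) c w <= E) ->
  (hausdorff_premeasure s d F <= E%:E)%E.
Proof.
move=> d0 Jd Jc FJ cE.
have c0 w : 0 <= c w by rewrite -lee_fin; apply: le_trans (Jc w); exact: diam_pow_ge0.
pose U i : set R := if pickle_inv i is Some w then J w else set0.
apply: (@le_trans _ _ (\sum_(0 <= i <oo) diam_pow s (U i))%E).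
  apply: ereal_inf_lbound; exists U => //; split.
    move=> x /FJ [w _ Jx]; exists (pickle w) => //.
    by rewrite /U pickleK_inv.
  move=> i; rewrite /U; case: pickle_inv => [w//|].
  by apply: diam_le => x y [].
apply: lime_le; first by apply: is_cvg_nneseries => i _ _; exact: diam_pow_ge0.
apply: nearW => N.
pose c' i := if pickle_inv i is Some w then c w else 0.
apply: (@le_trans _ _ (\sum_(0 <= i < N) (c' i)%:E)%E).
  apply: lee_sum => i _; rewrite /U /c'; case: pickle_inv => [w|]; first exact: Jc.
  by rewrite /diam_pow eqxx.
rewrite sumEFin lee_fin.
have ul : uniq (pmap (@pickle_inv (seq bool)) (iota 0 N)).
  by apply: (pmap_uniq (@pickle_invK _)); exact: iota_uniq.
have [K] := sum_words_le c0 ul; rewrite big_pmap => h.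
apply: le_trans (cE K); apply: le_trans h; rewrite /index_iota subn0 le_eqVlt.
by apply/orP; left; apply/eqP; apply: eq_bigr => i _; rewrite /c'; case: pickle_inv.
Qed.

Lemma geometric_tail (r : R) n0 K : 0 <= r < 1 ->
  \sum_(n < K) (if (n0 <= n)%N then r ^+ n else 0) <= r ^+ n0 / (1 - r).
Proof.
move=> /andP[r0 r1]; have r1' : 0 < 1 - r by rewrite subr_gt0.
rewrite ler_pdivlMr//.
suff -> : (\sum_(n < K) (if (n0 <= n)%N then r ^+ n else 0)) * (1 - r) =
    r ^+ n0 - r ^+ (maxn n0 K) by rewrite gerBl exprn_ge0.
elim: K => [|K IH]; first by rewrite big_ord0 mul0r maxn0 subrr.
rewrite big_ord_recr /= mulrDl IH; case: leqP => h.
  have -> : maxn n0 K.+1 = K.+1 by apply/maxn_idPr; exact: leqW.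
  by rewrite exprS; ring.
by rewrite mul0r addr0; have -> : maxn n0 K.+1 = n0 by apply/maxn_idPl.
Qed.

End word_covers.

Section upper_bound.
Context {R : realType} (beta : R) (hbeta : 1 < beta < 2) (m : nat).
Hypotheses (hm : (2 <= m)%N).

Let beta_gt1 : 1 < beta. Proof. by case/andP: hbeta. Qed.
Let beta_gt0 : 0 < beta. Proof. exact: lt_trans beta_gt1. Qed.
Let lnb_gt0 : 0 < ln beta. Proof. exact: ln_gt0. Qed.

Definition greedy_cylinder (w : seq bool) : set R :=
  [set x | 0 <= x < 1 /\ mkseq (dig beta x) (size w) = w].

Lemma greedy_cylinder_diam w x y :
  greedy_cylinder w x -> greedy_cylinder w y -> `|x - y| <= beta ^- size w.
Proof.
have itv z : greedy_cylinder w z ->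
    bval beta (size w) (nth false w) <= z < bval beta (size w) (nth false w) + beta ^- size w.
  move=> [z01 zw]; have z01' : 0 <= z <= 1 by case/andP: z01 => -> /ltW ->.
  have -> : bval beta (size w) (nth false w) = bval beta (size w) (dig beta z).
    by apply: eq_bval => i iw; rewrite -[in LHS]zw nth_mkseq.
  by rewrite (bval_dig_le hbeta)// (bval_dig_gt hbeta).
by move=> /itv /andP[x1 x2] /itv /andP[y1 y2]; rewrite ler_norml; apply/andP; split; lra.
Qed.

Lemma zeros_mkseq (x : R) n : 0 <= x < 1 ->
  zeros (mkseq (dig beta x) n) = (\sum_(1 <= k < n.+1) (digit beta x k == 0%Z))%N.
Proof.
move=> /andP[x0 /ltW x1]; elim: n => [|n IH]; first by rewrite big_geq.
rewrite mkseqS /zeros -cats1 count_cat -/(zeros _) IH [RHS]big_nat_recr//=.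
by rewrite (digitE hbeta) ?x0//= addn0; case: (dig beta x n).
Qed.

Lemma powR_betaN n s : (beta ^- n) `^ s = expR (- (n%:R * s * ln beta)).
Proof.
have b0 : 0 < beta ^- n by rewrite invr_gt0 exprn_gt0.
rewrite /powR gt_eqF// lnV ?posrE ?exprn_gt0// lnXn//; congr expR.
by rewrite -mulr_natl; ring.
Qed.

(** The points whose digits have frequency [a] lie, for every large [n], in one
    of the cylinders of length [n] with nearly that frequency; there are at
    most about [exp (n M)] of them, each of length at most [beta ^- n]. *)
Lemma frequency_measure_eq0 (a M s : R) : 0 <= s ->
    (forall q, block_law beta m q -> q [:: false] = a -> block_entropy m q <= M) ->
    M < s * ln beta ->
  hausdorff_measure s (frequency_set beta a) = 0%E.
Proof.
move=> s0 qM Ms; pose eta := (s * ln beta - M) / 2.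
have eta0 : 0 < eta by rewrite divr_gt0// subr_gt0.
have [d [C [N [d0 C0 hC]]]] := card_near_words hbeta hm eta0 qM.
pose r := expR (- eta); have r0 : 0 < r by exact: expR_gt0.
have r1 : r < 1 by rewrite expR_lt1 oppr_lt0.
have r1' : 0 < 1 - r by rewrite subr_gt0.
apply: measure_eq0 => del e del0 e0.
have rlt : `|r| < 1 by rewrite gtr0_norm.
have [n0 [n0N n0del n0e]] : exists n0, [/\ (N <= n0)%N, beta ^- n0 <= del &
    C * (r ^+ n0 / (1 - r)) <= e].
  have bi : `|beta^-1| < 1.
    by rewrite gtr0_norm ?invr_gt0// invf_lt1.
  have e' : 0 < e * (1 - r) / C by rewrite divr_gt0// mulr_gt0.
  have /cvgrPdist_lt/(_ _ del0) A := cvg_expr bi.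
  have /cvgrPdist_lt/(_ _ e') B := cvg_expr rlt.
  near \oo => n0; exists n0; split.
  - by near: n0; exact: nbhs_infty_ge.
  - have : `|0 - beta^-1 ^+ n0| < del by near: n0.
    rewrite sub0r normrN exprVn ger0_norm; first exact: ltW.
    by rewrite invr_ge0 exprn_ge0// ltW.
  - have : `|0 - r ^+ n0| < e * (1 - r) / C by near: n0.
    rewrite sub0r normrN ger0_norm; last by rewrite exprn_ge0// ltW.
    move=> h.
    rewrite mulrA ler_pdivrMr// mulrC -ler_pdivlMr//; exact: ltW.
pose sel (w : seq bool) := (n0 <= size w)%N &&
  (`[< good beta m (nth false w) >] && (`|(zeros w)%:R / (size w)%:R - a| < d)).
pose J w := if sel w then greedy_cylinder w else set0.
pose c w := if sel w then (beta ^- size w) `^ s else 0.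
apply: (@premeasure_words_le _ s del _ J c) => //.
- move=> w; rewrite /J; case: ifP => [/andP[nw _]|_]; last by apply: diam_le => x y [].
  apply: le_trans (diam_le (@greedy_cylinder_diam w)) _; rewrite lee_fin.
  apply: le_trans n0del; rewrite lef_pV2 ?posrE ?exprn_gt0//.
  by rewrite ler_weXn2l// ltW.
- move=> w; rewrite /J /c; case: ifP => _; last by rewrite /diam_pow eqxx.
  apply: diam_pow_le => //; first by rewrite invr_ge0 exprn_ge0// ltW.
  exact: greedy_cylinder_diam.
- move=> x [x01 /cvgrPdist_lt/(_ _ d0) xa].
  near \oo => n.
  have nn0 : (n0 <= n)%N by near: n; exact: nbhs_infty_ge.
  have fr : `|a - (\sum_(1 <= k < n.+1) (digit beta x k == 0%Z))%N%:R / n%:R| < d by near: n.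
  exists (mkseq (dig beta x) n) => //; rewrite /J.
  suff -> : sel (mkseq (dig beta x) n) by split; rewrite ?size_mkseq.
  rewrite /sel size_mkseq nn0 (zeros_mkseq _ x01) distrC fr andbT /=.
  apply/asboolP; apply: (good_le hbeta _ (good_dig hbeta m x01)) => i.
  have [lt|le] := ltnP i n; first by rewrite nth_mkseq.
  by rewrite nth_default// size_mkseq.
move=> K; apply: le_trans n0e; rewrite mulrC -ler_pdivrMr// mulrC mulr_sumr.
apply: le_trans (geometric_tail n0 K _); last by rewrite r1 ltW.
apply: ler_sum => n _; have [le|lt] := leqP n0 n; last first.
  rewrite big1 ?mulr0// => w _; rewrite /c /sel size_tuple leqNgt lt.
  by [].
rewrite ler_pdivrMl//.
have -> : \sum_(w : n.-tuple bool) c w = #|@near_words _ beta m a d n|%:R * (beta ^- n) `^ s.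
  rewrite -sum1_card natr_sum mulr_suml [RHS]big_mkcond; apply: eq_bigr => w _ /=.
  rewrite /c /sel size_tuple le /near_words unfold_in /=.
  by case: ifP => _; rewrite ?mul1r.
apply: le_trans (ler_wpM2r (powR_ge0 _ _) (hC n (leq_trans n0N le))) _.
rewrite -mulrA ler_pM2l// powR_betaN -expRD /r -expRM_natl ler_expR.
by rewrite /eta; have : 0 <= n%:R :> R by []; lra.
Unshelve. all: by end_near. Qed.

Lemma frequency_dim_le (a M : R) : 0 <= M ->
    (forall q, block_law beta m q -> q [:: false] = a -> block_entropy m q <= M) ->
  (hausdorff_dim (frequency_set beta a) <= (M / ln beta)%:E)%E.
Proof.
move=> M0 qM; apply/lee_addgt0Pr => e e0; rewrite -EFinD.
apply: ereal_inf_lbound; exists (M / ln beta + e) => //; split.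
  by rewrite addr_ge0 ?divr_ge0// ltW.
apply: (@frequency_measure_eq0 _ M) => //.
  by rewrite addr_ge0 ?divr_ge0// ltW.
by rewrite mulrDl divfK ?gt_eqF// ltrDl mulr_gt0.
Qed.

End upper_bound.

(** * A mass distribution principle *)

Section mass_distribution.
Context {R : realType} (beta : R) (hbeta : 1 < beta < 2) (m : nat).
Hypotheses (hm : (2 <= m)%N) (hdigit : digit beta 1 m = 1%Z)
  (hfinite : forall i : nat, (m < i)%N -> digit beta 1 i = 0%Z).

Let beta_gt1 : 1 < beta. Proof. by case/andP: hbeta. Qed.
Let beta_gt0 : 0 < beta. Proof. exact: lt_trans beta_gt1. Qed.

Lemma seqval_dig z : 0 <= z < 1 -> seqval beta (dig beta z) = z.
Proof.
move=> z01; have z01' : 0 <= z <= 1 by case/andP: z01 => -> /ltW ->.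
apply/cvg_lim => //; apply/cvgrPdist_lt => e e0.
have [N Ne] := betaN_small hbeta e0.
near=> n; have nN : (N <= n)%N by near: n; exact: nbhs_infty_ge.
have l := bval_dig_le hbeta n z01'; have u := bval_dig_gt hbeta n z01.
rewrite ger0_norm ?subr_ge0//; apply: lt_trans (_ : beta ^- n < e); first by lra.
apply: le_lt_trans Ne; rewrite lef_pV2 ?posrE ?exprn_gt0//.
by rewrite ler_weXn2l// ltW.
Unshelve. all: by end_near. Qed.

(** A good word followed by [m] zeros can be continued by any expansion, so the
    cylinder of a good word of length [n] contains an interval of length
    [beta ^- (n + m)]. *)
Lemma full_interval (w : seq bool) z : good beta m (nth false w) -> 0 <= z < 1 ->
  let x := bval beta (size w) (nth false w) + z / beta ^+ (size w + m) in
  0 <= x < 1 /\ mkseq (dig beta x) (size w) = w.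
Proof.
move=> gw z01 x; pose N := (size w + m)%N.
pose y i := if (i < N)%N then nth false w i else dig beta z (i - N)%N.
have yw i : (i < N)%N -> y i = nth false w i by rewrite /y => ->.
have yS : shiftn N y = dig beta z.
  by apply/funext => i; rewrite /shiftn /y ltnNge leq_addr /= addKn.
have gy : good beta m y.
  by apply: (good_join hbeta gw) => //; rewrite -/N yS; exact: good_dig.
pose g i := seqval beta (shiftn i y).
have gE i : g i = (y i)%:R / beta + g i.+1 / beta.
  rewrite /g (seqvalD hbeta hm hdigit hfinite 1 (good_shift i gy)) bval1 /shiftn addn0 expr1.
  congr (_ + seqval _ _ / _); apply/funext => j; congr y; lia.
have g01 i : 0 <= g i < 1.
  have g0 j : 0 <= g j := seqval_ge0 hbeta hm hdigit hfinite (good_shift j gy).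
  rewrite g0 /=; have [iN|Ni] := leqP N i.
    have -> : g i = iter (i - N) (beta_map beta) z.
      rewrite /g (_ : shiftn i y = dig beta (iter (i - N) (beta_map beta) z)).
        by rewrite seqval_dig//; exact: iter_bound_lt.
      apply/funext => j; rewrite dig_iter -yS /shiftn; congr y; lia.
    by case/andP: (iter_bound_lt beta (i - N) z01).
  have [wi|iw] := leqP i (size w).
    apply: (seqval_lt1 hbeta hm hdigit hfinite (good_shift i gy) (q := (size w - i)%N)) => j ij.
    by rewrite /shiftn yw ?nth_default//; move: ij; rewrite /N; lia.
  rewrite gE yw// nth_default ?(ltnW iw)// mul0r add0r ltr_pdivrMr// mul1r.
  exact: le_lt_trans (seqval_le1 hbeta hm hdigit hfinite (good_shift i.+1 gy)) beta_gt1.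
have xE : g 0%N = x.
  rewrite /g (_ : shiftn 0 y = y)// (seqvalD hbeta hm hdigit hfinite N gy) yS seqval_dig//.
  congr (_ + _); rewrite /N bvalD [X in _ + X / _]big1 ?mul0r ?addr0; last first.
    by move=> i _; rewrite /shiftn yw ?nth_default ?leq_addr ?mul0r// ltn_add2l.
  by apply: eq_bval => i iw; rewrite yw// ltn_addr.
rewrite -xE; split=> //; apply: (@eq_from_nth _ false); rewrite size_mkseq// => i iw.
by rewrite nth_mkseq// (coding hbeta gE g01 i).2 yw// ltn_addr.
Qed.

(** The first digit increases with the point, and the transformation increases
    where the first digit is constant. *)
Lemma greedy_cylinder_convex n x y z : 0 <= x <= y -> y <= z < 1 ->
  mkseq (dig beta x) n = mkseq (dig beta z) n -> mkseq (dig beta y) n = mkseq (dig beta x) n.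
Proof.
elim: n x y z => // n IH x y z /andP[x0 xy] /andP[yz z1] e.
have cons u : mkseq (dig beta u) n.+1 = dig beta u 0%N :: mkseq (dig beta (beta_map beta u)) n.
  rewrite /mkseq /= -[1%N]add1n iotaDl -map_comp; congr (_ :: _).
  by apply: eq_map => i /=; rewrite -(dig_iter beta u 1).
move: e; rewrite !cons => -[e0 e1].
have b u : 0 <= u <= z -> 0 <= u <= 1 by move=> /andP[-> uz]; apply: le_trans uz (ltW z1).
have bx : 0 <= x <= 1 by apply: b; rewrite x0; exact: le_trans yz.
have by_ : 0 <= y <= 1 by apply: b; rewrite yz andbT; exact: le_trans xy.
have bz : 0 <= z <= 1 by apply: b; rewrite lexx andbT (le_trans x0)// (le_trans xy).
have fl u v : 0 <= u <= 1 -> 0 <= v <= 1 -> u <= v -> (dig beta u 0%N <= dig beta v 0%N)%N.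
  move=> bu bv uv; have := digitE hbeta 0 bu; have := digitE hbeta 0 bv; rewrite /digit /=.
  move=> ev eu; rewrite -lez_nat -ev -eu; apply: le_floor.
  by rewrite ler_pM2l.
have exy : dig beta x 0%N = dig beta y 0%N.
  have := fl _ _ bx by_ xy; have := fl _ _ by_ bz yz; rewrite -e0.
  by case: (dig beta x _); case: (dig beta y _).
have T u : 0 <= u <= 1 -> beta_map beta u = beta * u - (dig beta u 0%N)%:R.
  exact: beta_mapE.
have zx : 0 <= z < 1 by rewrite z1 andbT; case/andP: bz.
rewrite exy; congr (_ :: _); apply: IH e1.
- have x1 : 0 <= x < 1 by rewrite x0 (le_lt_trans xy)// (le_lt_trans yz).
  have /= /andP[-> _] := iter_bound_lt beta 1 x1; rewrite !T// exy lerD2r ler_pM2l//.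
- have /= /andP[_ ->] := iter_bound_lt beta 1 zx.
  by rewrite andbT !T// -e0 exy lerD2r ler_pM2l//.
Qed.

(** The cylinder of [y] contains an interval of length [beta ^- (n + m)] starting
    at its left end ([full_interval]), and both [x] and [z] lie outside. *)
Lemma three_cylinders n x y z : 0 <= x <= y -> y <= z < 1 ->
    mkseq (dig beta x) n != mkseq (dig beta y) n ->
    mkseq (dig beta y) n != mkseq (dig beta z) n ->
  beta ^- (n + m) <= z - x.
Proof.
move=> /andP[x0 xy] /andP[yz z1] nxy nyz; pose w := mkseq (dig beta y) n.
have y01 : 0 <= y < 1 by rewrite (le_trans x0)// (le_lt_trans yz).
have sw : size w = n by rewrite size_mkseq.
have wE : bval beta n (nth false w) = bval beta n (dig beta y).
  by apply: eq_bval => i iw; rewrite nth_mkseq.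
have gw : good beta m (nth false w).
  apply: (good_le hbeta _ (good_dig hbeta m y01)) => i.
  have [lt|le] := ltnP i n; first by rewrite nth_mkseq.
  by rewrite nth_default// sw.
have Ly : bval beta n (nth false w) <= y.
  by rewrite wE (bval_dig_le hbeta)//; case/andP: y01 => -> /ltW ->.
pose c := beta ^- (n + m); have c0 : 0 < c by rewrite invr_gt0 exprn_gt0.
have full u : bval beta n (nth false w) <= u < bval beta n (nth false w) + c ->
    0 <= u < 1 /\ mkseq (dig beta u) n = w.
  move=> /andP[u1 u2]; pose v := (u - bval beta n (nth false w)) / c.
  have v01 : 0 <= v < 1.
    by rewrite divr_ge0 ?subr_ge0 ?(ltW c0)//= ltr_pdivrMr// mul1r ltrBlDl.
  have := full_interval gw v01; rewrite sw -/c.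
  by rewrite /v divfK ?gt_eqF// addrC subrK.
have zL : bval beta n (nth false w) + c <= z.
  rewrite leNgt; apply/negP => h; have [|_ zw] := full z; first by rewrite h (le_trans Ly).
  by move: nyz; rewrite zw eqxx.
have xL : x < bval beta n (nth false w).
  rewrite ltNge; apply/negP => h; have [|/andP[L0 _] Lw] := full (bval beta n (nth false w)).
    by rewrite lexx ltrDl.
  move/negP: nxy; apply; apply/eqP; rewrite -/w -Lw.
  apply: (@greedy_cylinder_convex _ _ _ y); rewrite ?L0 ?h ?xy//.
  by case/andP: y01.
by rewrite -/c; lra.
Qed.

(** Of three cylinders of length [n] met by a set, the middle one is contained
    in its convex hull. *)
Lemma two_prefixes n (U : set R) d : d < beta ^- (n + m) ->
    (forall x y, U x -> U y -> `|x - y| <= d) ->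
  exists w1 w2 : seq bool, [/\ size w1 = n, size w2 = n & forall x, U x -> 0 <= x < 1 ->
    mkseq (dig beta x) n = w1 \/ mkseq (dig beta x) n = w2].
Proof.
move=> dn Ud; pose P x := mkseq (dig beta x) n.
have [[x0 [U0 x01]]|none] := pselect (exists x, U x /\ 0 <= x < 1); last first.
  exists (nseq n false), (nseq n false); rewrite size_nseq; split=> // x Ux x01.
  by case: none; exists x.
have [[y0 [V0 y01 nxy]]|all1] := pselect (exists y, [/\ U y, 0 <= y < 1 & P y != P x0]); last first.
  exists (P x0), (P x0); rewrite size_mkseq; split=> // x Ux x01'; left.
  by apply/eqP/negPn/negP => h; apply: all1; exists x.
exists (P x0), (P y0); rewrite !size_mkseq; split=> // z Uz z01.
apply: contrapT => /not_orP[/eqP nz1 /eqP nz2].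
have key u v t : U u -> U t -> 0 <= u < 1 -> 0 <= t < 1 -> u <= v -> v <= t ->
    P u != P v -> P v != P t -> False.
  move=> Uu Ut /andP[u0 _] /andP[_ t1] uv vt n1 n2.
  have := @three_cylinders n u v t; rewrite u0 uv vt t1 => /(_ isT isT n1 n2).
  by have := Ud _ _ Ut Uu; rewrite ger0_norm; [lra|rewrite subr_ge0 (le_trans uv)].
move: (nxy) (nz1) (nz2); rewrite eq_sym => nxy' nz1' nz2'.
have [xy|/ltW xy] := leP x0 y0; have [xz|/ltW xz] := leP x0 z; have [yz|/ltW yz] := leP y0 z;
  rewrite -/(P z) in nz1 nz2 nz1' nz2'.
- by apply: (key x0 y0 z) => //; rewrite eq_sym.
- by apply: (key x0 z y0) => //; rewrite eq_sym.
- by apply: (key z x0 y0) => //; rewrite eq_sym.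
- by apply: (key z x0 y0) => //; rewrite eq_sym.
- by apply: (key y0 x0 z) => //; rewrite eq_sym.
- by apply: (key y0 x0 z) => //; rewrite eq_sym.
- by apply: (key y0 z x0) => //; rewrite eq_sym.
- by apply: (key z y0 x0) => //; rewrite eq_sym.
Qed.

Section coded_points.
Variables (p : seq bool -> R) (s : R) (C : R).
Hypotheses (lp : law p) (s0 : 0 <= s)
  (pC : forall w, p w <= C * expR (- ((size w)%:R * s * ln beta))).

Definition coded_by (U : set R) : set R :=
  [set t | 0 <= t < 1 /\ exists x, [/\ U x, 0 <= x < 1 & dig beta x =1 codeseq p t]].

Let K := 2 * C * expR (m.+1%:R * s * ln beta).

Let C0 : 0 < C.
Proof.
have := pC [::]; rewrite mul0r mul0r oppr0 expR0 mulr1 (law0 lp).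
exact: lt_le_trans ltr01.
Qed.

Let K0 : 0 < K. Proof. by rewrite !mulr_gt0 ?expR_gt0. Qed.

Let lnb_gt0 : 0 < ln beta. Proof. exact: ln_gt0. Qed.

Let leb (A : set R) := lebesgue_measure A.

(** If [beta ^- (n + m)] is the power of [beta] just above [r], the set [U] meets at
    most two cylinders of length [n], each of mass at most [C * beta ^- (n s)]. *)
Lemma coded_by_le (U : set R) r s' : 0 < r -> r < beta ^- m -> 0 <= s' <= s ->
    (forall x y, U x -> U y -> `|x - y| <= r) ->
  exists A : set R, [/\ measurable A, coded_by U `<=` A & (leb A <= (K * r `^ s')%:E)%E].
Proof.
move=> r0 rm /andP[s'0 s's] Ur.
have [k bk] : exists k, beta ^- (k + m) <= r.
  have [k bk] := betaN_small hbeta r0; exists k; apply: le_trans (ltW bk).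
  by rewrite lef_pV2 ?posrE ?exprn_gt0// ler_weXn2l ?leq_addr// ltW.
case: (ex_minnP (ex_intro (fun k => beta ^- (k + m) <= r) k bk)) => -[|n] bn min.
  by move: bn; rewrite add0n leNgt rm.
have rn : r < beta ^- (n + m).
  by rewrite ltNge; apply/negP => /min; rewrite ltnn.
have [w1 [w2 [s1 s2 h]]] := two_prefixes rn Ur.
pose I w : set R := `[left_end p w, left_end p w + p w[%classic.
have lI w : leb (I w) = (p w)%:E.
  rewrite /leb /I lebesgue_measure_itv /= lte_fin ltrDl.
  have := law_ge0 lp w; rewrite le_eqVlt => /orP[/eqP <-|->]; first by rewrite ltxx.
  by rewrite -EFinB addrAC subrr add0r.
exists (I w1 `|` I w2); split.
    by apply: measurableU; exact: measurable_itv.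
  move=> t [t01 [x [Ux x01 xt]]].
  have tE w : size w = n -> mkseq (dig beta x) n = w -> I w t.
    move=> sw xw; rewrite /I /= in_itv /= -code_prefixP// sw -{1}xw.
    by apply/eqP; apply: eq_mkseq => i; rewrite xt.
  by have [/tE|/tE] := h x Ux x01; [left|right]; auto.
apply: (@le_trans _ _ (leb (I w1) + leb (I w2))%E).
  by apply: measureU2; exact: measurable_itv.
rewrite !lI -EFinD lee_fin.
have pw w : size w = n -> p w <= C * expR (- (n%:R * s * ln beta)).
  by move=> <-.
apply: le_trans (lerD (pw _ s1) (pw _ s2)) _.
rewrite -mulrDl -mulr2n -[C *+ 2]mulr_natl /K -[leRHS]mulrA.
have C2 : 0 <= 2 * C by rewrite mulr_ge0 // ltW.
apply: ler_wpM2l; rewrite // -ler_pdivrMl ?expR_gt0// -expRN -expRD.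
have rs : r `^ s <= r `^ s'.
  apply: ger_powR => //; rewrite r0 /=; apply: le_trans (ltW rm) _.
  by rewrite invf_le1 ?exprn_gt0// exprn_ege1// ltW.
apply: le_trans rs; apply: le_trans (_ : (beta ^- (n.+1 + m)) `^ s <= _); last first.
  by apply: ge0_ler_powR => //; rewrite nnegrE ?(ltW r0)// invr_ge0 exprn_ge0// ltW.
rewrite powR_betaN// ler_expR natrD -!natr1 le_eqVlt; apply/orP; left.
by apply/eqP; ring.
Qed.

(** The error term pays for a set of diameter 0, which must be given a positive
    radius. *)
Lemma coded_by_cover (U : set R) s' e : 0 <= s' <= s -> 0 < e ->
    (diam U <= (beta ^- m.+1)%:E)%E ->
  exists A : set R, [/\ measurable A, coded_by U `<=` A &
    (leb A <= K%:E * diam_pow s' U + e%:E)%E].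
Proof.
move=> s's e0 Ud; pose del := beta ^- m.+1.
have del0 : 0 < del by rewrite invr_gt0 exprn_gt0.
have delm : del < beta ^- m.
  by rewrite ltf_pV2 ?posrE ?exprn_gt0// ltr_eXn2l.
rewrite /diam_pow; case: (eqVneq U set0) => [->|/set0P U0].
  exists set0; split => //; first by move=> t [_ [x []]].
  by rewrite /leb measure0 mule0 add0e lee_fin ltW.
have in_ball x y : U x -> U y -> (`|x - y|%:E <= diam U)%E.
  by move=> Ux Uy; apply: ereal_sup_ubound; exists (x, y).
have d0 := diam_ge0 U0; move: in_ball d0 Ud; case: (diam U) => [d| |] //.
rewrite !lee_fin => Ud d0 dle; rewrite poweR_EFin -EFinM -EFinD.
suff [r [r0 dr rm rs]] : exists r, [/\ 0 < r, d <= r, r < beta ^- m &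
    K * r `^ s' <= K * d `^ s' + e].
  have [|A [mA UA Ar]] := coded_by_le r0 rm s's (U := U).
    by move=> x y Ux Uy; rewrite -lee_fin (le_trans (Ud _ _ Ux Uy))// lee_fin.
  by exists A; split=> //; apply: le_trans Ar _; rewrite lee_fin.
move: d0; rewrite le_eqVlt => /orP[/eqP d0|d0]; last first.
  by exists d; split=> //; [exact: le_lt_trans delm|rewrite lerDl ltW].
case/andP: s's; rewrite le_eqVlt => /orP[/eqP <-|s'0] s's.
  by exists del; rewrite !powRr0 -d0 lerDl ltW//; split=> //; exact: ltW.
have eK : 0 < e / K by rewrite divr_gt0.
pose r0 := (e / K) `^ s'^-1.
have r00 : 0 < r0 by exact: powR_gt0.
exists (Num.min del r0); split.
- by rewrite lt_min del0 r00.
- by rewrite -d0 le_min !ltW.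
- by rewrite gt_min delm.
rewrite -d0 powR0 ?gt_eqF// mulr0 add0r -ler_pdivlMl// [leRHS]mulrC.
apply: le_trans (_ : r0 `^ s' <= _); last first.
  by rewrite -powRrM mulVf ?gt_eqF// powRr1// ltW.
by apply: ge0_ler_powR; rewrite ?nnegrE ?ge_min ?lexx ?orbT ?le_min ?ltW.
Qed.

(** If a set contains points coded by all of [0, 1[, then a cover of it gives a
    cover of [0, 1[, whose Lebesgue measure is bounded by the sum of the
    powers of the diameters. *)
Lemma mass_distribution (F : set R) s' : 0 <= s' <= s ->
    (forall t, 0 <= t < 1 -> exists x, [/\ F x, 0 <= x < 1 & dig beta x =1 codeseq p t]) ->
  hausdorff_measure s' F <> 0%E.
Proof.
move=> s's Fall F0; pose e : R := (2 * (K + 1))^-1.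
have K1 : 0 < K + 1 by exact: addr_gt0.
have e0 : 0 < e by rewrite invr_gt0 mulr_gt0.
have del0 : 0 < beta ^- m.+1 by rewrite invr_gt0 exprn_gt0.
have : (hausdorff_premeasure s' (beta ^- m.+1) F < e%:E)%E.
  apply: le_lt_trans (_ : _ <= 0)%E _; last by rewrite lte_fin.
  by rewrite -F0; apply: ereal_sup_ubound; exists (beta ^- m.+1).
move=> /ereal_inf_lt[_ [U [FU Ud] <-] Ue].
have h2 : 0 < 4^-1 :> R by rewrite invr_gt0.
have /choice[A hA] i : exists A : set R, [/\ measurable A, coded_by (U i) `<=` A &
    (leb A <= K%:E * diam_pow s' (U i) + (4^-1 / (2 ^ i.+1)%:R)%:E)%E].
  by apply: coded_by_cover => //; rewrite divr_gt0// ltr0n expn_gt0.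
have cover : `[0, 1[%classic `<=` \bigcup_i A i.
  move=> t /=; rewrite in_itv /= => t01; have [x [Fx x01 xt]] := Fall t t01.
  have [i _ Ux] := FU x Fx; exists i => //; have [_ h _] := hA i; apply: h.
  by split=> //; exists x.
have : (leb `[0%R, 1%R[ <= \sum_(i <oo) leb (A i))%E.
  apply: measure_sigma_subadditive => //; first by move=> i; case: (hA i).
rewrite /leb lebesgue_measure_itv /= lte_fin ltr01 oppr0 adde0; apply/negP; rewrite -ltNge.
apply: (@le_lt_trans _ _ (\sum_(i <oo) (K%:E * diam_pow s' (U i) + (4^-1 / (2 ^ i.+1)%:R)%:E))%E).
  by apply: lee_nneseries => // i _; case: (hA i).
apply: le_lt_trans (epsilon_trick _ _ _) _.
- by move=> i; rewrite mule_ge0 ?lee_fin ?(ltW K0)// diam_pow_ge0.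
- exact: ltW.
rewrite nneseriesZl; last by move=> i _; exact: diam_pow_ge0.
apply: (@le_lt_trans _ _ (K%:E * e%:E + (4^-1)%:E)%E).
  by rewrite leeD2r// lee_wpmul2l ?lee_fin ?(ltW K0)// ltW.
rewrite -EFinM -EFinD lte_fin.
have -> : K * e = 2^-1 - e by rewrite /e; field; rewrite gt_eqF.
by lra.
Qed.

End coded_points.

End mass_distribution.

(** * Typical concatenations of independent blocks *)

Section law_of_large_numbers.
Context {R : realType} (A : finType) (w : A -> R).
Hypotheses (w_ge0 : forall x, 0 <= w x) (w_sum : \sum_x w x = 1).
Implicit Types (f : A -> R) (s : seq A).

Let W s : R := \prod_(x <- s) w x.

Lemma prod_weight_ge0 s : 0 <= W s.
Proof. by apply: prodr_ge0 => x _. Qed.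

(** Variances of independent centred variables add up. *)
Lemma prod_weight_moments f V K : \sum_x w x * f x = 0 -> \sum_x w x * f x ^+ 2 = V ->
  [/\ \sum_(s : K.-tuple A) W s = 1,
      \sum_(s : K.-tuple A) W s * (\sum_(x <- s) f x) = 0 &
      \sum_(s : K.-tuple A) W s * (\sum_(x <- s) f x) ^+ 2 = K%:R * V].
Proof.
move=> f0 fV; elim: K => [|K [I0 I1 I2]].
  rewrite (sum_tuple0 W) (sum_tuple0 (fun s => W s * (\sum_(x <- s) f x))).
  rewrite (sum_tuple0 (fun s => W s * (\sum_(x <- s) f x) ^+ 2)) /W !big_nil.
  by rewrite expr0n !mulr0 mul0r.
have Wc x s : W (x :: s) = w x * W s by rewrite /W big_cons.
rewrite (sum_tuple_cons W) (sum_tuple_cons (fun s => W s * (\sum_(x <- s) f x))).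
rewrite (sum_tuple_cons (fun s => W s * (\sum_(x <- s) f x) ^+ 2)); split.
- rewrite -I0; apply: eq_bigr => s _; under eq_bigr do rewrite Wc.
  by rewrite -mulr_suml w_sum mul1r.
- rewrite -[RHS]I1; apply: eq_bigr => s _.
  transitivity (\sum_x (W s * (w x * f x) + W s * (\sum_(y <- s) f y) * w x)).
    by apply: eq_bigr => x _; rewrite Wc big_cons; ring.
  by rewrite big_split /= -!mulr_sumr f0 w_sum mulr0 mulr1 add0r.
- transitivity (\sum_(s : K.-tuple A) (W s * V + W s * (\sum_(y <- s) f y) ^+ 2)); last first.
    by rewrite big_split /= -mulr_suml I0 I2 -natr1; ring.
  apply: eq_bigr => s _.
  transitivity (\sum_x (W s * (w x * f x ^+ 2) +
      (W s * (\sum_(y <- s) f y) * 2) * (w x * f x) + W s * (\sum_(y <- s) f y) ^+ 2 * w x)).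
    by apply: eq_bigr => x _; rewrite Wc big_cons; ring.
  by rewrite !big_split /= -!mulr_sumr fV f0 w_sum mulr0 mulr1 addr0.
Qed.

Lemma chebyshev f K e : 0 < e -> \sum_x w x * f x = 0 ->
  \sum_(s : K.-tuple A | `|\sum_(x <- s) f x| > K%:R * e) W s <=
  (\sum_x w x * f x ^+ 2) / (K%:R * e ^+ 2).
Proof.
move=> e0 f0; have [I0 I1 I2] := prod_weight_moments K f0 erefl.
have [->|K0] := eqVneq K 0%N.
  rewrite !mul0r invr0 mulr0 big1// => s; rewrite [s]tuple0 big_nil normr0.
  by rewrite ltxx.
have Kgt : 0 < K%:R :> R by rewrite ltr0n lt0n.
have Ke : 0 < K%:R * e by rewrite mulr_gt0.
rewrite ler_pdivlMr ?mulr_gt0 ?exprn_gt0// -(ler_pM2l Kgt) -[leRHS]I2.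
rewrite [leRHS](bigID (fun s : K.-tuple A => `|\sum_(x <- s) f x| > K%:R * e)) /=.
apply: ler_wpDr.
  by apply: sumr_ge0 => s _; rewrite mulr_ge0 ?prod_weight_ge0 ?sqr_ge0.
rewrite mulrCA mulr_suml; apply: ler_sum => s big; apply: ler_wpM2l; first exact: prod_weight_ge0.
rewrite mulrA -expr2 -exprMn -[leRHS]real_normK ?num_real//.
by rewrite ler_sqr ?nnegrE ?(ltW big)// ltW.
Qed.

(** Half of the mass sits on the tuples that are typical both for [f] and for
    the information [- ln w]; each of these has weight close to
    [expR (- K H)], so there are about [expR (K H)] of them. *)
Lemma typical_tuples f (c H : R) : c = \sum_x w x * f x -> H = - \sum_x w x * ln (w x) ->
  exists K0, forall K, (K0 <= K)%N ->
    expR (K%:R * (H - 1)) / 2 <=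
    #|[pred s : K.-tuple A | (W s > 0) && (`|\sum_(x <- s) f x - K%:R * c| <= K%:R)]|%:R.
Proof.
move=> cE HE; pose f1 x := f x - c; pose f2 x := - ln (w x) - H.
have f10 : \sum_x w x * f1 x = 0.
  under eq_bigr do rewrite /f1 mulrBr.
  by rewrite sumrB -cE -mulr_suml w_sum mul1r subrr.
have f20 : \sum_x w x * f2 x = 0.
  under eq_bigr do rewrite /f2 mulrBr mulrN.
  by rewrite sumrB sumrN -HE -mulr_suml w_sum mul1r subrr.
pose V := \sum_x w x * f1 x ^+ 2 + \sum_x w x * f2 x ^+ 2.
have V0 : 0 <= V.
  by rewrite addr_ge0//; apply: sumr_ge0 => x _; rewrite mulr_ge0 ?sqr_ge0.
pose K0 := (Num.truncn (2 * V)).+1; exists K0 => K KK0.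
have VK : 2 * V <= K%:R.
  by apply: le_trans (ltW (truncnS_gt _)) _; rewrite ler_nat.
have K1 : 0 < K%:R :> R by rewrite ltr0n (leq_trans _ KK0).
have [I0 _ _] := prod_weight_moments K f10 erefl.
have B1 := chebyshev K ltr01 f10; have B2 := chebyshev K ltr01 f20.
rewrite expr1n mulr1 in B1 B2.
pose D1 (s : K.-tuple A) := `|\sum_(x <- s) f1 x| > K%:R.
pose D2 (s : K.-tuple A) := `|\sum_(x <- s) f2 x| > K%:R.
have half : 2^-1 <= \sum_(s : K.-tuple A | ~~ D1 s && ~~ D2 s) W s.
  have : 1 <= \sum_(s : K.-tuple A | D1 s) W s + \sum_(s : K.-tuple A | D2 s) W s +
      \sum_(s : K.-tuple A | ~~ D1 s && ~~ D2 s) W s.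
    rewrite -I0 [X in _ <= X + _ + _]big_mkcond [X in _ <= _ + X + _]big_mkcond.
    rewrite [X in _ <= _ + X]big_mkcond /= -!big_split /=; apply: ler_sum => s _.
    have := prod_weight_ge0 s; case: (D1 s); case: (D2 s) => /=; lra.
  have : V / K%:R <= 2^-1 by rewrite ler_pdivrMr// ler_pdivlMl.
  move: B1 B2; rewrite -!/(D1 _) -!/(D2 _) /V mulrDl.
  set b1 := (_ / _); set b2 := (_ / _); set u1 := \sum_(s | D1 s) _.
  by set u2 := \sum_(s | D2 s) _; lra.
have lnW s : 0 < W s -> W s = expR (\sum_(x <- s) ln (w x)).
  elim: s => [|x s IH]; first by rewrite /W !big_nil expR0.
  rewrite /W !big_cons -/(W s) => xs.
  have xs0 : w x != 0 by apply: contraTneq xs => ->; rewrite mul0r ltxx.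
  have x0 : 0 < w x by rewrite lt_neqAle eq_sym xs0 w_ge0.
  by rewrite expRD lnK ?posrE// -IH//; move: xs; rewrite pmulr_rgt0.
have sumf g k (s : K.-tuple A) : \sum_(x <- s) (g x - k) = \sum_(x <- s) g x - K%:R * k :> R.
  by rewrite sumrB big_const_seq count_predT size_tuple iter_addr_0 mulr_natl.
set S := [pred s | _].
have : \sum_(s : K.-tuple A | ~~ D1 s && ~~ D2 s) W s <= \sum_(s in S) expR (- (K%:R * (H - 1))).
  rewrite [leLHS]big_mkcond [leRHS]big_mkcond; apply: ler_sum => s _.
  case: ifP => [/andP[d1 d2]|_]; last by case: ifP => // _; exact: expR_ge0.
  have := prod_weight_ge0 s; rewrite le_eqVlt => /orP[/eqP <-|s0].
    by case: ifP => // _; exact: expR_ge0.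
  rewrite inE s0 /=; move: d1; rewrite /D1 -leNgt sumf => ->.
  rewrite lnW// ler_expR; move: d2; rewrite /D2 -leNgt sumf sumrN ler_norml => /andP[d2 _].
  by lra.
rewrite sumr_const -[expR _ *+ _]mulr_natl => h.
by move: (le_trans half h); rewrite expRN ler_pdivlMr ?expR_gt0// mulrC.
Qed.

End law_of_large_numbers.

Section many_words.
Context {R : realType} (beta : R) (hbeta : 1 < beta < 2) (m : nat).
Hypotheses (hm : (2 <= m)%N).

Let beta_gt1 : 1 < beta. Proof. by case/andP: hbeta. Qed.
Let beta_gt0 : 0 < beta. Proof. exact: lt_trans beta_gt1. Qed.

(** Words that any good sequence may follow. *)
Definition closing (w : seq bool) : Prop :=
  exists2 c, good beta m (nth false c) & w = c ++ nseq m false.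

Definition catseq (w : seq bool) (y : nat -> bool) : nat -> bool :=
  fun i => if (i < size w)%N then nth false w i else y (i - size w)%N.

Lemma shiftn_catseq w y : shiftn (size w) (catseq w y) = y.
Proof. by apply/funext => i; rewrite /shiftn /catseq ltnNge leq_addr /= addKn. Qed.

Lemma catseq_nth w v : catseq w (nth false v) = nth false (w ++ v).
Proof. by apply/funext => i; rewrite /catseq nth_cat. Qed.

Lemma closing_good w y : closing w -> good beta m y -> good beta m (catseq w y).
Proof.
move=> [c gc ->] gy; have s : size (c ++ nseq m false) = (size c + m)%N.
  by rewrite size_cat size_nseq.
apply: (good_join hbeta gc) => [i ic|]; last by rewrite -s shiftn_catseq.
rewrite /catseq s ic nth_cat nth_nseq; case: ltnP => // ci.
by rewrite nth_default//; case: ifP.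
Qed.

Lemma closing_cat u w : closing u -> closing w -> closing (u ++ w).
Proof.
move=> cu [c gc ->]; exists (u ++ c); last by rewrite catA.
by rewrite -catseq_nth; exact: closing_good.
Qed.

Lemma closing_flatten (s : seq (seq bool)) : s != [::] ->
  (forall w, w \in s -> closing w) -> closing (flatten s).
Proof.
case: s => // w s _; elim: s w => [|v s IH] w h.
  by rewrite /= cats0; apply: h; rewrite inE.
rewrite [flatten _]/=; apply: closing_cat; first by apply: h; rewrite inE eqxx.
by apply: IH => x xs; apply: h; rewrite inE xs orbT.
Qed.

Lemma closing_pad w n : closing w -> closing (w ++ nseq n false).
Proof.
move=> [c gc ->]; exists (c ++ nseq n false); last by rewrite -!catA -!nseqD addnC.
apply: (good_le hbeta _ gc) => i; rewrite nth_cat nth_nseq.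
by case: ltnP => // _; case: ifP.
Qed.

Definition block_word (L r : nat) (s : seq (L.-tuple bool)) : seq bool :=
  flatten [seq tval c ++ nseq m false | c <- s] ++ nseq r false.

Lemma size_block_word L r (s : seq (L.-tuple bool)) :
  size (block_word r s) = (size s * (L + m) + r)%N.
Proof.
rewrite size_cat size_nseq; congr (_ + _)%N.
by elim: s => //= c s IH; rewrite !size_cat size_tuple size_nseq IH mulSn.
Qed.

Lemma zeros_block_word L r (s : seq (L.-tuple bool)) :
  zeros (block_word r s) = (\sum_(c <- s) zeros c + size s * m + r)%N.
Proof.
rewrite /zeros count_cat count_nseq mul1n; congr (_ + _)%N.
elim: s => [|c s IH]; first by rewrite big_nil.
by rewrite big_cons /= !count_cat IH count_nseq mul1n mulSn; lia.
Qed.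

Lemma block_word_inj L r K : injective (fun s : K.-tuple (L.-tuple bool) => block_word r s).
Proof.
move=> s t /eqP; rewrite /block_word eqseq_cat; last first.
  have := size_block_word r s; have := size_block_word r t.
  by rewrite !size_cat !size_tuple => <- /addIn ->.
case/andP => /eqP e _; apply/val_inj => /=; move: e (size_tuple s) (size_tuple t).
move: (tval s) (tval t) => {s t} u v; elim: K u v => [|K IH] [|x u] [|y v] //= e [su] [sv].
move/eqP: e; rewrite eqseq_cat ?size_cat ?size_tuple//.
rewrite eqseq_cat ?size_tuple// => /andP[/andP[/eqP/val_inj -> _] /eqP e].
by congr (_ :: _); apply: IH.
Qed.

(** Words [c 0^m] with [c] drawn from the Markov extension of [q] are concatenated,
    and zeros fill the remaining places. The added zeros have a proportion that
    tends to 0 when [c] is long and [j] much longer. *)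
Lemma many_words q eta : block_law beta m q -> 0 < eta ->
  exists J, forall j, (J <= j)%N -> exists W : seq (seq bool),
    [/\ uniq W,
        forall w, w \in W -> [/\ size w = j, closing w &
          `|(zeros w)%:R - q [:: false] * j%:R| <= eta * j%:R] &
        expR (j%:R * (block_entropy m q - eta)) <= (size W)%:R].
Proof.
move=> bq eta0; pose p := markov_ext m q; pose h := block_entropy m q.
have h0 : 0 <= h := block_entropy_ge0 hm bq.
pose a := q [:: false].
have a01 : 0 <= a <= 1.
  by apply/andP; split; [apply: (bl_ge0 bq) | apply: (bl_le1 bq)] => //=; exact: ltnW.
have sp := markov_ext_stationary hm bq; have lp := st_law sp.
have nat_large (x : R) : exists n : nat, x <= n%:R.
  by exists (Num.truncn x).+1; exact: ltW (truncnS_gt _).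
(* A block of length [B] loses at most [c1], in zeros and in entropy, to the
   separating zeros and to the tolerance of [typical_tuples]. *)
pose c1 : R := m.+1%:R + (2 * m%:R * h + 1).
have [n nc] := nat_large (2 * c1 / eta).
pose L := (n + m.-1)%N; pose B := (L + m)%N.
have Bc : 2 * c1 <= eta * B%:R.
  rewrite [leRHS]mulrC -ler_pdivrMr//; apply: le_trans nc _.
  by rewrite ler_nat /B /L; lia.
pose w (c : L.-tuple bool) := p c; pose H := word_entropy p L.
have w0 c : 0 <= w c by exact: law_ge0.
have w1 : \sum_c w c = 1 by exact: law_sum.
have HE : H = - \sum_c w c * ln (w c) by [].
have cE : L%:R * a = \sum_c w c * (zeros c)%:R.
  by rewrite stationary_zeros// /p (markov_ext_small bq)//; exact: ltnW.
have Hh : B%:R * h - 2 * m%:R * h <= H.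
  rewrite /H /L /p (markov_entropy hm bq) -/h /B /L.
  have := word_entropy_ge0 m.-1 lp; rewrite -/p.
  have : (n + m.-1 + m)%:R <= n%:R + 2 * m%:R :> R.
    by rewrite -natrM -natrD ler_nat; lia.
  move=> /(ler_wpM2r h0); lra.
have [K0 hK] := typical_tuples w0 w1 cE HE.
have [J1 J1e] := nat_large (2 * (B%:R + (1 + B%:R * h)) / eta).
exists (maxn J1 (B * K0.+1)) => j; rewrite geq_max => /andP[J1j Bj].
have B0 : (0 < B)%N by rewrite /B addn_gt0 orbC (ltnW hm).
pose K := (j %/ B)%N; pose r := (j %% B)%N.
have jE : j = (K * B + r)%N := divn_eq j B.
have rB : (r < B)%N by rewrite ltn_mod.
have KK0 : (K0 < K)%N by rewrite /K leq_divRL// mulnC.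
have {}hK := hK K (ltnW KK0).
set S := [pred s : K.-tuple _ | _] in hK.
pose W := [seq block_word r s | s : K.-tuple (L.-tuple bool) in S].
have jR : j%:R = K%:R * B%:R + r%:R :> R by rewrite {1}jE natrD natrM.
have rR : r%:R <= B%:R :> R by rewrite ler_nat ltnW.
have r0 : 0 <= r%:R :> R by [].
have eJ : 2 * (B%:R + (1 + B%:R * h)) <= eta * j%:R.
  rewrite [leRHS]mulrC -ler_pdivrMr//; apply: le_trans J1e _.
  by rewrite ler_nat.
have eK : K%:R * (2 * c1) <= eta * j%:R.
  apply: le_trans (ler_wpM2l (ler0n _ K) Bc) _.
  by rewrite jR mulrCA ler_pM2l// lerDl.
have Kc : K%:R * c1 = K%:R + K%:R * m%:R + K%:R * (2 * m%:R * h + 1).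
  by rewrite /c1 -natr1; ring.
have Kp : 0 <= K%:R * (2 * m%:R * h + 1) by rewrite mulr_ge0// addr_ge0// !mulr_ge0.
have Bh : 0 <= B%:R * h by rewrite mulr_ge0.
exists W; split.
- by rewrite map_inj_in_uniq ?enum_uniq// => s t _ _ /block_word_inj.
- move=> u /mapP[s]; rewrite mem_enum inE => /andP[s0 zs] ->; split.
  + by rewrite size_block_word size_tuple -/B -jE.
  + apply/closing_pad/closing_flatten.
      by rewrite -size_eq0 size_map size_tuple -lt0n (leq_ltn_trans _ KK0).
    move=> v /mapP[c cs ->]; exists (tval c) => //.
    apply: (markov_ext_supp hm bq); rewrite -/p -/(w c); apply: contraTneq s0 => c0.
    by rewrite -leNgt (big_rem c)//= c0 mul0r.
  + rewrite zeros_block_word size_tuple !natrD natrM natr_sum -/a.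
    set T := \sum_(c <- s) _.
    have -> : T + K%:R * m%:R + r%:R - a * j%:R =
       (T - K%:R * (L%:R * a)) + (1 - a) * (K%:R * m%:R + r%:R).
      by rewrite jR /B natrD; ring.
    apply: le_trans (ler_normD _ _) _; rewrite [X in _ + X]ger0_norm; last first.
      case/andP: a01 => _ a1; apply: mulr_ge0; first by rewrite subr_ge0.
      by apply: addr_ge0 => //; exact: mulr_ge0.
    have : (1 - a) * (K%:R * m%:R + r%:R) <= K%:R * m%:R + r%:R.
      have [a0 _] := andP a01; apply: ler_piMl; last by rewrite lerBlDr lerDl.
      by apply: addr_ge0 => //; exact: mulr_ge0.
    by move: zs; rewrite -/T; lra.
- rewrite size_map -cardE; apply: le_trans hK.
  have -> : expR (K%:R * (H - 1)) / 2 = expR (K%:R * (H - 1) - ln 2).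
    by rewrite expRD expRN lnK// posrE.
  rewrite ler_expR -/h.
  have l2 : ln 2 <= 1 :> R.
    have -> : 2 = 1 + 1 :> R by [].
    by apply: le_ln1Dx; lra.
  have : K%:R * (B%:R * h - 2 * m%:R * h) <= K%:R * H by exact: ler_wpM2l.
  have : r%:R * h <= B%:R * h by exact: ler_wpM2r.
  have : j%:R * (h - eta) = (K%:R * B%:R + r%:R) * h - eta * j%:R by rewrite -jR; ring.
  have : 0 <= K%:R + K%:R * m%:R :> R by rewrite addr_ge0 ?mulr_ge0.
  by move=> ? ->; lra.
Qed.

End many_words.

(** * Concatenations of words of increasing length *)

Section moran_law.
Context {R : realType}.
Variables (W : nat -> seq (seq bool)) (j0 : nat).
Hypotheses (j0_gt0 : (0 < j0)%N)
  (W_gt0 : forall j, (j0 <= j)%N -> (0 < size (W j))%N)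
  (W_size : forall j w, (j0 <= j)%N -> w \in W j -> size w = j)
  (W_uniq : forall j, (j0 <= j)%N -> uniq (W j)).
Implicit Types (v w : seq bool) (x : nat -> bool).

Definition position k : nat := \sum_(i < k) (j0 + i).

Lemma positionS k : position k.+1 = (position k + (j0 + k))%N.
Proof. by rewrite /position big_ord_recr. Qed.

Lemma leq_position : {homo position : i k / (i <= k)%N}.
Proof.
move=> i k /subnKC <-; elim: (k - i)%N => [|d IH]; first by rewrite addn0.
by rewrite addnS positionS (leq_trans IH)// leq_addr.
Qed.

Lemma position_ge k : (k <= position k)%N.
Proof. by elim: k => // k IH; rewrite positionS; lia. Qed.

Lemma position_floor n : exists k, (position k <= n < position k.+1)%N.
Proof.
elim: n => [|n [k /andP[kn nk]]].
  by exists 0%N; rewrite positionS /position big_ord0 add0n addn0.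
have [lt|le] := ltnP n.+1 (position k.+1); first by exists k; rewrite lt (leq_trans kn).
exists k.+1; rewrite (positionS k.+1) le /=; move: nk le; lia.
Qed.

(** The probability that a word chosen uniformly in [W j] begins with [v]. *)
Definition prefix_freq j v : R := (count (prefix v) (W j))%:R / (size (W j))%:R.

Lemma prefix_freq_ge0 j v : 0 <= prefix_freq j v.
Proof. by rewrite divr_ge0. Qed.

Lemma prefix_freq_le1 j v : (j0 <= j)%N -> prefix_freq j v <= 1.
Proof.
move=> jj; rewrite ler_pdivrMr ?ltr0n ?W_gt0// mul1r ler_nat.
exact: count_size.
Qed.

Lemma prefix_freq_nil j : (j0 <= j)%N -> prefix_freq j [::] = 1.
Proof.
move=> jj; rewrite /prefix_freq (eq_count (a2 := predT)) ?count_predT; last first.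
  by move=> u; rewrite prefix0s.
by rewrite divff// pnatr_eq0 -lt0n W_gt0.
Qed.

Lemma prefix_freq_rcons j v : (j0 <= j)%N -> (size v < j)%N ->
  prefix_freq j (rcons v false) + prefix_freq j (rcons v true) = prefix_freq j v.
Proof.
move=> jj vj; rewrite /prefix_freq -mulrDl -natrD; congr (_%:R / _).
rewrite -!sum1_count [LHS]addnC [RHS]big_mkcond.
rewrite [X in (X + _)%N]big_mkcond [X in (_ + X)%N]big_mkcond -big_split /=.
apply: eq_big_seq => u uW.
have vu : (size v < size u)%N by rewrite (W_size jj uW).
rewrite !prefixE !size_rcons (take_nth false vu) !eqseq_rcons.
by case: eqP; case: (nth _ _ _).
Qed.

Lemma prefix_freq_full j v : (j0 <= j)%N -> size v = j ->
  prefix_freq j v <= (size (W j))%:R^-1.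
Proof.
move=> jj vj; rewrite /prefix_freq ler_piMl ?invr_ge0// (ler_nat R _ 1).
rewrite (eq_in_count (a2 := pred1 v)) ?count_uniq_mem ?W_uniq ?leq_b1// => u uW /=.
by rewrite prefixE vj -{1}(W_size jj uW) take_size.
Qed.

(** The [i]-th factor concerns the part of [w] covered by the [i]-th word; it is 1
    beyond the end of [w]. *)
Definition moran_prod N w : R :=
  \prod_(i < N) prefix_freq (j0 + i) (take (j0 + i) (drop (position i) w)).

Definition moran_law w : R := moran_prod (size w).+1 w.

Lemma moran_prodE N w : (size w < N)%N -> moran_law w = moran_prod N w.
Proof.
move=> wN; rewrite -(subnKC wN); elim: (N - _)%N => [|d IH]; first by rewrite addn0.
rewrite addnS /moran_prod big_ord_recr -/(moran_prod _ _) -IH /= drop_oversize.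
  by rewrite prefix_freq_nil ?leq_addr// mulr1.
by apply: leq_trans (position_ge _); lia.
Qed.

Lemma moran_law_law : law moran_law.
Proof.
split=> [|w|w].
- by rewrite /moran_law /moran_prod big_ord1 prefix_freq_nil// leq_addr.
- by apply: prodr_ge0 => i _; exact: prefix_freq_ge0.
have [k /andP[kw wk]] := position_floor (size w).
have kN : (k < (size w).+2)%N by have := position_ge k; lia.
have D u : size u = (size w).+1 \/ u = w -> moran_law u =
    prefix_freq (j0 + k) (take (j0 + k) (drop (position k) u)) *
    \prod_(i < (size w).+2 | i != Ordinal kN)
      prefix_freq (j0 + i) (take (j0 + i) (drop (position i) u)).
  move=> su; rewrite (@moran_prodE (size w).+2); last by case: su => ->.
  by rewrite /moran_prod (bigD1 (Ordinal kN)).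
rewrite !D ?size_rcons; [|by right|by left|by left].
have outer b i : i != k ->
    take (j0 + i) (drop (position i) (rcons w b)) = take (j0 + i) (drop (position i) w).
  move=> ik; have [lt|le] := leqP i k.
    have {}lt : (i < k)%N by rewrite ltn_neqAle ik.
    have iw : (position i + (j0 + i) <= size w)%N.
      by rewrite -positionS (leq_trans _ kw)// leq_position.
    rewrite drop_rcons; last by lia.
    by rewrite -cats1 takel_cat// size_drop; lia.
  have iw : (size w < position i)%N by rewrite (leq_trans wk)// leq_position.
  by rewrite !drop_oversize ?size_rcons// ltnW.
under eq_bigr => i ik do rewrite outer//.
under [X in _ + _ * X]eq_bigr => i ik do rewrite outer//.
rewrite -mulrDl; congr (_ * _).
have sk : (size (drop (position k) w) < j0 + k)%N.
  by rewrite size_drop; move: wk; rewrite positionS; lia.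
rewrite !drop_rcons// !(@take_oversize _ (j0 + k)) ?size_rcons//; last exact: ltnW.
by rewrite prefix_freq_rcons// leq_addr.
Qed.

(** Each complete word of length [j] has probability at most [expR (- j rho')].
    Only the last word, the [k]-th, can be incomplete; its [j0 + k] letters are
    paid by the gap between the rates on the [k] words before it, of length at
    least [j0] each. *)
Lemma moran_law_le (rho' rho : R) w : 0 <= rho -> rho <= (rho' - rho) * j0%:R ->
    (forall j, (j0 <= j)%N -> expR (j%:R * rho') <= (size (W j))%:R) ->
  moran_law w <= expR (rho * j0%:R) * expR (- ((size w)%:R * rho)).
Proof.
move=> rho0 rhoj Wrho; have [k /andP[kw wk]] := position_floor (size w).
have kN : (k <= (size w).+1)%N by have := position_ge k; lia.
have shorter N : (k <= N)%N -> moran_prod N w <= moran_prod k w.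
  move=> /subnKC <-; elim: (N - k)%N => [|d IH]; first by rewrite addn0.
  apply: le_trans IH; rewrite addnS /moran_prod big_ord_recr /= ler_piMr//.
    by apply: prodr_ge0 => i _; exact: prefix_freq_ge0.
  by rewrite prefix_freq_le1// leq_addr.
apply: le_trans (shorter _ kN) _.
apply: (@le_trans _ _ (expR (- ((position k)%:R * rho')))).
  have -> : - ((position k)%:R * rho') = \sum_(i < k) (- ((j0 + i)%:R * rho')).
    by rewrite sumrN -mulr_suml /position natr_sum.
  rewrite expR_sum; apply: ler_prod => i _; rewrite prefix_freq_ge0 /=.
  have iw : (position i + (j0 + i) <= size w)%N.
    by rewrite -positionS (leq_trans _ kw)// leq_position.
  apply: le_trans (prefix_freq_full _ _) _; first exact: leq_addr.
    by rewrite size_takel// size_drop; lia.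
  rewrite expRN lef_pV2 ?posrE ?expR_gt0 ?ltr0n ?W_gt0 ?leq_addr//.
  by apply: Wrho; exact: leq_addr.
rewrite -expRD ler_expR.
have : (size w)%:R <= (position k)%:R + (j0%:R + k%:R) :> R.
  by rewrite -!natrD ler_nat -positionS ltnW.
move/(ler_wpM2r rho0).
have kj : k%:R * j0%:R <= (position k)%:R :> R.
  rewrite -natrM ler_nat; elim: (k) => // i IH; rewrite positionS mulSn; lia.
have r' : 0 <= rho' - rho.
  by have := le_trans rho0 rhoj; rewrite pmulr_lge0// ltr0n.
have := ler_wpM2l r' kj; have := ler_wpM2l (ler0n R k) rhoj; lra.
Qed.

Lemma moran_blocks x : (forall n, 0 < moran_law (mkseq x n)) ->
  forall i, mkseq (shiftn (position i) x) (j0 + i) \in W (j0 + i).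
Proof.
move=> x0 i; have := x0 (position i.+1).
rewrite (@moran_prodE (position i.+1).+1) ?size_mkseq// /moran_prod.
have iN : (i < (position i.+1).+1)%N by have := position_ge i.+1; lia.
rewrite (bigD1 (Ordinal iN)) //= => h.
have {h} : prefix_freq (j0 + i)
    (take (j0 + i) (drop (position i) (mkseq x (position i.+1)))) != 0.
  by apply: contraTneq h => ->; rewrite mul0r ltxx.
have -> : take (j0 + i) (drop (position i) (mkseq x (position i.+1))) =
    mkseq (shiftn (position i) x) (j0 + i).
  have s : size (drop (position i) (mkseq x (position i.+1))) = (j0 + i)%N.
    by rewrite size_drop size_mkseq positionS addKn.
  rewrite take_oversize ?s//; apply: (@eq_from_nth _ false); rewrite s ?size_mkseq// => l li.
  by rewrite nth_drop !nth_mkseq// positionS ltn_add2l.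
rewrite mulf_eq0 negb_or pnatr_eq0 -lt0n -has_count => /andP[/hasP[u uW pu] _].
move: pu; rewrite prefixE size_mkseq -{1}(W_size (leq_addr i j0) uW) take_size => /eqP <-.
exact: uW.
Qed.

End moran_law.

(** * The lower bound *)

Section lower_bound.
Context {R : realType} (beta : R) (hbeta : 1 < beta < 2) (m : nat).
Hypotheses (hm : (2 <= m)%N) (hdigit : digit beta 1 m = 1%Z)
  (hfinite : forall i : nat, (m < i)%N -> digit beta 1 i = 0%Z).

Let beta_gt1 : 1 < beta. Proof. by case/andP: hbeta. Qed.
Let beta_gt0 : 0 < beta. Proof. exact: lt_trans beta_gt1. Qed.
Let lnb_gt0 : 0 < ln beta. Proof. exact: ln_gt0. Qed.

(** For each [j], take the smallest tolerance for which [many_words] provides words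
    of this length. *)
Lemma choose_words q (rho : R) : block_law beta m q -> rho < block_entropy m q ->
  exists (J0 : nat) (W : nat -> seq (seq bool)),
  (forall j, (J0 <= j)%N -> [/\ uniq (W j),
      forall w, w \in W j -> size w = j /\ closing beta m w &
      expR (j%:R * rho) <= (size (W j))%:R]) /\
  (forall e, 0 < e -> exists J, forall j, (J <= j)%N -> forall w, w \in W j ->
      `|(zeros w)%:R - q [:: false] * j%:R| <= e * j%:R).
Proof.
move=> bq rq; pose h := block_entropy m q.
pose eta (k : nat) : R := Num.min (h - rho) k.+1%:R^-1.
have eta0 k : 0 < eta k by rewrite lt_min subr_gt0 rq invr_gt0 ltr0n.
have eta_le i k : (i <= k)%N -> eta k <= eta i.
  move=> ik; rewrite /eta le_min !ge_min lexx /= orbC.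
  by rewrite lef_pV2 ?posrE ?ltr0n// ler_nat ltnS ik.
have /choice[J hJ] k := many_words hbeta hm bq (eta0 k).
(* The largest [k] with [J k <= j] serves all smaller [k] as well, since [eta]
   decreases. *)
have /choice[W hW] j : exists V : seq (seq bool), (J 0 <= j)%N ->
    [/\ uniq V, forall w, w \in V -> size w = j /\ closing beta m w,
        expR (j%:R * rho) <= (size V)%:R &
        forall k, (k <= j)%N -> (J k <= j)%N -> forall w, w \in V ->
          `|(zeros w)%:R - q [:: false] * j%:R| <= eta k * j%:R].
  have [jj|_] := leqP (J 0) j; last by exists [::].
  have [k Jk kmax] : exists2 k, (J k <= j)%N &
      forall i, (i <= j)%N -> (J i <= j)%N -> (i <= k)%N.
    have := @arg_maxnP _ (ord0 : 'I_j.+1) (fun k => J k <= j)%N (fun k => k : nat) jj.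
    case=> k Jk km; exists k => // i ij Ji.
    by have := km (Ordinal (n := j.+1) ij); apply.
  have [V [uV Vw Vs]] := hJ k j Jk; exists V => _; split=> // [w /Vw[]//||i ij Ji w /Vw[_ _]].
    apply: le_trans Vs; rewrite ler_expR ler_wpM2l// lerBrDr addrC -lerBrDr.
    by rewrite /eta ge_min lexx.
  by move=> zw; apply: le_trans zw _; rewrite ler_wpM2r// eta_le// kmax.
exists (J 0), W; split=> [j /hW[]//|e e0].
have [k ke] : exists k, eta k <= e.
  exists (Num.truncn e^-1); rewrite /eta ge_min; apply/orP; right.
  by rewrite invf_ple ?posrE ?ltr0n//; exact: ltW (truncnS_gt _).
exists (maxn (J 0) (maxn k (J k))) => j; rewrite !geq_max => /and3P[jJ kj Jk] w wW.
have [_ _ _ h0] := hW j jJ; apply: le_trans (h0 k kj Jk w wW) _.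
by rewrite ler_wpM2r.
Qed.

Lemma mkseqD x n k : mkseq x (n + k) = mkseq x n ++ mkseq (shiftn n x) k :> seq bool.
Proof.
rewrite /mkseq iotaD map_cat add0n; congr (_ ++ _).
rewrite -[n in iota n]addn0 iotaDl -map_comp; exact: eq_map.
Qed.

Lemma closing_nth w : closing beta m w -> good beta m (nth false w).
Proof.
move=> [c gc ->]; apply: (good_le hbeta _ gc) => i; rewrite nth_cat nth_nseq.
by case: ltnP => // _; case: ifP.
Qed.

Lemma zeros_size w : (zeros w <= size w)%N.
Proof. exact: count_size. Qed.

Section block_sequence.
Variables (W : nat -> seq (seq bool)) (j0 : nat) (a : R) (x : nat -> bool).
Hypotheses (j0_gt0 : (0 < j0)%N) (a01 : 0 <= a <= 1)
  (Wc : forall j w, (j0 <= j)%N -> w \in W j -> closing beta m w)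
  (Wz : forall e, 0 < e -> exists J, forall j, (J <= j)%N -> forall w, w \in W j ->
      `|(zeros w)%:R - a * j%:R| <= e * j%:R)
  (Wx : forall i, mkseq (shiftn (position j0 i) x) (j0 + i) \in W (j0 + i)).

Let pos := position j0.
Let block i := mkseq (shiftn (pos i) x) (j0 + i).

Lemma mkseq_position k : mkseq x (pos k.+1) = mkseq x (pos k) ++ block k.
Proof. by rewrite /pos positionS mkseqD. Qed.

Lemma blocks_closing k : closing beta m (mkseq x (pos k.+1)).
Proof.
elim: k => [|k IH]; rewrite mkseq_position.
  rewrite {1}/pos /position big_ord0; apply: Wc (Wx 0%N); exact: leq_addr.
apply: closing_cat IH _ => //; apply: Wc (Wx k.+1); exact: leq_addr.
Qed.

Lemma blocks_good : good beta m x.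
Proof.
move=> k; pose w := mkseq x (pos (k + m).+1).
have gw : good beta m (nth false w).
  exact: closing_nth (blocks_closing _).
have := gw k; congr (_ < _); apply: eq_bval => i im.
rewrite /shiftn nth_mkseq//; apply: leq_trans (position_ge j0_gt0 _).
by rewrite ltnS leq_add2l ltnW.
Qed.

Lemma blocks_windows n : exists q, forall i, (n + q <= i < n + q + m)%N -> x i = false.
Proof.
have [c _ ce] := Wc (leq_addr n j0) (Wx n).
have sc : (j0 + n = size c + m)%N.
  by rewrite -[LHS](size_mkseq (shiftn (pos n) x)) -/pos ce size_cat size_nseq.
have np := position_ge j0_gt0 n; exists (pos n + size c - n)%N => i.
rewrite subnKC; last by rewrite (leq_trans np)// leq_addr.
move=> /andP[ci ic]; have pi : (pos n <= i)%N by apply: leq_trans ci; exact: leq_addr.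
have <- : shiftn (pos n) x (i - pos n) = x i by rewrite /shiftn subnKC.
have ib : (i - pos n < j0 + n)%N by rewrite ltn_subLR// sc addnA.
rewrite -[LHS](nth_mkseq false _ ib) ce nth_cat nth_nseq.
have -> : (i - pos n < size c)%N = false.
  by apply/negbTE; rewrite -leqNgt leq_subRL.
by case: ifP.
Qed.

Let dev w : R := `|(zeros w)%:R - a * (size w)%:R|.

Let dev_le w : dev w <= (size w)%:R.
Proof.
have zw : (zeros w)%:R <= (size w)%:R :> R by rewrite ler_nat zeros_size.
have [a0 a1] := andP a01; have s0 : 0 <= (size w)%:R :> R by [].
have := ler_wpM2r s0 a1; have := mulr_ge0 a0 s0; have : 0 <= (zeros w)%:R :> R by [].
by rewrite /dev ler_norml; move=> *; apply/andP; split; lra.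
Qed.

Let dev_cat u w : dev (u ++ w) <= dev u + dev w.
Proof.
rewrite /dev /zeros count_cat size_cat !natrD; apply: le_trans (ler_normD _ _).
by rewrite le_eqVlt; apply/orP; left; apply/eqP; congr `|_|; ring.
Qed.

(** The number of blocks of a prefix and the length of its last block are
    negligible because the blocks get longer. *)
Lemma blocks_zeros e : 0 < e -> exists C, forall n, dev (mkseq x n) <= e * n%:R + C.
Proof.
move=> e0; have e2 : 0 < e / 2 by rewrite divr_gt0.
have [J1 hJ1] := Wz e2; pose J := maxn J1 (Num.truncn (e / 2)^-1).+1.
have J1J : (J1 <= J)%N by exact: leq_maxl.
have Je : 1 <= e / 2 * J%:R.
  rewrite -ler_pdivrMl// mulr1; apply: le_trans (ltW (truncnS_gt _)) _.
  by rewrite ler_nat leq_maxr.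
pose C1 : R := (pos J)%:R + J%:R.
have hk k : dev (mkseq x (pos k)) + k%:R <= e * (pos k)%:R + C1.
  have [kJ|/ltnW Jk] := leqP k J.
    have := dev_le (mkseq x (pos k)); rewrite size_mkseq.
    have : (pos k)%:R <= (pos J)%:R :> R by rewrite ler_nat leq_position.
    have : k%:R <= J%:R :> R by rewrite ler_nat.
    have : 0 <= e * (pos k)%:R by rewrite mulr_ge0// ltW.
    by rewrite /C1; lra.
  rewrite -(subnKC Jk); elim: (k - J)%N => [|d IH].
    rewrite addn0; have := dev_le (mkseq x (pos J)); rewrite size_mkseq.
    have : 0 <= e * (pos J)%:R by rewrite mulr_ge0// ltW.
    by rewrite /C1; lra.
  rewrite addnS mkseq_position; have := dev_cat (mkseq x (pos (J + d))) (block (J + d)).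
  have Jd : (J <= j0 + (J + d))%N by lia.
  have : dev (block (J + d)) <= e / 2 * (j0 + (J + d))%:R.
    by rewrite /dev size_mkseq; exact: hJ1 (leq_trans J1J Jd) _ (Wx _).
  have : e / 2 * J%:R <= e / 2 * (j0 + (J + d))%:R by rewrite ler_pM2l// ler_nat.
  have -> : (pos (J + d).+1)%:R = (pos (J + d))%:R + (j0 + (J + d))%:R :> R.
    by rewrite -natrD /pos positionS.
  by rewrite -(natr1 (J + d)); lra.
exists (C1 + j0%:R) => n; have [k /andP[kn nk]] := position_floor j0_gt0 n.
rewrite -(subnKC kn) mkseqD; apply: le_trans (dev_cat _ _) _.
have := dev_le (mkseq (shiftn (pos k) x) (n - pos k)); rewrite size_mkseq.
have : (n - pos k)%:R <= j0%:R + k%:R :> R.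
  by rewrite -natrD ler_nat; move: nk; rewrite positionS -/pos; lia.
have : e * (pos k)%:R <= e * (pos k + (n - pos k))%:R by rewrite ler_pM2l// ler_nat leq_addr.
by have := hk k; lra.
Qed.

Lemma blocks_point : exists z, [/\ frequency_set beta a z, 0 <= z < 1 & dig beta z =1 x].
Proof.
have [z01 zx] := seqval_digits hbeta hm hdigit hfinite blocks_good blocks_windows.
set z := seqval beta x in z01 zx; exists z.
have z01' : 0 <= z <= 1 by case/andP: z01 => -> /ltW ->.
have dx : dig beta z =1 x.
  by move=> i; have := zx i; rewrite (digitE hbeta)//; case: (x i); case: (dig beta z i).
split=> //; split=> //; apply/cvgrPdist_lt => e e0.
have e2 : 0 < e / 2 by rewrite divr_gt0.
have [C hC] := blocks_zeros e2.
near=> n; have n0 : (0 < n)%N by near: n; exact: nbhs_infty_gt.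
have nR : 0 < n%:R :> R by rewrite ltr0n.
have nC : C < e / 2 * n%:R.
  rewrite -ltr_pdivrMl//; apply: lt_le_trans (truncnS_gt _) _.
  by rewrite ler_nat; near: n; exact: nbhs_infty_ge.
rewrite -(zeros_mkseq hbeta _ z01) (eq_mkseq dx) distrC.
rewrite -(ltr_pM2r nR) -{2}(gtr0_norm nR) -normrM mulrBl divfK ?gt_eqF//.
have := hC n; rewrite /dev size_mkseq => h; apply: le_lt_trans h _.
by lra.
Unshelve. all: by end_near. Qed.

End block_sequence.

(** A rate between [s * ln beta] and the entropy leaves the gap that
    [moran_law_le] needs. *)
Lemma frequency_measure_neq0 q (s : R) : block_law beta m q -> 0 <= s ->
    s * ln beta < block_entropy m q ->
  hausdorff_measure s (frequency_set beta (q [:: false])) <> 0%E.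
Proof.
move=> bq s0 sh; set h := block_entropy m q in sh.
pose rho := s * ln beta; pose rho' := (rho + h) / 2.
have rho0 : 0 <= rho by rewrite mulr_ge0// ltW.
have rr : 0 < rho' - rho by rewrite /rho' /rho; lra.
have rh : rho' < h by rewrite /rho' /rho; lra.
have [J0 [W [hW Wz]]] := choose_words bq rh.
pose j0 := maxn J0 (Num.truncn (rho / (rho' - rho))).+1.
have j0_gt0 : (0 < j0)%N by rewrite /j0 leq_max orbT.
have JW j : (j0 <= j)%N -> (J0 <= j)%N by apply: leq_trans; exact: leq_maxl.
have W0 j : (j0 <= j)%N -> (0 < size (W j))%N.
  by move=> /JW/hW[_ _ h0]; rewrite -(ltr0n R); apply: lt_le_trans h0; exact: expR_gt0.
have Ws j w : (j0 <= j)%N -> w \in W j -> size w = j by move=> /JW/hW[_ h0 _] /h0[].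
have Wu j : (j0 <= j)%N -> uniq (W j) by move=> /JW/hW[].
have Wc j w : (j0 <= j)%N -> w \in W j -> closing beta m w by move=> /JW/hW[_ h0 _] /h0[].
have lp := moran_law_law j0_gt0 W0 Ws (R := R).
have a01 : 0 <= q [:: false] <= 1.
  by apply/andP; split; [apply: (bl_ge0 bq) | apply: (bl_le1 bq)] => //=; exact: ltnW.
apply: (@mass_distribution _ _ hbeta _ hm hdigit hfinite (moran_law W j0) s
  (expR (rho * j0%:R))) => //.
  move=> w; rewrite -mulrA -/rho; apply: (@moran_law_le _ _ _ j0_gt0 W0 Ws Wu rho') => //.
    rewrite -ler_pdivrMl// mulrC; apply: le_trans (ltW (truncnS_gt _)) _.
    by rewrite ler_nat leq_maxr.
  by move=> j /JW/hW[].
  by rewrite s0 lexx.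
move=> t t01; apply: (blocks_point j0_gt0 a01 Wc Wz).
by apply: (moran_blocks j0_gt0 W0 Ws (R := R)) => n; exact: code_prefix_gt0.
Qed.

Lemma frequency_dim_ge q : block_law beta m q ->
  ((block_entropy m q / ln beta)%:E <= hausdorff_dim (frequency_set beta (q [:: false])))%E.
Proof.
move=> bq; apply: le_ereal_inf_tmp => _ [s [s0 Hs] <-]; rewrite lee_fin leNgt.
apply/negP => sh; apply: (frequency_measure_neq0 bq s0) Hs.
by rewrite -ltr_pdivlMr.
Qed.

End lower_bound.

Theorem theorem1p2 (R : realType) (beta : R) (hbeta : 1 < beta < 2)
    (m : nat) (hm : (2 <= m)%N)
    (hdigit : digit beta 1 m = 1%Z)
    (hfinite : forall i : nat, (m < i)%N -> digit beta 1 i = 0%Z)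
    (a : R) (ha : 0 <= a <= 1) :
  (exists M : \bar R,
     is_max [set h : \bar R |
       exists mu : probability (borel_beta_shift hbeta) R,
         [/\ invariant_measure mu (@beta_shift _ _ hbeta),
             mu (cylinder [:: false]) = a%:E,
             markov_measure m.-1 mu &
             h = entropy mu (@beta_shift _ _ hbeta)]] M /\
     hausdorff_dim (frequency_set beta a) = ((1 / ln beta)%:E * M)%E) /\
  (exists M : \bar R,
     is_max [set h : \bar R |
       exists mu : set (beta_shift_space hbeta) -> R,
         [/\ cylinder_set_function m mu,
             coordinated m a mu &
             h = (cylinder_entropy m mu)%:E]] M /\
     hausdorff_dim (frequency_set beta a) = ((1 / ln beta)%:E * M)%E).
Proof.
rewrite (markov_values hbeta hm hdigit hfinite) (coordinated_values hbeta hm hdigit hfinite).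
suff [M HM] : exists M, is_max (block_values (beta := beta) m a) M /\
    hausdorff_dim (frequency_set beta a) = ((1 / ln beta)%:E * M)%E.
  by split; exists M.
have [[q0 [bq0 q0a]]|none] := pselect (exists q, block_law beta m q /\ q [:: false] = a).
  have [q [bq qa qmax]] := max_block_entropy hm (ex_intro _ q0 (conj bq0 q0a)).
  exists (block_entropy m q)%:E; split.
    have Mv : block_values (beta := beta) m a (block_entropy m q)%:E by exists q.
    split=> [_|e]; last by move: Mv; rewrite e.
    by split=> // _ [q' [bq' q'a ->]]; rewrite lee_fin qmax.
  rewrite -EFinM mul1r mulrC; apply/eqP; rewrite eq_le; apply/andP; split.
    by apply: (frequency_dim_le hbeta hm (block_entropy_ge0 hm bq)).
  by rewrite -qa; exact: frequency_dim_ge.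
exists 0%E; split.
  split=> [[_ [q [bq qa _]]]|//]; case: none; by exists q.
rewrite mule0; apply/eqP; rewrite eq_le; apply/andP; split.
  have := @frequency_dim_le R beta hbeta m hm a 0 (lexx 0); rewrite mul0r; apply=> q bq qa.
  by case: none; exists q.
by apply: le_ereal_inf_tmp => _ [s [s0 _] <-]; rewrite lee_fin.
Qed.
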